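(* There is a decreasing sequence of numbers $2=T_0>T_1>T_2>\cdots$ converging to $0$ satisfying the following two properties: (1) For any positive integer $h$ and any $j$, $T_j\in[2/(h+1),2/h]$ implies that $T_j$ is a rational number with denominator at most $2h(h+1)$. (2) For any interval $[T_{j+1},T_j]$ there is a finite sequence (of functions of $t\in[T_{j+1},T_j]$) $$0=\Lambda_{j,0}(t)\le\Lambda_{j,1}(t)\le\cdots\le\Lambda_{j,M_j}(t)\le\Lambda_{j,M_j+1}(t)=2/t,$$ where every inequality is valid for all $t\in[T_{j+1},T_j]$. Moreover, for any pair of intervals $[T_{j+1},T_j]$ and $[\Lambda_{j,i}(t),\Lambda_{j,i+1}(t)]$ there exist constants $\kappa_{j,i,k}$ ($k\in\{1,2,\dots,8\}$), independent of $t$ and $\lambda$, such that for any $t\in[T_{j+1},T_j]$ and any $\lambda\in[\Lambda_{j,i}(t),\Lambda_{j,i+1}(t)]$ with $\lambda>0$, $$\begin{aligned}G_t(\lambda)={}&\kappa_{j,i,1}+\kappa_{j,i,2}\,t+\kappa_{j,i,3}\,\lambda t+\kappa_{j,i,4}\,\lambda t^2\\&+\kappa_{j,i,5}\,t\log(\lambda)+\kappa_{j,i,6}\,\lambda t\log(\lambda)\\&+\kappa_{j,i,7}\,t\log(t)+\kappa_{j,i,8}\,\lambda t\log(t).\end{aligned}$$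
   Context: Fix $t>0$. For a positive integer $J$ (large enough that $tJ^2>J$) let $P_{t,J}=(-tJ^2,0)$ and $O=(0,0)$, and let $\mathcal R_J=\mathbb Z^2\cap([-J,J]\times[0,J])$, a set of $N=N_J=(2J+1)(J+1)$ lattice points. For $P\in\mathcal R_J$ consider the angle $\angle(P P_{t,J} O)$ at the vertex $P_{t,J}$ between the rays from $P_{t,J}$ to $P$ and to $O$. List these $N$ angles, with multiplicity, in nondecreasing order: $0=\alpha_1\le\alpha_2\le\dots\le\alpha_N=\alpha_{\max}$. Put $\Delta_{av}=\alpha_{\max}/N_J$ and, for $\lambda>0$, $$G_{t,J}(\lambda)=\frac{1}{N_J}\#\{j:\ 1\le j\le N-1,\ \alpha_{j+1}-\alpha_j\ge\lambda\Delta_{av}\}.$$ The limiting gap distribution function is $G_t(\lambda)=\lim_{J\to\infty}G_{t,J}(\lambda)$; this limit exists for all $t>0$ and $\lambda>0$. *)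

(* Defs.v *)
From mathcomp Require Import all_boot all_order all_algebra.
From mathcomp Require Import all_classical all_reals all_analysis.
From mathcomp Require Import zify.
Import Order.TTheory GRing.Theory Num.Theory.
Import numFieldNormedType.Exports.

Set Implicit Arguments.
Unset Strict Implicit.
Unset Printing Implicit Defensive.

Local Open Scope ring_scope.

Section PlaneAngle.
Context {R : realType}.
Implicit Types (u v A V B : R * R).

Definition dot u v : R := u.1 * v.1 + u.2 * v.2.

(* The library norm on R * R is the sup norm, hence this Euclidean one. *)
Definition enorm u : R := Num.sqrt (dot u u).

(* Unoriented angle, in [0, pi], at the vertex V between the rays VA and VB.
   Only meaningful when A != V and B != V. *)
Definition angle A V B : R :=
  acos (dot (A - V) (B - V) / (enorm (A - V) * enorm (B - V))).

End PlaneAngle.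

Definition region (J : nat) : seq (int * int) :=
  [seq (m%:Z - J%:Z, n%:Z) | m <- iota 0 (2 * J).+1, n <- iota 0 J.+1].

Definition region_card (J : nat) : nat := ((2 * J).+1 * J.+1)%N.

Lemma mem_region J (p : int * int) :
  (p \in region J) = (- J%:Z <= p.1 <= J%:Z) && (0 <= p.2 <= J%:Z).
Proof.
case: p => x y; rewrite /fst /snd; apply/allpairsP/idP => [[[m n] []]|].
  rewrite !mem_iota /fst /snd.
  move: m n => m' n'; set m : nat := m'; set n : nat := n'.
  by move=> hm hn [-> ->]; lia.
move=> h; exists (`|(x + J%:Z)%R|%N, `|y|%N).
rewrite /fst /snd; split; [rewrite mem_iota; lia | rewrite mem_iota; lia |].
by congr pair; lia.
Qed.

Lemma uniq_region J : uniq (region J).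
Proof.
apply: allpairs_uniq; rewrite ?iota_uniq //.
by move=> [a b] [c d] _ _ /= [/addIr[->] ->].
Qed.

Lemma size_region J : size (region J) = region_card J.
Proof. by rewrite size_allpairs !size_iota. Qed.

Section GapDistribution.
Context {R : realType}.
Implicit Types (t lambda : R) (J j : nat).

Definition viewpoint t J : R * R := (- (t * J%:R ^+ 2), 0).

Definition angles t J : seq R :=
  sort <=%R [seq angle (p.1%:~R, p.2%:~R) (viewpoint t J) (0, 0)
            | p <- region J].

(* Indexed from 1, for 1 <= j <= region_card J. *)
Definition alpha t J j : R := nth 0 (angles t J) j.-1.

Definition mean_gap t J : R := alpha t J (region_card J) / (region_card J)%:R.

Definition gap_distr t lambda J : R :=
  (count (fun j => lambda * mean_gap t J <= alpha t J j.+1 - alpha t J j)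
         (iota 1 (region_card J).-1))%:R / (region_card J)%:R.

(* Total operator: an arbitrary value if the sequence diverges. *)
Definition limit_gap_distr t lambda : R :=
  limn (fun J => gap_distr t lambda J).

End GapDistribution.

(* Main.v *)
Require Import Defs.
From mathcomp Require Import all_boot all_order all_algebra.
From mathcomp Require Import all_classical all_reals all_analysis.
From mathcomp Require Import ring lra zify.
Import Order.TTheory GRing.Theory Num.Theory.
Import numFieldNormedType.Exports.
Local Open Scope classical_set_scope.
Local Open Scope ring_scope.
Set Implicit Arguments.
Unset Strict Implicit.
Unset Printing Implicit Defensive.

(** Let [(m, y)] be the lattice point of height [y] in the column number [m], at
    horizontal distance [X = t * J ^ 2 - J + m] from the viewpoint. Its angle is
    [atan (y / X)], and a gap of at least [lambda] average gaps starts at it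
    exactly when no point is seen slightly above it, if coincidences are left
    aside ([gaps_isolated]). For the point [k] rows and [d] columns away, the
    difference of the slopes [y / X] is a cross product: it equals
    [y * (k * w - p)] divided by about [(t * J ^ 2) ^ 2], where [w] is the
    fractional part of [X / y] and [p] is an integer. Only the active rows
    [- A <= k <= B] can contain such a point, with [A] and [B] the integer parts
    of [m * y / (t * J ^ 2)] and [(2 * J - m) * y / (t * J ^ 2)], and for them every
    small [k * w - p] does occur. So [(m, y)] is isolated when the least
    positive [k * w - p], for [- A <= k <= B], is at least [mu * J / y] with
    [mu = lambda * t / 2] ([isolated_of_far], [not_isolated_of_near]).

    By the three-gap theorem ([succ_dist_min]) this least value is affine in [w] on
    each Farey arc of order [A + B]. Hence the points to count are those for
    which [w] lies in certain windows, one per arc, whose length is a combination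
    of two functions [max (1 / q - mu * J / y, 0)], the [q] being the
    denominators at the ends of the arc ([arc_len]).

    In a column, the numbers [X / y] are equidistributed modulo 1, even against
    slowly moving windows ([equidistribution]): locally [X / y] is an arithmetic
    progression of step [X / y ^ 2], which Dirichlet's theorem approximates by
    [p / q]; on [q] consecutive rows the values nearly fill the classes modulo
    [1 / q], and Hermite's identity averages the sawtooth function over them. The
    denominators [q] are large except for few rows, because the step varies.

    The number of columns with given [A] and [B] in row [y = b * J] is [J] times a
    function [tent (A + B)] of [b], piecewise affine in [1 / b]. Summing over the
    rows gives a Riemann sum ([riemann_sum]): the density of isolated points
    tends to integrals over [b] of products of two functions that are piecewise
    affine in [1 / b], with antiderivatives [c0 * b + c1 * ln b - c2 / b]. The
    pieces end at the kinks [m * t / 2] of the tents, at the kinks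
    [q * lambda * t / 2] of the window lengths and at [b = 1], and at each of these
    points the antiderivative is in the span of the eight functions of the
    statement ([span_prim]). Points near the limits of all these cases are rare
    ([rare_bad]), which yields the limit ([gap_distr_cvg]).

    The formula depends on [(t, lambda)] only through the order of the ends of the
    pieces. Let [2 / (h + 1) <= t <= 2 / h]; then the order changes only on
    the curves [lambda = m / q] and [lambda = 2 / (q * t)] with [m] and [q] at most
    [h], which serve as thresholds for [lambda]. A curve of the first kind
    meets one of the second at a rational [t = 2 * q / (m * q')] of denominator at most
    [h ^ 2]. Taking as breakpoints for [t] all rationals of this interval with
    denominator at most [2 * h * (h + 1)], which also include its ends, leaves
    the curves in a fixed order between two breakpoints ([curves_order]). *)

(** * Farey arcs and the three-gap theorem *)

(** An arc is a pair of fractions (numerator, denominator), its left and right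
    ends. Splitting at the mediant exactly when its denominator reaches [n]
    turns the arcs of order [n - 1] into those of order [n]. *)
Definition split_arc (n : nat) (a : (nat * nat) * (nat * nat)) :=
  let med := ((a.1.1 + a.2.1)%N, (a.1.2 + a.2.2)%N) in
  if (a.1.2 + a.2.2 == n)%N then [:: (a.1, med); (med, a.2)] else [:: a].

Fixpoint farey (n : nat) : seq ((nat * nat) * (nat * nat)) :=
  if n is m.+1 then flatten [seq split_arc n a | a <- farey m]
  else [:: ((0, 1), (1, 1))]%N.

(** The Farey neighbour relations: determinant 1, and a mediant whose denominator
    exceeds the order. *)
Definition is_arc (n : nat) (a : (nat * nat) * (nat * nat)) : bool :=
  [&& (0 < a.1.2 <= maxn n 1)%N, (0 < a.2.2 <= maxn n 1)%N,
      (n < a.1.2 + a.2.2)%N & (a.1.2 * a.2.1 == a.1.1 * a.2.2 + 1)%N].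

Lemma fareyP n a : a \in farey n -> is_arc n a.
Proof.
elim: n a => [|n IH] a; first by rewrite inE => /eqP->.
move=> /flattenP[s /mapP[b /IH Hb ->]].
move: Hb; case: b => [[p1 q1] [p2 q2]]; rewrite /is_arc /split_arc /=.
case/and4P=> h1 h2 h3 /eqP h4; case: eqP => h5; rewrite !inE.
  by case/orP=> /eqP->; rewrite /=; apply/and4P; split; nia.
by move/eqP->; rewrite /=; apply/and4P; split; nia.
Qed.

Section Farey.
Context {R : realType}.
Implicit Types (w : R).

Definition ratio (p : nat * nat) : R := p.1%:R / p.2%:R.

Definition in_arc (a : (nat * nat) * (nat * nat)) w :=
  (ratio a.1 <= w) && (w < ratio a.2).

Lemma ratio_lt n a : is_arc n a -> ratio a.1 < ratio a.2.
Proof.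
case: a => [[p1 q1] [p2 q2]]; case/and4P=> /= /andP[h1 _] /andP[h2 _] _ /eqP h4.
rewrite /ratio /= ltr_pdivrMr ?ltr0n // mulrAC ltr_pdivlMr ?ltr0n //.
by rewrite -!natrM ltr_nat; lia.
Qed.

(** Inserting a mediant cuts an arc in two, so every level tiles [0, 1). *)
Lemma farey_tiling n w :
  \sum_(a <- farey n) (in_arc a w)%:R = ((0 <= w < 1)%R)%:R :> R.
Proof.
elim: n => [|n IH]; first by rewrite big_seq1 /in_arc /ratio /= !divr1.
rewrite -IH /= big_flatten big_map /= big_seq [RHS]big_seq; apply: eq_bigr.
move=> a /fareyP ha; rewrite /split_arc; case: eqP => _; last by rewrite big_seq1.
rewrite big_cons big_seq1; move: ha; case: a => [[p1 q1] [p2 q2]].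
case/and4P=> /= /andP[h1 _] /andP[h2 _] _ /eqP h4.
rewrite /in_arc /ratio /=.
have q10 : 0 < q1%:R :> R by rewrite ltr0n.
have q20 : 0 < q2%:R :> R by rewrite ltr0n.
have qq0 : 0 < (q1 + q2)%:R :> R by rewrite ltr0n; lia.
have l1 : p1%:R / q1%:R < (p1 + p2)%:R / (q1 + q2)%:R :> R.
  rewrite ltr_pdivrMr // mulrAC ltr_pdivlMr //.
  by rewrite -!natrM ltr_nat; nia.
have l2 : (p1 + p2)%:R / (q1 + q2)%:R < p2%:R / q2%:R :> R.
  rewrite ltr_pdivrMr // mulrAC ltr_pdivlMr //.
  by rewrite -!natrM ltr_nat; nia.
have [m1|m1] := leP ((p1 + p2)%:R / (q1 + q2)%:R) w.
  have -> : p1%:R / q1%:R <= w by lra.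
  by rewrite /= add0r.
have -> : w < p2%:R / q2%:R by lra.
by rewrite /= andbT addr0.
Qed.

(** Slope and intercept of the distance from 0 to its successor among the
    residues of [k * w], [- A <= k <= B], for [w] in the arc [a]; the successor
    is [k = q1], else [k = - q2] or, when both lie outside of [- A, B],
    [k = q1 - q2]. On a whole arc the distance is thus affine in [w]. *)
Definition slope (A B : nat) (a : (nat * nat) * (nat * nat)) : int :=
  if (a.1.2 <= B)%N then a.1.2%:Z
  else if (a.2.2 <= A)%N then - a.2.2%:Z else a.1.2%:Z - a.2.2%:Z.

Definition icept (A B : nat) (a : (nat * nat) * (nat * nat)) : int :=
  if (a.1.2 <= B)%N then - a.1.1%:Z
  else if (a.2.2 <= A)%N then a.2.1%:Z else a.2.1%:Z - a.1.1%:Z.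

Definition succ_dist A B a w : R := (slope A B a)%:~R * w + (icept A B a)%:~R.

(** The determinant of an arc is 1, so every pair [(k, p)] is an integral
    combination of its ends, and [k * w - p] is the same combination of the two
    small positive residues [q1 * w - p1] and [p2 - q2 * w]. *)
Lemma unimodular_coord (a : (nat * nat) * (nat * nat)) w (k p : int) :
  (a.1.2 * a.2.1 = a.1.1 * a.2.2 + 1)%N ->
  exists i j : int, k = i * a.1.2%:Z - j * a.2.2%:Z /\
  k%:~R * w - p%:~R =
    i%:~R * (a.1.2%:R * w - a.1.1%:R) + j%:~R * (a.2.1%:R - a.2.2%:R * w).
Proof.
case: a => [[p1 q1] [p2 q2]] /= det.
have D : q1%:Z * p2%:Z = p1%:Z * q2%:Z + 1 by lia.
exists (k * p2%:Z - p * q2%:Z), (k * p1%:Z - p * q1%:Z).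
split; first by ring: D.
have DR : q1%:R * p2%:R = p1%:R * q2%:R + 1 :> R by rewrite -!natrM det natrD.
rewrite !rmorphB !rmorphM /=.
by rewrite !pmulrn; ring: DR.
Qed.

Section Arc.
Variables (A B : nat) (a : (nat * nat) * (nat * nat)) (w : R).
Hypothesis arc_a : is_arc (A + B) a.

Let q1_gt0 : 0 < a.1.2%:R :> R.
Proof. by case/and4P: arc_a => /andP[? _] _ _ _; rewrite ltr0n. Qed.
Let q2_gt0 : 0 < a.2.2%:R :> R.
Proof. by case/and4P: arc_a => _ /andP[? _] _ _; rewrite ltr0n. Qed.
Let det : (a.1.2 * a.2.1 = a.1.1 * a.2.2 + 1)%N.
Proof. by case/and4P: arc_a => _ _ _ /eqP. Qed.
Let qq : (A + B < a.1.2 + a.2.2)%N.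
Proof. by case/and4P: arc_a. Qed.
Let q1P : (0 < a.1.2 <= maxn (A + B) 1)%N.
Proof. by case/and4P: arc_a. Qed.
Let q2P : (0 < a.2.2 <= maxn (A + B) 1)%N.
Proof. by case/and4P: arc_a. Qed.

Hypothesis w_in : ratio a.1 < w < ratio a.2.

Let u_gt0 : 0 < a.1.2%:R * w - a.1.1%:R.
Proof.
by case/andP: w_in => h _; rewrite subr_gt0 mulrC -ltr_pdivrMr.
Qed.
Let v_gt0 : 0 < a.2.1%:R - a.2.2%:R * w.
Proof.
by case/andP: w_in => _ h; rewrite subr_gt0 mulrC -ltr_pdivlMr.
Qed.

Let signs (i j : int) : 0 < i%:~R * (a.1.2%:R * w - a.1.1%:R)
    + j%:~R * (a.2.1%:R - a.2.2%:R * w) -> (0 < i) || (0 < j).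
Proof.
apply: contraTT; rewrite negb_or -!leNgt => /andP[hi hj].
have := @mulr_le0_ge0 R i%:~R _ _ (ltW u_gt0); rewrite lerz0 => /(_ hi).
have := @mulr_le0_ge0 R j%:~R _ _ (ltW v_gt0); rewrite lerz0 => /(_ hj).
lra.
Qed.

(* Mixed signs of the coordinates push [k] out of [- A, B], except for the few
   combinations that define [slope]. *)
Let coord_bounds (i j k : int) : k = i * a.1.2%:Z - j * a.2.2%:Z ->
  [/\ i <= 0 -> 0 < j -> k <= - a.2.2%:Z, 0 < i -> j <= 0 -> a.1.2%:Z <= k,
      0 < i -> j < 0 -> a.1.2%:Z + a.2.2%:Z <= k
    & i < 0 -> 0 < j -> k <= - (a.1.2%:Z + a.2.2%:Z)].
Proof.
move: (a.1.2) (a.2.2) => x y ->.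
have pos (z : int) (n : nat) : 0 < z -> n%:Z <= z * n by nia.
have neg (z : int) (n : nat) : z <= 0 -> z * n <= 0 by nia.
have neg1 (z : int) (n : nat) : z < 0 -> z * n <= - n%:Z by nia.
split=> hi hj.
- by move: (neg i x hi) (pos j y hj); lia.
- by move: (pos i x hi) (neg j y hj); lia.
- by move: (pos i x hi) (neg1 j y hj); lia.
- by move: (neg1 i x hi) (pos j y hj); lia.
Qed.

(** Three-gap theorem: a positive [k * w - p] has a positive coordinate on one
    of the two small residues; as [A + B < q1 + q2], those [k] that remain in
    [- A, B] use at least the residues that make up [succ_dist]. *)
Lemma succ_dist_min (k p : int) : - A%:Z <= k <= B%:Z ->
  0 < k%:~R * w - p%:~R -> succ_dist A B a w <= k%:~R * w - p%:~R.
Proof.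
move=> hk; have [i [j []]] := unimodular_coord w k p det.
move=> /coord_bounds[b1 b2 b3 b4] -> /signs hs.
have le1 z : 0 < z -> 1 <= z%:~R :> R by move=> h; rewrite ler1z; lia.
have le0 z : 0 <= z -> 0 <= z%:~R :> R by move=> h; rewrite ler0z.
have keep (x y u v : R) : 0 < u -> 0 < v -> 0 <= x -> 0 <= y -> 0 <= x * u + y * v.
  by move=> u0 v0 x0 y0; rewrite addr_ge0 ?mulr_ge0 // ltW.
rewrite /succ_dist /slope /icept; case: leqP => c1.
  have [i1 j1] : 0 < i /\ 0 <= j by lia.
  have := keep (i%:~R - 1) _ _ _ u_gt0 v_gt0 _ (le0 _ j1).
  by rewrite subr_ge0 => /(_ (le1 _ i1)); rewrite rmorphN /= -!pmulrn; lra.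
case: leqP => c2.
  have [i1 j1] : 0 <= i /\ 0 < j by lia.
  have := keep _ (j%:~R - 1) _ _ u_gt0 v_gt0 (le0 _ i1).
  by rewrite subr_ge0 => /(_ (le1 _ j1)); rewrite rmorphN /= -!pmulrn; lra.
have [i1 j1] : 0 < i /\ 0 < j by lia.
have := keep (i%:~R - 1) (j%:~R - 1) _ _ u_gt0 v_gt0.
rewrite !subr_ge0 => /(_ (le1 _ i1) (le1 _ j1)).
by rewrite !rmorphB /= -!pmulrn; lra.
Qed.

(** Two positive residues cancel only with coordinates of opposite signs, and
    then [`|k|] is at least [q1 + q2]. *)
Lemma no_return (k p : int) : - A%:Z <= k <= B%:Z ->
  k%:~R * w - p%:~R = 0 -> k = 0.
Proof.
move=> hk; have [i [j []]] := unimodular_coord w k p det.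
move=> hkij -> hs; have [b1 b2 b3 b4] := coord_bounds hkij.
have pos (z : int) (x : R) : 0 < x -> 0 < z -> 0 < z%:~R * x.
  by move=> ? ?; rewrite mulr_gt0 // ltr0z.
have neg (z : int) (x : R) : 0 < x -> z < 0 -> z%:~R * x < 0.
  by move=> ? ?; rewrite nmulr_rlt0 // ltrz0.
have [i1|i1|i1] := ltgtP i 0; have [j1|j1|j1] := ltgtP j 0.
- exfalso; move: (neg _ _ u_gt0 i1) (neg _ _ v_gt0 j1); lra.
- exfalso; lia.
- exfalso; move: (neg _ _ u_gt0 i1) hs; rewrite j1 mul0r; lra.
- exfalso; lia.
- exfalso; move: (pos _ _ u_gt0 i1) (pos _ _ v_gt0 j1); lra.
- exfalso; move: (pos _ _ u_gt0 i1) hs; rewrite j1 mul0r; lra.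
- exfalso; move: (neg _ _ v_gt0 j1) hs; rewrite i1 mul0r; lra.
- exfalso; move: (pos _ _ v_gt0 j1) hs; rewrite i1 mul0r; lra.
- by rewrite hkij i1 j1; lia.
Qed.

Lemma slope_range : - A%:Z <= slope A B a <= B%:Z.
Proof. by rewrite /slope; case: leqP => c1; first lia; case: leqP => c2; lia. Qed.

Lemma succ_dist_gt0 : 0 < succ_dist A B a w.
Proof.
rewrite /succ_dist /slope /icept; case: leqP => c1; last case: leqP => c2.
- by rewrite rmorphN.
- by rewrite rmorphN mulNr addrC.
- rewrite !rmorphB /=; move: u_gt0 v_gt0; rewrite -!pmulrn; lra.
Qed.

Lemma succ_dist_le1 : succ_dist A B a w <= 1.
Proof.
have DR : a.1.2%:R * a.2.1%:R = a.1.1%:R * a.2.2%:R + 1 :> R.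
  by rewrite -!natrM det natrD.
have K : a.2.2%:R * (a.1.2%:R * w - a.1.1%:R)
       + a.1.2%:R * (a.2.1%:R - a.2.2%:R * w) = 1 by ring: DR.
have g1 : 1 <= a.1.2%:R :> R by rewrite ler1n; lia.
have g2 : 1 <= a.2.2%:R :> R by rewrite ler1n; lia.
have : (a.1.2%:R * w - a.1.1%:R) + (a.2.1%:R - a.2.2%:R * w) <= 1.
  have h1 := mulr_ge0 (ltW u_gt0) (_ : 0 <= a.2.2%:R - 1).
  have h2 := mulr_ge0 (ltW v_gt0) (_ : 0 <= a.1.2%:R - 1).
  by move: h1 h2; rewrite !subr_ge0 => /(_ g2) + /(_ g1); lra.
rewrite /succ_dist /slope /icept; case: leqP => c1; last case: leqP => c2.
- by rewrite rmorphN /= -!pmulrn => h; move: v_gt0; lra.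
- by rewrite rmorphN /= -!pmulrn => h; move: u_gt0; lra.
- rewrite !rmorphB /= -!pmulrn; lra.
Qed.

End Arc.
End Farey.

(** * Fractional parts *)

Section Fractional.
Context {R : realType}.
Implicit Types (z w : R).

Definition frac z : R := z - (Num.floor z)%:~R.

Lemma frac_itv z : 0 <= frac z < 1.
Proof.
have /andP[h1 h2] := floor_itv z; rewrite /frac; rewrite intrD in h2.
by apply/andP; split; lra.
Qed.

Lemma frac_ge0 z : 0 <= frac z. Proof. by case/andP: (frac_itv z). Qed.
Lemma frac_lt1 z : frac z < 1. Proof. by case/andP: (frac_itv z). Qed.

Lemma floor_frac z (m : int) (f : R) : z = m%:~R + f -> 0 <= f < 1 ->
  Num.floor z = m /\ frac z = f.
Proof.
move=> -> /andP[f0 f1]; have e : Num.floor (m%:~R + f) = m.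
  by apply: floor_def; rewrite intrD; apply/andP; split; lra.
by split=> //; rewrite /frac e; ring.
Qed.

Lemma frac_unique z (m : int) (f : R) : z = m%:~R + f -> 0 <= f < 1 -> frac z = f.
Proof. by move=> h1 h2; case: (floor_frac h1 h2). Qed.

Lemma fracE z : z = (Num.floor z)%:~R + frac z.
Proof. by rewrite /frac addrC subrK. Qed.

(** Sawtooth identity: it turns counting points modulo 1 in an interval into
    averaging two fractional parts. *)
Lemma frac_itv_indic z (w1 w2 : R) : 0 <= w1 -> w1 <= w2 -> w2 <= 1 ->
  ((w1 <= frac z) && (frac z < w2))%:R - (w2 - w1) = frac (z - w2) - frac (z - w1).
Proof.
move=> h0 h1 h2; have /andP[f0 f1] := frac_itv z; have ez := fracE z.
move: (Num.floor z) (frac z) f0 f1 ez => m f f0 f1 ez.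
have lo w : w <= f -> 0 <= w -> frac (z - w) = f - w.
  by move=> ? ?; apply: (@frac_unique _ m); [rewrite ez; ring | apply/andP; split; lra].
have hi w : f < w -> w <= 1 -> frac (z - w) = f - w + 1.
  move=> ? ?; apply: (@frac_unique _ (m - 1)); first by rewrite ez rmorphB /=; ring.
  by apply/andP; split; lra.
have [a1|a1] := leP w1 f; have [a2|a2] := ltP f w2 => /=.
- by rewrite (lo w1) ?(hi w2) //; ring.
- by rewrite (lo w1) ?(lo w2) //; [ring|lra].
- by rewrite (hi w1) ?(hi w2) //; [ring|lra].
- lra.
Qed.

(** Hermite's identity: if [q * z] has floor [m * q + s], then exactly [s] of the
    [q] shifts pass the next integer. *)
Lemma hermite_floor (q : nat) (z : R) : (0 < q)%N ->
  \sum_(0 <= r < q) Num.floor (z + r%:R / q%:R) = Num.floor (q%:R * z).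
Proof.
move=> q0; have q0R : 0 < q%:R :> R by rewrite ltr0n.
set N := Num.floor (q%:R * z).
have /andP[f0 f1] := frac_itv (q%:R * z); have ez := fracE (q%:R * z).
rewrite -/N in ez; move: (frac _) f0 f1 ez => f f0 f1 ez.
pose m := (N %/ q%:Z)%Z; pose s := `|(N %% q%:Z)%Z|%N.
have qz : q%:Z != 0 by lia.
have sP : (N %% q%:Z)%Z = s%:Z by rewrite /s gez0_abs // modz_ge0.
have sq : (s < q)%N by have := @ltz_pmod N q%:Z; rewrite sP; lia.
have NE : N = m * q%:Z + s%:Z by rewrite -sP -divz_eq.
have ezz : z = m%:~R + (s%:R + f) / q%:R.
  apply: (mulfI (lt0r_neq0 q0R)); rewrite ez NE rmorphD rmorphM /= -!pmulrn.
  by field; rewrite lt0r_neq0.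
have step r : (r < q)%N -> Num.floor (z + r%:R / q%:R) = m + ((q <= s + r)%N : nat)%:Z.
  move=> rq; have e : z + r%:R / q%:R = m%:~R + ((s + r)%:R + f) / q%:R.
    by rewrite ezz natrD; field; rewrite lt0r_neq0.
  have [h|h] := leqP q (s + r).
    have e' : z + r%:R / q%:R = (m + 1)%:~R + ((s + r - q)%:R + f) / q%:R.
      by rewrite e natrB // intrD; field; rewrite lt0r_neq0.
    case: (floor_frac e') => //.
    rewrite divr_ge0 ?addr_ge0 ?ler0n //= ltr_pdivrMr // mul1r.
    have : (s + r - q)%:R + 1 <= q%:R :> R by rewrite natr1 ler_nat; lia.
    lra.
  rewrite addr0; case: (floor_frac e) => //.
  rewrite divr_ge0 ?addr_ge0 ?ler0n //= ltr_pdivrMr // mul1r.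
  have : (s + r)%:R + 1 <= q%:R :> R by rewrite natr1 ler_nat; lia.
  lra.
rewrite (@eq_big_nat _ _ _ 0%N q _ (fun r => m + ((q <= s + r)%N : nat)%:Z)); last first.
  by move=> r /andP[_]; exact: step.
have cnt : \sum_(0 <= r < q) ((q <= s + r)%N : nat)%:Z = s%:Z.
  rewrite (@big_cat_nat _ _ _ (q - s)%N) ?leq_subr //= big_nat big1 ?add0r; last first.
    by move=> r hr; have -> : (q <= s + r)%N = false by lia.
  rewrite (@eq_big_nat _ _ _ _ _ _ (fun=> 1)); last first.
    by move=> r hr; have -> : (q <= s + r)%N by lia.
  by rewrite sumr_const_nat; lia.
by rewrite big_split /= sumr_const_nat subn0 cnt NE; lia.
Qed.

(** A sequence that follows an arithmetic progression of step [- p / q] within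
    [eta] meets every class modulo [1 / q] once, so by Hermite's identity its
    fractional parts average to 1/2. *)
Lemma frac_sum_block (p q : nat) (z : nat -> R) (psi eta : R) :
  (0 < q)%N -> coprime q p -> 0 <= eta ->
  (forall l, (l < q)%N -> `|z l - (psi - l%:R * (p%:R / q%:R))| <= eta) ->
  `|\sum_(0 <= l < q) (frac (z l) - 2^-1)| <= 2 * q%:R * eta + 1.
Proof.
move=> q0 cqp e0 hz; have q0R : 0 < q%:R :> R by rewrite ltr0n.
have qn0 : q%:R != 0 :> R by rewrite lt0r_neq0.
pose r (l : nat) := ((l * (p * (q - 1))) %% q)%N.
have rq l : (r l < q)%N by rewrite ltn_mod.
have rE l : exists N : nat, (l * p + r l = q * N)%N.
  exists (l * p - (l * (p * (q - 1))) %/ q)%N.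
  have := divn_eq (l * (p * (q - 1))) q; rewrite -/(r l).
  have : (l * p + l * (p * (q - 1)) = q * (l * p))%N.
    by case: q q0 {z hz q0R qn0 cqp r rq} => // q _; rewrite subn1 /=; nia.
  set d := (_ %/ q)%N; nia.
have dst l : exists N : int,
    psi - l%:R * (p%:R / q%:R) = (psi + (r l)%:R / q%:R) - N%:~R.
  have [N hN] := rE l; exists N%:Z; rewrite -pmulrn.
  have : l%:R * p%:R + (r l)%:R = q%:R * N%:R :> R by rewrite -!natrM -natrD hN.
  move=> h; have -> : (r l)%:R = q%:R * N%:R - l%:R * p%:R :> R by rewrite -h; ring.
  by field.
pose e l := z l - (psi - l%:R * (p%:R / q%:R)).
have fz l : frac (z l) = (psi + (r l)%:R / q%:R + e l)
    - (Num.floor (psi + (r l)%:R / q%:R + e l))%:~R.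
  have [N hN] := dst l.
  rewrite -/(frac (psi + _ + _)); apply: (@frac_unique _
    (Num.floor (psi + (r l)%:R / q%:R + e l) - N)); last exact: frac_itv.
  rewrite rmorphB /=; have := fracE (psi + (r l)%:R / q%:R + e l).
  by rewrite /e; move: hN; lra.
have perm (F : nat -> R) : \sum_(0 <= l < q) F (r l) = \sum_(0 <= l < q) F l.
  rewrite !big_mkord.
  rewrite [RHS](reindex_inj (h := fun l : 'I_q => Ordinal (rq l))) //=.
  move=> l1 l2 /(congr1 val) /= /eqP; rewrite /r.
  wlog h : l1 l2 / (l2 <= l1)%N.
    move=> H; have [h|h] := leqP l2 l1; first exact: H.
    by rewrite eq_sym => /(H _ _ (ltnW h)).
  rewrite eqn_mod_dvd ?leq_mul // -mulnBl Gauss_dvdl; last first.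
    rewrite coprimeMr cqp /=; case: q q0 {z hz q0R qn0 cqp r rq rE dst e fz l1 l2 h} => // q _.
    by rewrite subn1 /= coprimeSn.
  move=> /dvdnP[k hk]; apply/val_inj => /=; have := ltn_ord l1.
  case: k hk => [|k]; nia.
have sumr : \sum_(0 <= l < q) (psi + (r l)%:R / q%:R) = q%:R * psi + (q%:R - 1) / 2.
  rewrite (perm (fun l => psi + l%:R / q%:R)).
  rewrite big_split /= sumr_const_nat subn0 -mulr_suml; congr (_ + _).
    by rewrite mulr_natl.
  have -> : \sum_(0 <= i < q) i%:R = q%:R * (q%:R - 1) / 2 :> R; last by field.
  elim: (q) => [|k IH]; first by rewrite big_geq // mul0r mul0r.
  by rewrite big_nat_recr //= IH -natr1; field.
have se : `|\sum_(0 <= l < q) e l| <= q%:R * eta.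
  apply: le_trans (ler_norm_sum _ _ _) _.
  rewrite big_nat; apply: (@le_trans _ _ (\sum_(0 <= i < q | (0 <= i < q)%N) eta)).
    by apply: ler_sum => l /andP[_]; exact: hz.
  by rewrite -big_nat sumr_const_nat subn0 mulr_natl.
have fl (c : R) : \sum_(0 <= l < q) (Num.floor (psi + (r l)%:R / q%:R + c))%:~R
    = (Num.floor (q%:R * (psi + c)))%:~R :> R.
  rewrite (perm (fun l => (Num.floor (psi + l%:R / q%:R + c))%:~R)).
  rewrite -hermite_floor // rmorph_sum /=; apply: eq_bigr => l _.
  by rewrite addrAC.
pose S : R := \sum_(0 <= l < q) (Num.floor (psi + (r l)%:R / q%:R + e l))%:~R.
have eb l : (l < q)%N -> - eta <= e l <= eta by move=> /hz; rewrite ler_norml.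
have S1 : S <= (Num.floor (q%:R * (psi + eta)))%:~R.
  rewrite -fl /S !big_nat; apply: ler_sum => l /andP[_ /eb /andP[_ h]].
  by rewrite ler_int le_floor // lerD2l.
have S2 : (Num.floor (q%:R * (psi - eta)))%:~R <= S.
  rewrite -fl /S !big_nat; apply: ler_sum => l /andP[_ /eb /andP[h _]].
  by rewrite ler_int le_floor // lerD2l.
have -> : \sum_(0 <= l < q) (frac (z l) - 2^-1) =
    \sum_(0 <= l < q) (psi + (r l)%:R / q%:R) + \sum_(0 <= l < q) e l - S - q%:R / 2.
  rewrite (eq_bigr (fun l => ((psi + (r l)%:R / q%:R) + e l -
    (Num.floor (psi + (r l)%:R / q%:R + e l))%:~R) - 2^-1)); last first.
    by move=> l _; rewrite fz.
  rewrite !big_split /= !sumrN -/S; congr (_ + _).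
  by rewrite sumr_const_nat subn0 -[in LHS]mulr_natl; field.
rewrite sumr.
have /andP[a1 a2] := floor_itv (q%:R * (psi + eta)).
have /andP[b1 b2] := floor_itv (q%:R * (psi - eta)).
rewrite intrD in a2; rewrite intrD in b2.
by move: se; rewrite !ler_norml => /andP[s1 s2]; apply/andP; split; lra.
Qed.

(** Pigeonhole on the fractional parts of [i * theta], [i <= Q]; dividing by the
    gcd makes the approximating fraction reduced, which the averaging over
    residue classes requires. *)
Lemma dirichlet (theta : R) (Q : nat) : 0 <= theta -> (0 < Q)%N ->
  exists q p : nat, [/\ (0 < q <= Q)%N, coprime q p
    & `|q%:R * theta - p%:R| < Q%:R^-1].
Proof.
move=> th0 Q0; have Q0R : 0 < Q%:R :> R by rewrite ltr0n.
have box (i : nat) : (Num.truncn (Q%:R * frac (i%:R * theta)) < Q)%N.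
  rewrite truncn_lt_nat ?mulr_ge0 ?frac_ge0 // ?ltW //.
  by rewrite gtr_pMr // frac_lt1.
pose f (i : 'I_Q.+1) : 'I_Q := Ordinal (box i).
have : ~~ injectiveb f.
  by apply/negP => /injectiveP /leq_card; rewrite !card_ord ltnn.
case/injectivePn => i [j ij /(congr1 val) /= eqf].
wlog lt_ij : i j ij eqf / (i < j)%N.
  move=> H; have [h|h] := ltnP i j; first exact: (H i j).
  apply: (H j i) => //; first by rewrite eq_sym.
  by rewrite ltn_neqAle h andbT; apply: contra ij => /eqP e; apply/eqP/val_inj.
pose q := (j - i)%N.
pose pz := Num.floor (j%:R * theta) - Num.floor (i%:R * theta).
have pz0 : 0 <= pz.
  by rewrite subr_ge0 le_floor // ler_wpM2r // ler_nat ltnW.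
pose p := `|pz|%N.
have pE : p%:R = pz%:~R :> R by rewrite pmulrn gez0_abs.
have close : `|q%:R * theta - p%:R| < Q%:R^-1.
  have -> : q%:R * theta - p%:R = frac (j%:R * theta) - frac (i%:R * theta).
    rewrite pE /pz /q natrB; last exact: ltnW.
    rewrite rmorphB /= /frac.
    move: (Num.floor (j%:R * theta)) (Num.floor (i%:R * theta)) => a b.
    by rewrite mulrBl opprB !opprD; lra.
  have g (k : nat) : 0 <= Q%:R * frac (k%:R * theta).
    by rewrite mulr_ge0 ?frac_ge0 // ltW.
  have /andP[a1 a2] := truncn_itv (g i).
  have /andP[b1 b2] := truncn_itv (g j).
  rewrite -(ltr_pM2l Q0R) mulfV ?lt0r_neq0 // -[X in X * _]gtr0_norm // -normrM.
  rewrite -eqf in b1 b2; rewrite -natr1 in a2; rewrite -natr1 in b2.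
  by rewrite ltr_norml mulrBr; apply/andP; split; lra.
have q0 : (0 < q)%N by rewrite subn_gt0.
have qQ : (q <= Q)%N by rewrite /q; have := ltn_ord j; lia.
pose g := gcdn q p; have g0 : (0 < g)%N by rewrite gcdn_gt0 q0.
have qg : (q %/ g * g)%N = q by rewrite divnK // dvdn_gcdl.
have pg : (p %/ g * g)%N = p by rewrite divnK // dvdn_gcdr.
exists (q %/ g)%N, (p %/ g)%N; split.
- by rewrite divn_gt0 // dvdn_leq ?dvdn_gcdl //= (leq_trans (leq_div _ _)).
- rewrite /coprime -(eqn_pmul2r g0) muln_gcdl qg pg mul1n //.
- apply: le_lt_trans close.
  have -> : q%:R * theta - p%:R = ((q %/ g)%:R * theta - (p %/ g)%:R) * g%:R.
    by rewrite -{1}qg -{1}pg !natrM; ring.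
  by rewrite normrM ler_peMr // ger0_norm // ler1n.
Qed.

End Fractional.

(** * Counting tools *)

Section Counting.
Context {R : realType}.
Implicit Types (z w : R).

Lemma sum_indic_le (i j : nat) (P Q : pred nat) :
  (forall m, (i <= m < j)%N -> P m -> Q m) ->
  \sum_(i <= m < j) (P m)%:R <= \sum_(i <= m < j) (Q m)%:R :> R.
Proof.
move=> h; rewrite !big_nat; apply: ler_sum => m /h; rewrite ler_nat.
by case: (P m) (Q m) => [] [] // /(_ isT).
Qed.

Lemma sum_indic_orb (i j : nat) (P Q : pred nat) :
  \sum_(i <= m < j) (P m || Q m)%:R <=
  \sum_(i <= m < j) (P m)%:R + \sum_(i <= m < j) (Q m)%:R :> R.
Proof.
rewrite -big_split /=; apply: ler_sum => m _.
by case: (P m) (Q m) => [] [] //=; rewrite ?addr0 ?add0r ?lexx // lerDl.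
Qed.

Lemma sum_const_le (i j : nat) (F : nat -> R) (c : R) : 0 <= c ->
  (forall m, (i <= m < j)%N -> F m <= c) ->
  \sum_(i <= m < j) F m <= j%:R * c.
Proof.
move=> c0 h; apply: (@le_trans _ _ (\sum_(i <= m < j) c)).
  by rewrite !big_nat; exact: ler_sum.
by rewrite sumr_const_nat -[leLHS]mulr_natl ler_wpM2r // ler_nat leq_subr.
Qed.

Lemma count_spread (i j : nat) (P : pred nat) (D : R) : 0 <= D ->
  (forall m m', (i <= m)%N -> (m <= m' < j)%N -> P m -> P m' ->
     m'%:R - m%:R <= D) ->
  \sum_(i <= m < j) (P m)%:R <= D + 1.
Proof.
move=> D0; elim: j => [|j IH] h; first by rewrite big_geq // addr_ge0.
have [ij|ij] := leqP i j; last by rewrite big_geq // addr_ge0.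
have IH' : \sum_(i <= m < j) (P m)%:R <= D + 1.
  by apply: IH => m m' im /andP[mm mj]; apply: h => //; rewrite mm ltnW.
have [Pj|Pj] := boolP (P j); last by rewrite big_nat_recr //= (negbTE Pj) addr0.
pose K := Num.truncn D; have /andP[K1 K2] := truncn_itv D0.
apply: (@le_trans _ _ (\sum_(i <= m < j.+1) ((j - K <= m)%N)%:R)).
  apply: sum_indic_le => m /andP[im mj] Pm.
  have := h m j im _ Pm Pj; rewrite ltnSn andbT => /(_ mj).
  rewrite -natrB // => hD.
  by rewrite leq_subCl -ltnS -(ltr_nat R); apply: le_lt_trans hD K2.
apply: (@le_trans _ _ (K.+1%:R)); last by rewrite -natr1 lerD2r.
have cst (a b : nat) : \sum_(a <= m < b) ((j - K <= m)%N)%:R <= (b - a)%:R :> R.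
  have -> : (b - a)%:R = \sum_(a <= m < b) 1 :> R by rewrite sumr_const_nat.
  apply: ler_sum => m _.
  by case: (_ <= _)%N.
have [jk|jk] := leqP (j - K) i.
  by apply: le_trans (cst _ _) _; rewrite ler_nat; lia.
rewrite (@big_cat_nat _ _ _ (j - K)%N) /=; [|exact: ltnW|lia].
rewrite big_nat big1 ?add0r; last first.
  by move=> m /andP[_ hm]; rewrite leqNgt hm.
by apply: le_trans (cst _ _) _; rewrite ler_nat; lia.
Qed.

(** Split the indices with small fractional part according to the floor. *)
Lemma count_frac (i j K : nat) (z : nat -> R) (j0 : int) (eta D : R) : 0 <= D ->
  (forall m, (i <= m < j)%N -> j0%:~R <= z m < j0%:~R + K%:R) ->
  (forall m m', (i <= m)%N -> (m <= m' < j)%N ->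
     `|z m' - z m| <= eta -> m'%:R - m%:R <= D) ->
  \sum_(i <= m < j) (frac (z m) <= eta)%R%:R <= K%:R * (D + 1).
Proof.
move=> D0 hz hD.
pose P k m := (frac (z m) <= eta) && (Num.floor (z m) == j0 + k%:Z).
apply: (@le_trans _ _ (\sum_(i <= m < j) \sum_(0 <= k < K) (P k m)%:R)).
  rewrite !big_nat; apply: ler_sum => m im.
  have [h|h] /= := boolP (frac (z m) <= eta); last by rewrite sumr_ge0.
  have /andP[z1 z2] := hz m im; have /andP[f1 f2] := frac_itv (z m).
  have ez := fracE (z m).
  pose k := `|Num.floor (z m) - j0|%N.
  have fl1 : j0 <= Num.floor (z m) by rewrite -ltzD1 -(ltr_int R) intrD; lra.
  have fl2 : Num.floor (z m) < j0 + K%:Z.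
    by rewrite -(ltr_int R) intrD -pmulrn; lra.
  have kK : (k < K)%N by rewrite /k; lia.
  rewrite (@big_cat_nat _ _ _ k) /=; [|by []|exact: ltnW].
  rewrite (big_ltn kK) addrCA ler_wpDr ?addr_ge0 ?sumr_ge0 //.
  by rewrite /P h /=; have -> : (Num.floor (z m) == j0 + k%:Z) by rewrite /k; lia.
rewrite exchange_big /=.
apply: (sum_const_le (c := D + 1)); first by rewrite addr_ge0.
move=> k _; apply: count_spread => // m m' im mm /andP[p1 /eqP q1] /andP[p2 /eqP q2].
apply: hD => //.
have := fracE (z m); have := fracE (z m'); rewrite q1 q2 => -> ->.
have := frac_ge0 (z m); have := frac_ge0 (z m'); rewrite ler_norml => ? ?.
by apply/andP; split; lra.
Qed.

(** An arithmetic progression of step [sigma] visits about [sigma * M] unit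
    intervals and spends [eta / sigma] steps near the start of each. *)
Lemma count_frac_arith (M : nat) (z0 sigma eta : R) : 0 < sigma -> 0 <= eta ->
  \sum_(0 <= m < M) (frac (z0 + sigma * m%:R) <= eta)%R%:R
    <= (sigma * M%:R + 2) * (eta / sigma + 1).
Proof.
move=> s0 e0; have sM : 0 <= sigma * M%:R by rewrite mulr_ge0 // ltW.
pose K := (Num.truncn (sigma * M%:R)).+2.
have D0 : 0 <= eta / sigma by rewrite divr_ge0 // ltW.
apply: (@le_trans _ _ (K%:R * (eta / sigma + 1))).
  apply: (@count_frac _ _ _ _ (Num.floor z0)) => //.
    move=> m /andP[_ mM]; have /andP[f1 f2] := floor_itv z0.
    have := truncnS_gt (sigma * M%:R); rewrite intrD in f2.
    have : sigma * m%:R <= sigma * M%:R by rewrite ler_pM2l // ler_nat ltnW.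
    have : 0 <= sigma * m%:R by rewrite mulr_ge0 // ltW.
    rewrite /K -[_.+2%:R]natr1 => ? ? ?; apply/andP; split; lra.
  move=> m m' _ /andP[mm _]; rewrite opprD addrACA subrr add0r -mulrBr.
  rewrite ger0_norm ?mulr_ge0 ?subr_ge0 ?ler_nat //; last exact: ltW.
  by rewrite ler_pdivlMr // mulrC.
rewrite ler_wpM2r ?addr_ge0 //.
have /andP[k1 _] := truncn_itv sM; rewrite /K -[_.+2%:R]natr1 -[_.+1%:R]natr1; lra.
Qed.

(** Cut an interval greedily into blocks of length at most [Q] on which the
    sum is small, stepping by one over the points where there is no block. *)
Lemma greedy_blocks (h : nat -> R) (bad : pred nat) (Q i j : nat) (e : R) :
  0 <= e -> (forall y, `|h y| <= 1) ->
  (forall y, (i <= y)%N -> (y + Q <= j)%N -> bad y \/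
     exists2 q, (0 < q <= Q)%N & `|\sum_(y <= l < y + q) h l| <= e * q%:R) ->
  `|\sum_(i <= y < j) h y| <= e * j%:R + \sum_(i <= y < j) (bad y)%:R + Q%:R.
Proof.
move=> e0 h1 H.
suff : `|\sum_(i <= y < j) h y| <= e * (j - i)%:R + \sum_(i <= y < j) (bad y)%:R + Q%:R.
  by move=> /le_trans; apply; rewrite !lerD2r ler_wpM2l // ler_nat leq_subr.
have [n ijn] := ubnP (j - i); elim: n => // n IH in i H ijn *.
have s0 (a : nat) : 0 <= \sum_(a <= y < j) (bad y)%:R :> R by rewrite sumr_ge0.
have [iQ|iQ] := leqP (i + Q) j; last first.
  have : `|\sum_(i <= y < j) h y| <= Q%:R.
    apply: le_trans (ler_norm_sum _ _ _) _.
    apply: (@le_trans _ _ (\sum_(i <= y < j) 1)); first exact: ler_sum.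
    by rewrite sumr_const_nat ler_nat; lia.
  by move/le_trans; apply; rewrite lerDr addr_ge0 ?mulr_ge0.
have step q : (0 < q)%N -> (i + q <= j)%N ->
  `|\sum_(i + q <= y < j) h y| <=
     e * (j - (i + q))%:R + \sum_(i + q <= y < j) (bad y)%:R + Q%:R.
  by move=> q0 qj; apply: IH; [move=> y hy; apply: H; lia | lia].
have [Q0|Q0] := posnP Q.
  have [ji|ji] := leqP j i.
    by rewrite !big_geq // normr0 !addr_ge0 ?mulr_ge0.
  have := H i (leqnn _); rewrite Q0 addn0 ltnW // => /(_ isT)[|[q]]; last by lia.
  move=> bi; rewrite !(big_ltn ji) bi /=.
  have := step 1%N isT; rewrite addn1 Q0 => /(_ ji).
  have : e * (j - i.+1)%:R <= e * (j - i)%:R by rewrite ler_wpM2l // ler_nat; lia.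
  have := h1 i; have := ler_normD (h i) (\sum_(i.+1 <= y < j) h y); lra.
have [bi|[q /andP[q0 qQ] hq]] := H i (leqnn _) iQ.
  have ji : (i < j)%N by lia.
  rewrite !(big_ltn ji) bi /=.
  have := step 1%N isT; rewrite addn1 => /(_ ji).
  have : e * (j - i.+1)%:R <= e * (j - i)%:R by rewrite ler_wpM2l // ler_nat; lia.
  have := h1 i; have := ler_normD (h i) (\sum_(i.+1 <= y < j) h y); lra.
have qj : (i + q <= j)%N by lia.
have iq : (i <= i + q)%N by lia.
rewrite (@big_cat_nat _ _ _ (i + q)%N) //= [in leRHS](@big_cat_nat _ _ _ (i + q)%N) //=.
have := step q q0 qj.
have : e * (j - (i + q))%:R + e * q%:R = e * (j - i)%:R.
  by rewrite -mulrDr -natrD; congr (_ * _%:R); lia.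
have := ler_normD (\sum_(i <= l < i + q) h l) (\sum_(i + q <= y < j) h y).
have : 0 <= \sum_(i <= y < i + q) (bad y)%:R :> R by rewrite sumr_ge0.
lra.
Qed.

End Counting.

(** * Negligible errors and the grid *)

Section Negligible.
Context {R : realType}.
Implicit Types (f g : nat -> R).

(** Little-o of [J ^ 2], the order of magnitude of the number of points. *)
Definition negl f := forall e : R, 0 < e ->
  \forall J \near \oo, `|f J| <= e * J%:R ^+ 2.

Lemma negl_add f g : negl f -> negl g -> negl (fun J => f J + g J).
Proof.
move=> hf hg e e0; have e2 : 0 < e / 2 by lra.
near=> J; have hF : `|f J| <= e / 2 * J%:R ^+ 2 by near: J; exact: hf.
have hG : `|g J| <= e / 2 * J%:R ^+ 2 by near: J; exact: hg.
by apply: le_trans (ler_normD _ _) _; lra.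
Unshelve. all: by end_near. Qed.

Lemma negl_scale f (c : R) : negl f -> negl (fun J => c * f J).
Proof.
move=> hf e e0; have c0 : 0 < `|c| + 1 by rewrite ltr_wpDl.
have e2 : 0 < e / (`|c| + 1) by rewrite divr_gt0.
near=> J; have hF : `|f J| <= e / (`|c| + 1) * J%:R ^+ 2 by near: J; exact: hf.
rewrite normrM; apply: (@le_trans _ _ ((`|c| + 1) * `|f J|)).
  by rewrite ler_wpM2r // lerDl.
apply: le_trans (ler_wpM2l (ltW c0) hF) _.
by rewrite mulrA [(_ + 1) * _]mulrC divfK ?lt0r_neq0.
Unshelve. all: by end_near. Qed.

Lemma negl_opp f : negl f -> negl (fun J => - f J).
Proof. by move=> hf e /hf; apply: filterS => J; rewrite normrN. Qed.

Lemma negl_eq f g : (\forall J \near \oo, f J = g J) -> negl f -> negl g.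
Proof. by move=> fg hf e /hf; apply: filterS2 fg => J ->. Qed.

Lemma negl0 : negl (fun=> 0).
Proof. by move=> e e0; near=> J; rewrite normr0 mulr_ge0 ?sqr_ge0 // ltW. Unshelve. all: by end_near. Qed.

Lemma negl_linear f (C : R) : (\forall J \near \oo, `|f J| <= C * J%:R) -> negl f.
Proof.
move=> fC e e0; near=> J.
have hC : `|f J| <= C * J%:R by near: J.
have hJ : C / e <= J%:R by near: J; exact: nbhs_infty_ger.
apply: le_trans hC _; rewrite expr2 mulrA ler_wpM2r //.
by rewrite mulrC -ler_pdivrMr.
Unshelve. all: by end_near. Qed.

Lemma negl_sum (I : eqType) (s : seq I) (F : I -> nat -> R) :
  (forall i, i \in s -> negl (F i)) -> negl (fun J => \sum_(i <- s) F i J).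
Proof.
elim: s => [|i s IH] h.
  by apply: negl_eq negl0; near=> J; rewrite big_nil.
apply: negl_eq (negl_add (h i (mem_head _ _)) (IH _)); last first.
  by move=> j js; apply: h; rewrite inE js orbT.
by near=> J; rewrite big_cons.
Unshelve. all: by end_near. Qed.

End Negligible.

Section Grid.
Context {R : realType}.
Variables (t b0 : R).
Hypotheses (t_gt0 : 0 < t) (b0_gt0 : 0 < b0).
Implicit Types (J m y A B : nat).

(** [absc J m] is the horizontal distance [X] from the viewpoint to column [m],
    the columns being numbered from 0 to [2 * J]. For a point at height [y], a
    point [k] rows higher seen under nearly the same angle lies about
    [k * X / y] columns further, with [X] close to [t * J ^ 2]. Such a point
    exists in the grid when [k <= rows_above], and symmetrically
    [k >= - rows_below]. *)
Definition absc J m : R := t * J%:R ^+ 2 - J%:R + m%:R.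
Definition rows_below J m y : R := m%:R * y%:R / (t * J%:R ^+ 2).
Definition rows_above J m y : R := (2 * J - m)%:R * y%:R / (t * J%:R ^+ 2).
Definition row0 J : nat := (Num.truncn (b0 * J%:R)).+1.
Definition active A B J m y : bool :=
  (Num.truncn (rows_below J m y) == A) && (Num.truncn (rows_above J m y) == B).

Lemma row0_gt J y : (row0 J <= y)%N -> b0 * J%:R < y%:R.
Proof.
rewrite /row0 => h; apply: lt_le_trans (truncnS_gt _) _.
by rewrite ler_nat.
Qed.

Lemma rows_below_ge0 J m y : 0 <= rows_below J m y.
Proof. by rewrite /rows_below divr_ge0 ?mulr_ge0 ?sqr_ge0 // ltW. Qed.

Lemma rows_above_ge0 J m y : 0 <= rows_above J m y.
Proof. by rewrite /rows_above divr_ge0 ?mulr_ge0 ?sqr_ge0 // ltW. Qed.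

(** Where one of these holds, moving by [O(e * J)] columns changes the set of
    active rows. *)
Definition near_wall (e : R) J m y : bool :=
  (frac (rows_below J m y + e) <= 2 * e) || (frac (rows_above J m y + e) <= 2 * e).

(** The two integer parts, hence the window of active rows, are locally constant
    away from the walls. *)
Lemma not_near e (z : R) : 0 < e -> ~~ (frac (z + e) <= 2 * e) -> 0 <= z ->
  (Num.truncn z)%:R + e < z < (Num.truncn z)%:R + 1 - e.
Proof.
move=> e0 + z0; rewrite -ltNge => h; have /andP[t1 t2] := truncn_itv z0.
rewrite -natr1 in t2; move: (Num.truncn z) t1 t2 => n t1 t2.
have l1 : n%:R + e < z.
  rewrite ltNge; apply/negP => hz.
  have : frac (z + e) = z + e - n%:R.
    have [l|l] := ltP (z + e) (n%:R + 1).
      by apply: (@frac_unique _ _ n%:Z); [rewrite -pmulrn; ring|apply/andP; split; lra].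
    have := frac_lt1 (z + e); lra.
  lra.
apply/andP; split=> //; rewrite ltNge; apply/negP => hz.
have [l|l] := ltP e 1; last by have := frac_lt1 (z + e); lra.
have : frac (z + e) = z + e - n%:R - 1.
  apply: (@frac_unique _ _ (n.+1%:Z)); last by apply/andP; split; lra.
  by rewrite -pmulrn -natr1; ring.
lra.
Qed.

Lemma truncn_stable (z s e : R) : (Num.truncn z)%:R + e < z < (Num.truncn z)%:R + 1 - e ->
  0 <= s < e -> Num.truncn (z + s) = Num.truncn z.
Proof.
move: (Num.truncn z) => n /andP[z1 z2] /andP[s0 s1].
by apply: truncn_def; rewrite -natr1; apply/andP; split; lra.
Qed.

Definition wall_const : R := (3 / t + 2) * 2.

Lemma count_near_row e J y : 0 < e -> (0 < J)%N -> (row0 J <= y < J)%N ->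
  \sum_(0 <= m < (2 * J).+1) (near_wall e J m y)%:R <=
    wall_const * (2 * e * t * J%:R / b0 + 1).
Proof.
move=> e0 J0 /andP[yJ yJ1]; have J0R : 0 < J%:R :> R by rewrite ltr0n.
have y1 := row0_gt yJ; have y2 : y%:R <= J%:R :> R by rewrite ler_nat ltnW.
have y0 : 0 < y%:R :> R by apply: le_lt_trans y1; rewrite mulr_ge0 // ltW.
have T0 : 0 < t * J%:R ^+ 2 by rewrite mulr_gt0 ?exprn_gt0.
apply: le_trans (sum_indic_orb _ _ _ _) _.
have E : \sum_(0 <= m < (2 * J).+1) (frac (rows_above J m y + e) <= 2 * e)%R%:R =
   \sum_(0 <= m < (2 * J).+1) (frac (rows_below J m y + e) <= 2 * e)%R%:R :> R.
  rewrite big_nat_rev /= !big_mkord; apply: eq_bigr => i _.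
  rewrite /rows_above /rows_below add0n subSS subKn //.
  by have := ltn_ord i; rewrite ltnS.
pose sigma := y%:R / (t * J%:R ^+ 2).
have s0 : 0 < sigma by rewrite divr_gt0.
have L : \sum_(0 <= m < (2 * J).+1) (frac (rows_below J m y + e) <= 2 * e)%R%:R
    <= (3 / t + 2) * (2 * e * t * J%:R / b0 + 1).
  have -> : \sum_(0 <= m < (2 * J).+1) (frac (rows_below J m y + e) <= 2 * e)%R%:R =
    \sum_(0 <= m < (2 * J).+1) (frac (e + sigma * m%:R) <= 2 * e)%R%:R :> R.
    apply: eq_bigr => m _; rewrite /rows_below /sigma addrC.
    have -> : m%:R * y%:R / (t * J%:R ^+ 2) = y%:R / (t * J%:R ^+ 2) * m%:R.
      by ring.
    by [].
  apply: le_trans (count_frac_arith _ _ s0 _) _; first lra.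
  apply: ler_pM.
  - by have := mulr_ge0 (ltW s0) (ler0n R (2 * J).+1); lra.
  - have : 0 <= 2 * e / sigma by rewrite divr_ge0 ?(ltW s0) //; lra.
    lra.
  - rewrite lerD2r; apply: (@le_trans _ _ (J%:R / (t * J%:R ^+ 2) * (3 * J%:R))).
      apply: ler_pM; [exact: ltW|by []| |].
        by rewrite ler_pM2r // invr_gt0.
      by rewrite -natrM ler_nat; lia.
    by rewrite le_eqVlt; apply/orP; left; apply/eqP; field; rewrite !lt0r_neq0.
  - rewrite lerD2r /sigma invf_div mulrA ler_pdivrMr //.
    have -> : 2 * e * t * J%:R / b0 * y%:R = 2 * e * t * J%:R * (y%:R / b0).
      by field; rewrite lt0r_neq0.
    have -> : 2 * e * (t * J%:R ^+ 2) = 2 * e * t * J%:R * J%:R by ring.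
    rewrite ler_wpM2l ?mulr_ge0 // ?ltW //.
    by rewrite ltr_pdivlMr // mulrC.
by rewrite /wall_const -mulrA E; lra.
Qed.

End Grid.

(** * Equidistribution of X / y modulo 1 *)

Section Equidistribution.
Context {R : realType}.
Variables (t b0 : R).
Hypotheses (t_gt0 : 0 < t) (b0_gt0 : 0 < b0).
Implicit Types (J m y A B : nat).

Let X := @absc R t.

Lemma absc_bounds J m : (m <= 2 * J)%N -> 2 <= t * J%:R ->
  t * J%:R ^+ 2 / 2 <= X J m <= 2 * (t * J%:R ^+ 2).
Proof.
move=> mJ tJ; have : m%:R <= 2 * J%:R :> R by rewrite -natrM ler_nat.
have : 2 * J%:R <= t * J%:R * J%:R by rewrite ler_wpM2r.
have : 0 <= m%:R :> R by [].
by rewrite /X /absc expr2 mulrA => ? ? ?; apply/andP; split; lra.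
Qed.

(** [X / y ^ 2] is the local step of [X / y]; these are the rows where it is
    close to a rational of denominator at most [q0]. *)
Definition small_denom (q0 Q : nat) J m y : bool :=
  has (fun q => frac (q%:R * (X J m / y%:R ^+ 2) + Q%:R^-1) <= 2 / Q%:R) (iota 1 q0).

Lemma small_denomP q0 Q J m y (q p : nat) : (2 < Q)%N -> (0 < q <= q0)%N ->
  `|q%:R * (X J m / y%:R ^+ 2) - p%:R| < Q%:R^-1 -> small_denom q0 Q J m y.
Proof.
move=> Q2 qq; rewrite ltr_norml => /andP[h1 h2]; apply/hasP; exists q.
  by rewrite mem_iota; lia.
have Q2R : 2 < Q%:R :> R by rewrite ltr_nat.
have Q1 : 2 / Q%:R < 1 :> R by rewrite ltr_pdivrMr ?mul1r //; lra.
move: (_ * (_ / _)) h1 h2 => z h1 h2.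
rewrite (@frac_unique _ _ p%:Z (z + Q%:R^-1 - p%:R)); first lra.
  by rewrite -pmulrn; ring.
apply/andP; split; lra.
Qed.

(** The step [X / y ^ 2] decreases at speed at least [t / (2 * J)] in [y] and
    stays bounded, so it spends few rows near a given fraction. *)
Lemma count_small_denom q0 Q J m : (0 < Q)%N -> (m <= 2 * J)%N -> 2 <= t * J%:R ->
  (0 < J)%N ->
  \sum_(row0 b0 J <= y < J) (small_denom q0 Q J m y)%:R <=
    q0%:R * ((Num.truncn (2 * t * q0%:R / b0 ^+ 2)).+3%:R * (4 * J%:R / (t * Q%:R) + 1)).
Proof.
move=> Q0 mJ tJ J0; have /andP[X1 X2] := absc_bounds mJ tJ.
have J0R : 0 < J%:R :> R by rewrite ltr0n.
have Q0R : 0 < Q%:R :> R by rewrite ltr0n.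
have T0 : 0 < t * J%:R ^+ 2 by rewrite mulr_gt0 ?exprn_gt0.
have X0 : 0 < X J m by lra.
set N := (_).+3; set D := 4 * J%:R / _.
have D0 : 0 <= D by rewrite divr_ge0 ?mulr_ge0 // ltW.
pose P q y := frac (q%:R * (X J m / y%:R ^+ 2) + Q%:R^-1) <= 2 / Q%:R.
apply: (@le_trans _ _ (\sum_(q <- iota 1 q0) \sum_(row0 b0 J <= y < J) (P q y)%:R)).
  rewrite exchange_big /=; apply: ler_sum => y _.
  rewrite /small_denom -/(P _ y); elim: (iota 1 q0) => [|q s IH]; first by rewrite big_nil.
  rewrite big_cons /=; rewrite -/(P q y); case: (P q y) => /=; last by rewrite add0r.
  by rewrite lerDl sumr_ge0.
have Q1 : Q%:R^-1 <= 1 :> R by rewrite invf_le1 // ler1n.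
have Q1' : 0 < Q%:R^-1 :> R by rewrite invr_gt0.
have -> : iota 1 q0 = index_iota 1 q0.+1 by rewrite /index_iota subn1.
apply: (@le_trans _ _ (\sum_(1 <= q < q0.+1) N%:R * (D + 1))); last first.
  by rewrite sumr_const_nat subn1 /= -[leLHS]mulr_natl.
rewrite big_nat [leRHS]big_nat; apply: ler_sum => q /andP[q1 qq].
have q1R : 1 <= q%:R :> R by rewrite ler1n.
have qqR : q%:R <= q0%:R :> R by rewrite ler_nat.
have JI : 0 < J%:R^-1 :> R by rewrite invr_gt0.
have inv y : (row0 b0 J <= y)%N -> (y < J)%N -> (J%:R^-1 : R) <= y%:R^-1 <= (b0 * J%:R)^-1.
  move=> /row0_gt y1 y2; have bJ : 0 < b0 * J%:R by rewrite mulr_gt0.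
  have y0 : 0 < y%:R :> R by apply: lt_trans y1.
  by rewrite !lef_pV2 ?posrE // (ltW y1) andbT ler_nat ltnW.
apply: (@count_frac _ _ _ _ _ 0) => //.
  move=> y /andP[y1 y2]; have /andP[i1 i2] := inv y y1 y2.
  have zz : 0 <= q%:R * (X J m / y%:R ^+ 2) by rewrite mulr_ge0 ?divr_ge0 ?sqr_ge0 // ltW.
  apply/andP; split; first by rewrite addr_ge0 // ltW.
  have : q%:R * (X J m / y%:R ^+ 2) <= 2 * t * q0%:R / b0 ^+ 2.
    have -> : 2 * t * q0%:R / b0 ^+ 2 = q0%:R * (2 * (t * J%:R ^+ 2) * ((b0 * J%:R)^-1) ^+ 2).
      by field; rewrite !lt0r_neq0.
    rewrite ler_pM ?divr_ge0 ?sqr_ge0 // -?exprVn ?(ltW X0) //.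
    have yI : 0 < y%:R^-1 :> R by apply: lt_le_trans i1.
    apply: ler_pM => //; first exact: ltW.
    by rewrite ler_pXn2r // nnegrE ltW // (lt_le_trans yI).
  have := truncnS_gt (2 * t * q0%:R / b0 ^+ 2).
  rewrite /N -[_.+3%:R]natr1 -[_.+2%:R]natr1; lra.
move=> y y' y1 /andP[yy y2].
have /andP[i1 _] := inv y y1 (leq_ltn_trans yy y2).
have /andP[i1' _] := inv y' (leq_trans y1 yy) y2.
have y0 : 0 < y%:R :> R by rewrite -invr_gt0 (lt_le_trans JI).
have y0' : 0 < y'%:R :> R by rewrite -invr_gt0 (lt_le_trans JI).
have dy : 0 <= y'%:R - y%:R :> R by rewrite subr_ge0 ler_nat.
have I1 : (y'%:R - y%:R : R) * J%:R^-1 ^+ 3 <= (y%:R ^+ 2)^-1 - (y'%:R ^+ 2)^-1.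
  apply: (@le_trans _ _ ((y'%:R - y%:R) * (y%:R^-1 * y'%:R^-1 * (y%:R^-1 + y'%:R^-1)))); last first.
    by rewrite le_eqVlt; apply/orP; left; apply/eqP; field; rewrite !lt0r_neq0.
  rewrite ler_wpM2l //; have -> : J%:R^-1 ^+ 3 = J%:R^-1 * J%:R^-1 * J%:R^-1 :> R by ring.
  have xi : 0 <= J%:R^-1 :> R by exact: ltW.
  by rewrite !ler_pM ?mulr_ge0 // (le_trans i1) // lerDl ltW // invr_gt0.
set d := (X in _ <= X) in I1.
have -> : q%:R * (X J m / y'%:R ^+ 2) + Q%:R^-1 - (q%:R * (X J m / y%:R ^+ 2) + Q%:R^-1)
    = - (q%:R * (X J m * d)) by rewrite /d; ring.
have dJ : 0 <= (y'%:R - y%:R : R) * J%:R^-1 ^+ 3 by rewrite mulr_ge0 ?exprn_ge0 // ltW.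
have Xd : t * J%:R ^+ 2 / 2 * ((y'%:R - y%:R) * J%:R^-1 ^+ 3) <= X J m * d.
  by rewrite ler_pM // ltW // divr_gt0.
have Xd0 : 0 <= X J m * d by rewrite mulr_ge0 ?(ltW X0) // (le_trans dJ).
have Xdq : X J m * d <= q%:R * (X J m * d) by rewrite ler_peMl.
rewrite normrN ger0_norm => [h|]; last by rewrite mulr_ge0.
have : t * J%:R ^+ 2 / 2 * ((y'%:R - y%:R) * J%:R^-1 ^+ 3) <= 2 / Q%:R by lra.
have -> : t * J%:R ^+ 2 / 2 * ((y'%:R - y%:R) * J%:R^-1 ^+ 3)
   = (y'%:R - y%:R) * (t / (2 * J%:R)) by field; rewrite lt0r_neq0.
rewrite -ler_pdivlMr ?divr_gt0 ?mulr_gt0 // => /le_trans; apply.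
rewrite /D le_eqVlt; apply/orP; left; apply/eqP; field.
by rewrite !lt0r_neq0.
Qed.

Lemma inv_shift (y l : R) : 0 < y -> 0 < y + l ->
  (y + l)^-1 - (y^-1 - l / y ^+ 2) = l ^+ 2 / (y ^+ 2 * (y + l)).
Proof. by move=> y0 yl; field; rewrite !lt0r_neq0. Qed.

(** Weighted by the indicator that exactly the rows [- A, B] are active,
    [X / y] shifted by a slowly varying function averages to 1/2 modulo 1: along
    a column, [X / y] is locally linear with step [X / y ^ 2], and it is
    equidistributed on blocks of length the denominator of an approximation of
    that step, unless this denominator is small. *)
Lemma equidistribution A B (W : nat -> nat -> R) (C : R) : 0 <= C ->
  (forall J y l, (row0 b0 J <= y)%N -> `|W J (y + l)%N - W J y| <= C * l%:R / J%:R) ->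
  negl (fun J => \sum_(0 <= m < (2 * J).+1) \sum_(row0 b0 J <= y < J)
    (active t A B J m y)%:R * (frac (X J m / y%:R - W J y) - 2^-1)).
Proof.
move=> C0 hW e e0.
have triangle (x y z bx bY bz : R) : 0 <= x <= bx -> `|y| <= bY -> `|z| <= bz ->
    `|x - y - z| <= bx + bY + bz.
  rewrite !ler_norml => /andP[? ?] /andP[? ?] /andP[? ?].
  by apply/andP; split; lra.
(* Four errors of relative size e / 8: blocks have length above [q0] and
   average up to an error [1 / q0]; they are at most [Q] long and their step is
   approximated within [1 / Q]; [Q] is large enough for steps near a fraction of
   denominator at most [q0] to be rare; [e1] bounds the distance to the walls. *)
pose q0 := (Num.truncn (24 / e)).+1.
have q0P : 3 / q0%:R <= e / 8.
  rewrite ler_pdivrMr // -ler_pdivrMl ?divr_gt0 //.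
  by apply: le_trans (ltW (truncnS_gt _)); rewrite invf_div; lra.
pose N := (Num.truncn (2 * t * q0%:R / b0 ^+ 2)).+3.
pose Q := (maxn 3 (Num.truncn (96 / e) + Num.truncn (96 * q0%:R * N%:R / t / e)).+1)%N.
have Q2 : (2 < Q)%N by rewrite leq_max.
have Qgt0 : (0 < Q)%N by apply: ltn_trans Q2.
have Q0R : 0 < Q%:R :> R by rewrite ltr0n.
have QP1 : 12 / Q%:R <= e / 8.
  rewrite ler_pdivrMr // -ler_pdivrMl ?divr_gt0 //.
  apply: (@le_trans _ _ (96 / e)); first by rewrite invf_div; lra.
  apply: le_trans (ltW (truncnS_gt _)) _; by rewrite ler_nat leq_max; apply/orP; right; rewrite ltnS leq_addr.
have QP2 : 12 * q0%:R * N%:R / (t * Q%:R) <= e / 8.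
  rewrite invfM mulrA ler_pdivrMr // -ler_pdivrMl ?divr_gt0 //.
  apply: (@le_trans _ _ (96 * q0%:R * N%:R / t / e)).
    by rewrite invf_div le_eqVlt; apply/orP; left; apply/eqP; field; rewrite !lt0r_neq0.
  apply: le_trans (ltW (truncnS_gt _)) _; by rewrite ler_nat leq_max; apply/orP; right; rewrite ltnS leq_addl.
have wc0 : 0 < wall_const t by rewrite /wall_const mulr_gt0 // addr_gt0 // divr_gt0.
pose e1 := e / 8 * b0 / (2 * t * wall_const t).
have e10 : 0 < e1 by apply: divr_gt0; apply: mulr_gt0 => //; [lra|apply: mulr_gt0].
have e1P : wall_const t * (2 * e1 * t / b0) <= e / 8.
  by rewrite le_eqVlt; apply/orP; left; apply/eqP; rewrite /e1; field; rewrite !lt0r_neq0.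
have q0_gt0 : (0 < q0)%N by [].
clearbody e1 Q q0.
near=> J.
have J0R : 0 < J%:R :> R by near: J; exact: nbhs_infty_gtr.
have J0 : (0 < J)%N by rewrite -(ltr_nat R).
have JI : 0 < J%:R^-1 :> R by rewrite invr_gt0.
have tJ : 2 <= t * J%:R.
  by rewrite -ler_pdivrMl //; near: J; exact: nbhs_infty_ger.
have hJ1 : (3 * Q%:R + wall_const t + 3 * q0%:R * N%:R) / (e / 8) <= J%:R.
  by near: J; exact: nbhs_infty_ger.
have hJ2 : Q%:R * (2 * t * Q%:R ^+ 2 / b0 ^+ 3 + C * Q%:R) <= J%:R.
  by near: J; exact: nbhs_infty_ger.
have hJ3 : (2 * Q%:R) / (t * e1) < J%:R by near: J; exact: nbhs_infty_gtr.
pose h m y : R := (active t A B J m y)%:R * (frac (X J m / y%:R - W J y) - 2^-1).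
pose bad m y := near_wall t e1 J m y || small_denom q0 Q J m y.
have h1 m y : `|h m y| <= 1.
  rewrite /h; case: (active _ _ _ _ _ _) => /=; last by rewrite mul0r normr0.
  have := frac_itv (X J m / y%:R - W J y).
  by rewrite mul1r ler_norml => /andP[? ?]; apply/andP; split; lra.
have hbad m y : (m <= 2 * J)%N -> (row0 b0 J <= y)%N -> (y + Q <= J)%N ->
    bad m y \/ exists2 q, (0 < q <= Q)%N &
      `|\sum_(y <= l < y + q) h m l| <= (4 / Q%:R + q0%:R^-1) * q%:R.
  move=> mJ y1 yQ; have [|/norP[nw ns]] := boolP (bad m y); [by left|right].
  have y1R := row0_gt y1.
  have bJ0 : 0 < b0 * J%:R by rewrite mulr_gt0.
  have y0R : 0 < y%:R :> R by apply: lt_trans y1R.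
  have /andP[X1 X2] := absc_bounds mJ tJ.
  have X0 : 0 < X J m by apply: lt_le_trans X1; rewrite divr_gt0 ?mulr_gt0 ?exprn_gt0.
  have [|q [p [qQ cqp close]]] := @dirichlet R (X J m / y%:R ^+ 2) Q _ Qgt0.
    by rewrite divr_ge0 ?sqr_ge0 // ltW.
  have /andP[q_gt0 qleQ] := qQ.
  have q1 : (q0 < q)%N.
    rewrite ltnNge; apply: contra ns => qq.
    by apply: small_denomP close; rewrite ?q_gt0.
  exists q => //.
  have q0R' : 0 < q%:R :> R by rewrite ltr0n.
  have shift l k : (l < q)%N -> (k <= 2 * J)%N ->
      0 <= k%:R * l%:R / (t * J%:R ^+ 2) < e1.
    move=> lq kJ; rewrite divr_ge0 ?mulr_ge0 ?sqr_ge0 ?(ltW t_gt0) //=.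
    rewrite ltr_pdivrMr ?mulr_gt0 ?exprn_gt0 //.
    move: hJ3; rewrite ltr_pdivrMr ?mulr_gt0 // => hJ3.
    apply: (@le_lt_trans _ _ (2 * J%:R * Q%:R)).
      by rewrite ler_pM // -?natrM ler_nat // (leq_trans (ltnW lq)).
    have -> : 2 * J%:R * Q%:R = J%:R * (2 * Q%:R) :> R by ring.
    have -> : e1 * (t * J%:R ^+ 2) = J%:R * (J%:R * (t * e1)) by ring.
    by rewrite ltr_pM2l.
  have act l : (l < q)%N -> active t A B J m (y + l) = active t A B J m y.
    move=> lq; move: nw; rewrite /near_wall negb_or => /andP[na nb].
    have a := not_near e10 na (rows_below_ge0 t_gt0 J m y).
    have b := not_near e10 nb (rows_above_ge0 t_gt0 J m y).
    have EA : Num.truncn (rows_below t J m (y + l)) = Num.truncn (rows_below t J m y).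
      have -> : rows_below t J m (y + l) = rows_below t J m y + m%:R * l%:R / (t * J%:R ^+ 2).
        by rewrite /rows_below natrD; ring.
      exact: truncn_stable a (shift l m lq mJ).
    have EB : Num.truncn (rows_above t J m (y + l)) = Num.truncn (rows_above t J m y).
      have -> : rows_above t J m (y + l) = rows_above t J m y
          + (2 * J - m)%:R * l%:R / (t * J%:R ^+ 2).
        by rewrite /rows_above natrD; ring.
      exact: truncn_stable b (shift l (2 * J - m)%N lq (leq_subr _ _)).
    by rewrite /active EA EB.
  pose z l : R := X J m / (y + l)%N%:R - W J (y + l)%N.
  have -> : \sum_(y <= l < y + q) h m l =
      (active t A B J m y)%:R * \sum_(0 <= l < q) (frac (z l) - 2^-1).
    rewrite -{1}[y]add0n big_addn addKn mulr_sumr !big_nat; apply: eq_bigr.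
    by move=> l /andP[_ lq]; rewrite /h /z addnC act.
  have blk : `|\sum_(0 <= l < q) (frac (z l) - 2^-1)| <= 2 * q%:R * (2 / Q%:R) + 1.
    apply: (@frac_sum_block _ p q z (X J m / y%:R - W J y)) => //.
    move=> l lq; have l0 : 0 <= l%:R :> R by [].
    have lQ : l%:R <= Q%:R :> R by rewrite ler_nat (leq_trans (ltnW lq)).
    have lqR : l%:R <= q%:R :> R by rewrite ler_nat ltnW.
    have yl0 : 0 < y%:R + l%:R :> R by rewrite ltr_wpDr.
    have E1 : `|l%:R * (X J m / y%:R ^+ 2 - p%:R / q%:R)| <= Q%:R^-1.
      rewrite normrM ger0_norm //.
      apply: (@le_trans _ _ (q%:R * `|X J m / y%:R ^+ 2 - p%:R / q%:R|)).
        by rewrite ler_wpM2r.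
      rewrite -[X in X * _](gtr0_norm q0R') -normrM mulrBr.
      by rewrite [q%:R * (p%:R / _)]mulrCA mulfV ?lt0r_neq0 // mulr1 ltW.
    have E2 : `|W J (y + l)%N - W J y| <= C * Q%:R / J%:R.
      apply: le_trans (hW _ _ _ y1) _.
      by rewrite ler_pM2r // ler_wpM2l.
    have E3 : 0 <= X J m * (l%:R ^+ 2 / (y%:R ^+ 2 * (y%:R + l%:R)))
        <= 2 * t * Q%:R ^+ 2 / b0 ^+ 3 / J%:R.
      rewrite mulr_ge0 ?divr_ge0 ?mulr_ge0 ?sqr_ge0 ?(ltW X0) ?(ltW yl0) //=.
      have -> : 2 * t * Q%:R ^+ 2 / b0 ^+ 3 / J%:R =
          2 * (t * J%:R ^+ 2) * (Q%:R ^+ 2 / ((b0 * J%:R) ^+ 2 * (b0 * J%:R))).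
        by field; rewrite !lt0r_neq0.
      apply: ler_pM => //; first exact: ltW.
      apply: ler_pM; rewrite ?sqr_ge0 // ?invr_ge0 ?mulr_ge0 ?sqr_ge0 ?(ltW yl0) //.
        by rewrite ler_pXn2r // nnegrE.
      rewrite lef_pV2 ?posrE ?mulr_gt0 ?exprn_gt0 //.
      apply: ler_pM; rewrite ?sqr_ge0 ?(ltW bJ0) //; last by rewrite ler_wpDr // ltW.
      by rewrite ler_pXn2r ?nnegrE ?(ltW bJ0) ?(ltW y1R) // ltW.
    have E4 : 2 * t * Q%:R ^+ 2 / b0 ^+ 3 / J%:R + C * Q%:R / J%:R <= Q%:R^-1.
      rewrite -mulrDl ler_pdivrMr // -ler_pdivrMl ?invr_gt0 // invrK.
      exact: hJ2.
    have -> : z l - (X J m / y%:R - W J y - l%:R * (p%:R / q%:R)) =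
      X J m * ((y%:R + l%:R)^-1 - (y%:R^-1 - l%:R / y%:R ^+ 2))
        - l%:R * (X J m / y%:R ^+ 2 - p%:R / q%:R) - (W J (y + l)%N - W J y).
      by rewrite /z natrD; ring.
    rewrite inv_shift //.
    apply: le_trans (triangle _ _ _ _ _ _ E3 E1 E2) _.
    have -> : 2 / Q%:R = Q%:R^-1 + Q%:R^-1 :> R by rewrite mulr_natl mulr2n.
    by rewrite addrAC lerD2r.
  have q0R : 0 < q0%:R :> R by rewrite ltr0n.
  have qq0 : 1 <= q0%:R^-1 * q%:R :> R by rewrite mulrC ler_pdivlMr // mul1r ler_nat ltnW.
  rewrite normrM; apply: (@le_trans _ _ (1 * (2 * q%:R * (2 / Q%:R) + 1))).
    apply: ler_pM => //; case: (active _ _ _ _ _ _); rewrite ?normr1 ?normr0 //.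
  by rewrite mul1r mulrDl; lra.
rewrite -/(h _ _).
have colsum m : (m <= 2 * J)%N -> `|\sum_(row0 b0 J <= y < J) h m y| <=
   (4 / Q%:R + q0%:R^-1) * J%:R + \sum_(row0 b0 J <= y < J) (bad m y)%:R + Q%:R.
  move=> mJ; apply: greedy_blocks => //.
  by move=> y; exact: hbad.
apply: le_trans (ler_norm_sum _ _ _) _.
pose S1 : R := \sum_(0 <= m < (2 * J).+1) \sum_(row0 b0 J <= y < J) (near_wall t e1 J m y)%:R.
pose K2 : R := q0%:R * (N%:R * (4 * J%:R / (t * Q%:R) + 1)).
have M3 : (2 * J).+1%:R <= 3 * J%:R :> R by rewrite -natrM ler_nat mulSn -addn1 addnC leq_add.
apply: (@le_trans _ _ (S1 + (2 * J).+1%:R *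
     ((4 / Q%:R + q0%:R^-1) * J%:R + Q%:R + K2))).
  set c : R := (X in _ <= _ + _ * X).
  have -> : (2 * J).+1%:R * c = \sum_(0 <= m < (2 * J).+1) c.
    by rewrite sumr_const_nat subn0 mulr_natl.
  rewrite /S1 -big_split /=.
  rewrite big_nat [leRHS]big_nat; apply: ler_sum => m /andP[_ mJ].
  apply: le_trans (colsum m mJ) _.
  have := @sum_indic_orb R (row0 b0 J) J (near_wall t e1 J m) (small_denom q0 Q J m).
  have := @count_small_denom q0 Q J m Qgt0 mJ tJ J0; rewrite -/N -/K2.
  by rewrite /bad /c; lra.
have hS1 : S1 <= J%:R * (wall_const t * (2 * e1 * t * J%:R / b0 + 1)).
  rewrite /S1 exchange_big /=; apply: sum_const_le.
    rewrite mulr_ge0 ?(ltW wc0) // addr_ge0 // divr_ge0 ?mulr_ge0 ?(ltW t_gt0) ?(ltW e10) //.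
    exact: ltW.
  by move=> y hy; exact: count_near_row.
have i0 : 0 <= q0%:R^-1 :> R by rewrite invr_ge0.
have iQ : 0 <= 4 / Q%:R :> R by rewrite divr_ge0.
have K20 : 0 <= K2.
  by rewrite /K2 !mulr_ge0 // addr_ge0 // divr_ge0 ?mulr_ge0 // ltW.
apply: (@le_trans _ _ (J%:R * (wall_const t * (2 * e1 * t * J%:R / b0 + 1)) +
   3 * J%:R * ((4 / Q%:R + q0%:R^-1) * J%:R + Q%:R + K2))).
  apply: lerD => //; rewrite ler_wpM2r // !addr_ge0 // mulr_ge0 // addr_ge0 //.
rewrite ler_pdivrMr ?divr_gt0 // in hJ1.
have -> : J%:R * (wall_const t * (2 * e1 * t * J%:R / b0 + 1)) +
   3 * J%:R * ((4 / Q%:R + q0%:R^-1) * J%:R + Q%:R + K2) =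
   (wall_const t * (2 * e1 * t / b0) + 12 / Q%:R + 3 / q0%:R
      + 12 * q0%:R * N%:R / (t * Q%:R)) * J%:R ^+ 2
   + (3 * Q%:R + wall_const t + 3 * q0%:R * N%:R) * J%:R.
  rewrite /K2; set x := (t * Q%:R)^-1; set x2 := Q%:R^-1; set x3 := q0%:R^-1; set x4 := b0^-1.
  by ring.
have J2 : 0 <= J%:R ^+ 2 :> R by rewrite sqr_ge0.
apply: (@le_trans _ _ ((e / 8 + e / 8 + e / 8 + e / 8) * J%:R ^+ 2 + (J%:R * (e / 8)) * J%:R)).
  apply: lerD; rewrite ler_wpM2r //.
  by rewrite !lerD.
have : 0 <= e * J%:R ^+ 2 by rewrite mulr_ge0 // ltW.
by rewrite expr2; lra.
Unshelve. all: by end_near. Qed.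

End Equidistribution.

(** * Windows cut out in an arc by a distance threshold *)

Section Windows.
Context {R : realType}.
Implicit Types (P al ga de w c : R).

Definition pos (x : R) : R := Num.max x 0.
Definition clip P1 P2 (c : R) : R := Num.max P1 (Num.min P2 c).

(** Endpoints of the part of [P1, P2) where [al * w + ga] exceeds [de]. *)
Definition win_lo P1 P2 al ga de : R :=
  if 0 < al then clip P1 P2 ((de - ga) / al) else P1.
Definition win_hi P1 P2 al ga de : R :=
  if al < 0 then clip P1 P2 ((de - ga) / al)
  else if (al == 0) && (ga < de) then P1 else P2.

Lemma clipP P1 P2 c : P1 <= P2 ->
  [\/ P2 <= c /\ clip P1 P2 c = P2, (P1 <= c /\ c <= P2) /\ clip P1 P2 c = c
    | c <= P1 /\ clip P1 P2 c = P1].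
Proof.
move=> h; rewrite /clip; have [h1|h1] := leP P2 c; have [h2|h2] := leP P1 c.
- by apply: Or31; rewrite max_r.
- lra.
- by apply: Or32; rewrite (ltW h1).
- by apply: Or33; rewrite (ltW h2).
Qed.

Lemma clip_itv P1 P2 c : P1 <= P2 -> P1 <= clip P1 P2 c <= P2.
Proof.
by move=> h; have [[? ->]|[[? ?] ->]|[? ->]] := clipP c h; apply/andP; split; lra.
Qed.

Lemma win_itv P1 P2 al ga de : P1 <= P2 ->
  [/\ P1 <= win_lo P1 P2 al ga de, win_lo P1 P2 al ga de <= win_hi P1 P2 al ga de
    & win_hi P1 P2 al ga de <= P2].
Proof.
move=> h; rewrite /win_lo /win_hi.
have /andP[c1 c2] := clip_itv ((de - ga) / al) h.
have [a|a|a] := ltgtP al 0; rewrite ?c1 ?c2 //.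
by case: (ga < de); rewrite lexx.
Qed.

Lemma clip_lip P1 P2 c c' : P1 <= P2 -> `|clip P1 P2 c - clip P1 P2 c'| <= `|c - c'|.
Proof.
move=> h; have n1 := ler_norm (c - c'); have n2 := ler_norm (c' - c).
rewrite distrC in n2; have n3 := normr_ge0 (c - c').
have [[? ->]|[[? ?] ->]|[? ->]] := clipP c h;
have [[? ->]|[[? ?] ->]|[? ->]] := clipP c' h; rewrite ler_norml; apply/andP; split; lra.
Qed.

(** An integral slope is at least 1 in absolute value, so the window moves no
    faster than its threshold; equidistribution applies to slowly moving
    windows. *)
Lemma win_lip P1 P2 al ga de de' : P1 <= P2 -> 1 <= `|al| ->
  `|win_lo P1 P2 al ga de - win_lo P1 P2 al ga de'| <= `|de - de'| /\
  `|win_hi P1 P2 al ga de - win_hi P1 P2 al ga de'| <= `|de - de'|.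
Proof.
move=> h a1; have al0 : al != 0 by rewrite -normr_gt0 (lt_le_trans _ a1).
have C : `|clip P1 P2 ((de - ga) / al) - clip P1 P2 ((de' - ga) / al)| <= `|de - de'|.
  apply: le_trans (clip_lip _ _ h) _.
  rewrite -mulrBl opprB addrA subrK normrM normfV.
  by rewrite ler_pdivrMr ?(lt_le_trans _ a1) // ler_peMr.
by rewrite /win_lo /win_hi (negbTE al0) /=; case: ltgtP al0 => // ? _;
  rewrite subrr normr0.
Qed.

Lemma win_mem P1 P2 al ga de w : P1 <= w < P2 -> al * w + ga != de ->
  (win_lo P1 P2 al ga de <= w) && (w < win_hi P1 P2 al ga de) = (de < al * w + ga).
Proof.
move=> /andP[w1 w2] ne; rewrite /win_lo /win_hi.
have [a|a|a] := ltgtP al 0.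
- have -> : (de < al * w + ga) = (w < (de - ga) / al).
    by rewrite ltr_ndivlMr // ltrBlDr mulrC.
  rewrite w1 /=; have h := ltW (le_lt_trans w1 w2).
  by have [[? ->]|[[? ?] ->]|[? ->]] := clipP ((de - ga) / al) h; apply/idP/idP; lra.
- have c : (de < al * w + ga) = ((de - ga) / al <= w).
    by rewrite lt_neqAle eq_sym ne ler_pdivrMr // lerBlDr mulrC.
  rewrite c w2 andbT; have h := ltW (le_lt_trans w1 w2).
  by have [[? ->]|[[? ?] ->]|[? ->]] := clipP ((de - ga) / al) h; apply/idP/idP; lra.
- move: ne; rewrite a mul0r add0r w1 /= => ne.
  have [l|l|l] := ltgtP ga de => //=; last by rewrite l eqxx in ne.
  by apply/negbTE; rewrite -leNgt.
Qed.

Lemma win_len P1 P2 al ga de : P1 <= P2 -> al != 0 ->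
  win_hi P1 P2 al ga de - win_lo P1 P2 al ga de =
  (pos (al * P2 + ga - de) - pos (al * P1 + ga - de)) / al.
Proof.
move=> h a0; set c := (de - ga) / al.
have E x : al * x + ga - de = al * (x - c) by rewrite /c; field.
rewrite !E /win_lo /win_hi (negbTE a0) /= -/c.
have [a|a|a] := ltgtP al 0; last by rewrite a eqxx in a0.
- have P x : pos (al * x) / al = - pos (- x).
    rewrite /pos; have [x0|x0] := leP x 0.
      by rewrite max_l ?nmulr_rge0 // max_l ?oppr_ge0 // mulrAC mulfV // mul1r opprK.
    by rewrite max_r ?nmulr_rle0 ?ltW // max_r ?mul0r ?oppr0 // oppr_le0 ltW.
  rewrite mulrBl !P /pos; have [[? ->]|[[? ?] ->]|[? ->]] := clipP c h;
  have [h3|h3] := leP (- (P2 - c)) 0; have [h4|h4] := leP (- (P1 - c)) 0; lra.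
- have P x : pos (al * x) / al = pos x.
    rewrite /pos; have [x0|x0] := leP x 0.
      by rewrite max_r ?pmulr_rle0 // mul0r.
    by rewrite max_l ?mulr_ge0 ?(ltW a) ?(ltW x0) // mulrAC mulfV // mul1r.
  rewrite mulrBl !P /pos; have [[? ->]|[[? ?] ->]|[? ->]] := clipP c h;
  have [h3|h3] := leP (P2 - c) 0; have [h4|h4] := leP (P1 - c) 0; lra.
Qed.

End Windows.

Section ArcWindow.
Context {R : realType}.
Implicit Types (A B : nat) (a : (nat * nat) * (nat * nat)) (de : R).

Definition arc_lo A B a de : R :=
  win_lo (ratio a.1) (ratio a.2) (slope A B a)%:~R (icept A B a)%:~R de.
Definition arc_hi A B a de : R :=
  win_hi (ratio a.1) (ratio a.2) (slope A B a)%:~R (icept A B a)%:~R de.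

Lemma slope_neq0 A B a : is_arc (A + B) a -> (0 < A + B)%N -> slope A B a != 0.
Proof.
case: a => [[p1 q1] [p2 q2]]; case/and4P=> /= /andP[a1 a2] /andP[a3 a4] a5 /eqP a6 n0.
rewrite /slope /=; case: leqP => c1; first by lia.
case: leqP => c2; first by lia.
apply/eqP => e; have e' : q1 = q2 by lia.
subst q2; have [d|d] := ltnP p1 p2; last by nia.
have : (q1 * (p2 - p1) = 1)%N by nia.
by move=> /eqP; rewrite muln_eq1 => /andP[/eqP q1E _]; lia.
Qed.

(** Coefficients of the two ramps in the length of an arc window, the kinks
    being at the values [1 / q] of the distance at the ends of the arc. *)
Definition ramp_r A B a : R :=
  ((a.1.2 <= B) || (A < a.2.2))%N%:R / (slope A B a)%:~R.
Definition ramp_l A B a : R := - ((B < a.1.2)%N%:R / (slope A B a)%:~R).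

Lemma arc_len A B a de : is_arc (A + B) a -> (0 < A + B)%N -> 0 <= de ->
  arc_hi A B a de - arc_lo A B a de =
  ramp_r A B a * pos (a.2.2%:R^-1 - de) + ramp_l A B a * pos (a.1.2%:R^-1 - de).
Proof.
move=> arc n0 de0; have s0 := slope_neq0 arc n0.
rewrite /arc_hi /arc_lo win_len ?intr_eq0 //; last exact: ltW (ratio_lt arc).
rewrite mulrBl [RHS]addrC.
case: a arc s0 => [[p1 q1] [p2 q2]] /and4P[/= /andP[a1 a2] /andP[a3 a4] a5 /eqP a6] s0.
have DR : q1%:R * p2%:R = p1%:R * q2%:R + 1 :> R by rewrite -!natrM a6 natrD.
have q10 : q1%:R != 0 :> R by rewrite pnatr_eq0 -lt0n.
have q20 : q2%:R != 0 :> R by rewrite pnatr_eq0 -lt0n.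
have e2 : p2%:R / q2%:R = p1%:R / q1%:R + q1%:R^-1 * q2%:R^-1 :> R.
  apply: (mulfI q10); apply: (mulIf q20).
  have -> : q1%:R * (p2%:R / q2%:R) * q2%:R = q1%:R * p2%:R :> R by field.
  by rewrite DR; field; rewrite q10 q20.
have pos0 : pos (- de) = 0 by rewrite /pos max_r // oppr_le0.
move: s0; rewrite /ramp_r /ramp_l /slope /icept /ratio /=.
case: leqP => c1 /= s0.
  rewrite !rmorphN /= -!pmulrn e2.
  have -> : q1%:R * (p1%:R / q1%:R + q1%:R^-1 * q2%:R^-1) + - p1%:R - de = q2%:R^-1 - de :> R.
    by field; rewrite q10 q20.
  have -> : q1%:R * (p1%:R / q1%:R) + - p1%:R - de = - de :> R by field.
  by rewrite pos0; ring.
case: (leqP q2 A) s0 => c2 /= s0.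
  rewrite !rmorphN /= -!pmulrn.
  have -> : - q2%:R * (p1%:R / q1%:R) + p2%:R - de = q1%:R^-1 - de :> R.
    have -> : p2%:R = p2%:R / q2%:R * q2%:R :> R by field.
    by rewrite e2; field; rewrite q10 q20.
  have -> : - q2%:R * (p2%:R / q2%:R) + p2%:R - de = - de :> R by field.
  by rewrite pos0; ring.
rewrite !rmorphB /= -!pmulrn.
have -> : (q1%:R - q2%:R) * (p2%:R / q2%:R) + (p2%:R - p1%:R) - de = q2%:R^-1 - de :> R.
  by rewrite mulrBl e2; have -> : p2%:R = p2%:R / q2%:R * q2%:R :> R; [field|rewrite e2; field; rewrite q10 q20].
have -> : (q1%:R - q2%:R) * (p1%:R / q1%:R) + (p2%:R - p1%:R) - de = q1%:R^-1 - de :> R.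
  by have -> : p2%:R = p2%:R / q2%:R * q2%:R :> R; [field|rewrite e2; field; rewrite q10 q20].
by ring.
Qed.

(** With a single active row the distance is constantly 1, the only case of slope
    0, and [arc_len] does not apply. *)
Lemma arc_len0 de : arc_hi 0 0 ((0, 1), (1, 1))%N de - arc_lo 0 0 ((0, 1), (1, 1))%N de
  = (de <= 1)%R%:R.
Proof.
rewrite /arc_hi /arc_lo /win_hi /win_lo /ratio /slope /icept /= subrr ltxx eqxx /=.
by rewrite subr0 !divr1 mulr1n subr0; have [h|h] := leP de 1; rewrite ?subr0.
Qed.

End ArcWindow.

(** * Number of columns with given active rows *)

Section ActiveCount.
Context {R : realType}.
Variables (t b0 : R).
Hypotheses (t_gt0 : 0 < t) (b0_gt0 : 0 < b0).
Implicit Types (J m y A B : nat).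

(** Density, at height [b], of the columns with exactly [n] other active rows. *)
Definition tent (n : nat) (b : R) : R :=
  Num.max 0 (Num.min (2 - n%:R * t / b) (n.+2%:R * t / b - 2)).

Lemma count_open_interval (j : nat) (lo hi : R) : 0 <= lo -> hi <= j%:R ->
  hi - lo - 2 <= \sum_(0 <= m < j.+1) (lo < m%:R < hi)%R%:R.
Proof.
move=> lo0 hij; have [|lohi] := leP hi lo.
  by move=> h; apply: (@le_trans _ _ 0); [lra|exact: sumr_ge0].
have hi0 : 0 <= hi by lra.
have /andP[a1 a2] := truncn_itv lo0; have /andP[b1 b2] := truncn_itv hi0.
rewrite -natr1 in b2.
have trj : (Num.truncn hi <= j)%N by rewrite -(ler_nat R); lra.
have [h|h] := leqP (Num.truncn hi) (Num.truncn lo).+1.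
  apply: (@le_trans _ _ 0); last exact: sumr_ge0.
  have : (Num.truncn hi)%:R <= (Num.truncn lo).+1%:R :> R by rewrite ler_nat.
  rewrite -natr1; lra.
have h' := ltnW h.
rewrite (@big_cat_nat _ _ _ (Num.truncn lo).+1) //=; last by lia.
rewrite (@big_cat_nat _ _ _ (Num.truncn hi) (Num.truncn lo).+1) //=; last by lia.
have -> : \sum_((Num.truncn lo).+1 <= m < Num.truncn hi) (lo < m%:R < hi)%R%:R
   = (Num.truncn hi - (Num.truncn lo).+1)%:R :> R.
  rewrite big_nat (eq_bigr (fun=> 1)) -?big_nat ?sumr_const_nat //.
  move=> m /andP[m1 m2]; have -> : lo < m%:R by apply: lt_le_trans a2 _; rewrite ler_nat.
  by have -> : m%:R < hi by apply: lt_le_trans b1; rewrite ltr_nat.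
rewrite natrB // -[(Num.truncn lo).+1%:R]natr1.
apply: (@le_trans _ _ (0 + ((Num.truncn hi)%:R - ((Num.truncn lo)%:R + 1) + 0))); first lra.
by rewrite !lerD ?sumr_ge0.
Qed.

(** Both floor conditions are intervals for [m], of endpoints [A * T],
    [(A + 1) * T] and [2 * J - (B + 1) * T], [2 * J - B * T] with
    [T = t * J ^ 2 / y]; the length of their intersection depends on [A + B]
    alone. *)
Lemma count_active A B J y : (0 < J)%N -> (0 < y)%N ->
  `|\sum_(0 <= m < (2 * J).+1) (active t A B J m y)%:R
     - J%:R * tent (A + B) (y%:R / J%:R)| <= 2.
Proof.
move=> J0 y0; have J0R : 0 < J%:R :> R by rewrite ltr0n.
have y0R : 0 < y%:R :> R by rewrite ltr0n.
pose T := t * J%:R ^+ 2 / y%:R; have T0 : 0 < T by rewrite divr_gt0 ?mulr_gt0 ?exprn_gt0.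
pose lo := Num.max (A%:R * T) (2 * J%:R - (B%:R + 1) * T).
pose hi := Num.min ((A%:R + 1) * T) (2 * J%:R - B%:R * T).
have E : J%:R * tent (A + B) (y%:R / J%:R) = Num.max 0 (hi - lo).
  have zT : t / (y%:R / J%:R) = T / J%:R by rewrite /T; field; rewrite !lt0r_neq0.
  rewrite /tent maxr_pMr ?(ltW J0R) // mulr0 minr_pMr ?(ltW J0R) //.
  rewrite -!mulrA zT -[(A + B).+2%:R]natr1 -[(A + B).+1%:R]natr1 natrD.
  have -> : J%:R * (2 - (A%:R + B%:R) * (T / J%:R)) = 2 * J%:R - (A%:R + B%:R) * T.
    by field; rewrite lt0r_neq0.
  have -> : J%:R * ((A%:R + B%:R + 1 + 1) * (T / J%:R) - 2) =
     (A%:R + B%:R + 2) * T - 2 * J%:R by field; rewrite lt0r_neq0.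
  congr (Num.max 0 _); rewrite /hi /lo.
  have [h1|h1] := leP ((A%:R + 1) * T) (2 * J%:R - B%:R * T);
  have [h2|h2] := leP (A%:R * T) (2 * J%:R - (B%:R + 1) * T);
  have [h3|h3] := leP (2 * J%:R - (A%:R + B%:R) * T) ((A%:R + B%:R + 2) * T - 2 * J%:R); lra.
have actE m : (m <= 2 * J)%N -> active t A B J m y =
   [&& A%:R * T <= m%:R, m%:R < (A%:R + 1) * T, B%:R * T <= 2 * J%:R - m%:R
     & 2 * J%:R - m%:R < (B%:R + 1) * T].
  move=> mJ; rewrite /active !truncn_eq ?rows_below_ge0 ?rows_above_ge0 //.
  have e1 : rows_below t J m y = m%:R / T by rewrite /rows_below /T; field; rewrite !lt0r_neq0.
  have e2 : rows_above t J m y = (2 * J%:R - m%:R) / T.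
    by rewrite /rows_above /T natrB // natrM; field; rewrite !lt0r_neq0.
  by rewrite e1 e2 !ler_pdivlMr // !ltr_pdivrMr // -!natr1 -andbA.
rewrite E maxC; have [hl|hl] := ltP (hi - lo) 0.
  rewrite big_nat big1 ?subrr ?normr0 // => m /andP[_ mJ].
  rewrite actE //; apply/eqP; rewrite pnatr_eq0 eqb0; apply/negP => /and4P[c1 c2 c3 c4].
  move: hl; rewrite /hi /lo.
  by have [h1|h1] := leP ((A%:R + 1) * T) (2 * J%:R - B%:R * T);
  have [h2|h2] := leP (A%:R * T) (2 * J%:R - (B%:R + 1) * T); lra.
have lo0 : 0 <= lo by rewrite /lo le_max mulr_ge0 // ltW.
have hiJ : hi <= (2 * J)%:R.
  rewrite /hi natrM ge_min; apply/orP; right; have := mulr_ge0 (ler0n R B) (ltW T0); lra.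
have low := count_open_interval lo0 hiJ.
have up : \sum_(0 <= m < (2 * J).+1) (active t A B J m y)%:R <= hi - lo + 1.
  apply: count_spread => //.
  move=> m m' _ /andP[mm m'J]; rewrite !actE //; last exact: leq_ltn_trans mm m'J.
  move=> /and4P[c1 c2 c3 c4] /and4P[d1 d2 d3 d4]; rewrite /hi /lo.
  by have [h1|h1] := leP ((A%:R + 1) * T) (2 * J%:R - B%:R * T);
  have [h2|h2] := leP (A%:R * T) (2 * J%:R - (B%:R + 1) * T); lra.
have mid : \sum_(0 <= m < (2 * J).+1) (lo < m%:R < hi)%R%:R <=
   \sum_(0 <= m < (2 * J).+1) (active t A B J m y)%:R :> R.
  apply: sum_indic_le => m /andP[_ mJ]; rewrite actE // /lo /hi gt_max lt_min.
  by move=> /andP[/andP[c1 c2] /andP[c3 c4]]; apply/and4P; split; lra.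
by rewrite ler_norml; apply/andP; split; lra.
Qed.

End ActiveCount.

(** * Riemann sums *)

Section Riemann.
Context {R : realType}.
Variables (b0 : R).
Hypotheses (b0_gt0 : 0 < b0).
Implicit Types (J m y A B : nat) (c b lo hi e : R).

(** [prim] is the antiderivative of [integrand], and [piece] the integral from
    [lo] to [hi], or 0 when [hi <= lo]. *)
Definition prim c0 c1 c2 b : R := c0 * b + c1 * ln b - c2 / b.
Definition integrand c0 c1 c2 b : R := c0 + c1 / b + c2 / b ^+ 2.
Definition piece c0 c1 c2 lo hi : R := prim c0 c1 c2 (Num.max lo hi) - prim c0 c1 c2 lo.

Let prim_const c1 c2 : R := `|c1| / b0 ^+ 2 + `|c2| / b0 ^+ 3.

Lemma prim_const_ge0 c1 c2 : 0 <= prim_const c1 c2.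
Proof. by rewrite addr_ge0 // divr_ge0 // exprn_ge0 // ltW. Qed.

Lemma ln_step b e : b0 <= b -> 0 <= e ->
  `|ln (b + e) - ln b - e / b| <= e ^+ 2 / b0 ^+ 2.
Proof.
move=> hb e0; have b_gt0 : 0 < b by apply: lt_le_trans hb.
pose z := e / b; have z0 : 0 <= z by rewrite divr_ge0 // ltW.
have -> : ln (b + e) = ln b + ln (1 + z).
  by rewrite -lnM ?posrE ?ltr_wpDr //; congr ln; rewrite /z; field; rewrite lt0r_neq0.
have up : ln (1 + z) <= z by apply: le_ln1Dx; lra.
have z1 : 0 < 1 + z by lra.
have lw : z - z ^+ 2 <= ln (1 + z).
  pose y := (1 + z)^-1 - 1; have ey : (1 + z)^-1 = 1 + y by rewrite /y; ring.
  have yI : 0 < (1 + z)^-1 by rewrite invr_gt0.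
  have : ln ((1 + z)^-1) <= y by rewrite ey; apply: le_ln1Dx; rewrite /y; lra.
  rewrite lnV ?posrE // => h.
  have : z - z ^+ 2 <= - y.
    rewrite /y opprB.
    rewrite -subr_ge0; have -> : 1 - (1 + z)^-1 - (z - z ^+ 2) = z ^+ 3 / (1 + z).
      by field; rewrite lt0r_neq0.
    by rewrite divr_ge0 ?exprn_ge0 // ltW.
  by rewrite -[y]opprK; lra.
have z2 : z ^+ 2 <= e ^+ 2 / b0 ^+ 2.
  rewrite /z expr_div_n ler_wpM2l ?sqr_ge0 // lef_pV2 ?posrE ?exprn_gt0 //.
  by rewrite ler_pXn2r // nnegrE ltW.
have z20 : 0 <= z ^+ 2 by rewrite sqr_ge0.
rewrite -/z ler_norml; apply/andP; split; lra.
Qed.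

Lemma prim_step c0 c1 c2 b e : b0 <= b -> 0 <= e ->
  `|prim c0 c1 c2 (b + e) - prim c0 c1 c2 b - e * integrand c0 c1 c2 b|
    <= prim_const c1 c2 * e ^+ 2.
Proof.
move=> hb e0; have b_gt0 : 0 < b by apply: lt_le_trans hb.
have be : 0 < b + e by rewrite ltr_wpDr.
have -> : prim c0 c1 c2 (b + e) - prim c0 c1 c2 b - e * integrand c0 c1 c2 b =
   c1 * (ln (b + e) - ln b - e / b) + c2 * (- (e ^+ 2 / (b ^+ 2 * (b + e)))).
  by rewrite /prim /integrand; field; rewrite !lt0r_neq0.
apply: le_trans (ler_normD _ _) _; rewrite !normrM /prim_const mulrDl.
apply: lerD.
  by rewrite [leRHS]mulrAC -[leRHS]mulrA ler_wpM2l // ln_step.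
rewrite [leRHS]mulrAC -[leRHS]mulrA ler_wpM2l // normrN ger0_norm; last first.
  by rewrite divr_ge0 ?mulr_ge0 ?sqr_ge0 // ltW.
rewrite ler_wpM2l ?sqr_ge0 // lef_pV2 ?posrE ?mulr_gt0 ?exprn_gt0 //.
rewrite [b0 ^+ 3]exprSr; apply: ler_pM; rewrite ?sqr_ge0 ?(ltW b0_gt0) //.
  by rewrite ler_pXn2r // nnegrE ltW.
by rewrite ler_wpDr.
Qed.

Lemma integrand_bound c0 c1 c2 b : b0 <= b ->
  `|integrand c0 c1 c2 b| <= `|c0| + `|c1| / b0 + `|c2| / b0 ^+ 2.
Proof.
move=> hb; have b_gt0 : 0 < b by apply: lt_le_trans hb.
apply: le_trans (ler_normD _ _) _; apply: lerD.
  apply: le_trans (ler_normD _ _) _; rewrite lerD2l normrM ler_wpM2l //.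
  by rewrite normfV gtr0_norm // lef_pV2 // posrE.
rewrite normrM ler_wpM2l // normfV gtr0_norm ?exprn_gt0 // lef_pV2 ?posrE ?exprn_gt0 //.
by rewrite ler_pXn2r // nnegrE ltW.
Qed.

Lemma nat_ceil (z : R) : 0 <= z -> exists n : nat, z <= n%:R < z + 1.
Proof.
move=> z0; have /andP[h1 h2] := truncn_itv z0; rewrite -natr1 in h2.
have [h|h] := leP z (Num.truncn z)%:R.
  by exists (Num.truncn z); rewrite h /=; lra.
by exists (Num.truncn z).+1; rewrite -natr1; apply/andP; split; lra.
Qed.

(** The sum telescopes against [prim], with an error [O(1 / J ^ 2)] per term and
    [O(1 / J)] at each end. *)
Lemma riemann_sum c0 c1 c2 lo hi : b0 < lo -> hi <= 1 ->
  negl (fun J => \sum_(row0 b0 J <= y < J)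
      J%:R * ((lo <= y%:R / J%:R < hi)%R%:R * integrand c0 c1 c2 (y%:R / J%:R))
    - J%:R ^+ 2 * piece c0 c1 c2 lo hi).
Proof.
move=> blo hi1; set F := integrand c0 c1 c2.
pose C1 := prim_const c1 c2; have C10 : 0 <= C1 := prim_const_ge0 c1 c2.
pose C2 := `|c0| + `|c1| / b0 + `|c2| / b0 ^+ 2.
have lo0 : 0 < lo by apply: lt_trans blo.
have [hl|lh] := leP hi lo.
  apply: negl_eq negl0; near=> J.
  rewrite /piece max_l // subrr mulr0 subr0 big1 // => y _.
  have -> : (lo <= y%:R / J%:R < hi) = false.
    by apply/negP => /andP[h1 h2]; lra.
  by rewrite mul0r mulr0.
apply: (@negl_linear _ _ (C1 + 2 * (C1 + C2))); near=> J.
have J0R : 0 < J%:R :> R by near: J; exact: nbhs_infty_gtr.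
have J0 : (0 < J)%N by rewrite -(ltr_nat R).
have J1 : 1 <= J%:R :> R by rewrite ler1n.
have Ji : 0 < J%:R^-1 :> R by rewrite invr_gt0.
have [|n1 /andP[n1l n1u]] := @nat_ceil (lo * J%:R); first by rewrite mulr_ge0 // ltW.
have [|n2 /andP[n2l n2u]] := @nat_ceil (hi * J%:R).
  by rewrite mulr_ge0 // ltW // (lt_trans lo0).
have geceil (z : R) (n y : nat) : z * J%:R <= n%:R < z * J%:R + 1 ->
    (z <= y%:R / J%:R) = (n <= y)%N.
  move=> /andP[h1 h2]; rewrite ler_pdivlMr //; apply/idP/idP => h.
    by rewrite -ltnS -(ltr_nat R) -natr1; lra.
  by apply: le_trans h1 _; rewrite ler_nat.
have n12 : (n1 <= n2)%N.
  rewrite -ltnS -(ltr_nat R) -natr1; have : lo * J%:R < hi * J%:R by rewrite ltr_pM2r.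
  lra.
have n2J : (n2 <= J)%N.
  have : hi * J%:R <= J%:R by rewrite ler_piMl // ltW.
  by move=> h; rewrite -ltnS -(ltr_nat R) -natr1; lra.
have n1Y : (row0 b0 J <= n1)%N.
  rewrite /row0 -(ltr_nat R); apply: le_lt_trans (_ : _ <= b0 * J%:R) _.
    by rewrite truncn_le mulr_ge0 // ltW.
  by apply: lt_le_trans n1l; rewrite ltr_pM2r.
have -> : \sum_(row0 b0 J <= y < J)
    J%:R * ((lo <= y%:R / J%:R < hi)%R%:R * F (y%:R / J%:R))
  = \sum_(n1 <= y < n2) J%:R * F (y%:R / J%:R).
  have ind y : (lo <= y%:R / J%:R < hi) = (n1 <= y < n2)%N.
    by rewrite (geceil _ n1) ?n1l ?n1u // ltNge (geceil _ n2) ?n2l ?n2u // -ltnNge.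
  rewrite (@big_cat_nat _ _ _ n1) //=; last exact: leq_trans n2J.
  rewrite [X in X + _]big_nat big1 ?add0r; last first.
    by move=> y /andP[_ h]; rewrite ind leqNgt h /= mul0r mulr0.
  rewrite (@big_cat_nat _ _ _ n2) //=.
  have -> : \sum_(n2 <= y < J) J%:R * ((lo <= y%:R / J%:R < hi)%R%:R * F (y%:R / J%:R)) = 0.
    rewrite big_nat big1 // => y /andP[h _].
    by rewrite ind [(y < n2)%N]ltnNge h andbF /= mul0r mulr0.
  rewrite addr0.
  by rewrite !big_nat; apply: eq_bigr => y h; rewrite ind h mul1r.
have tele : \sum_(n1 <= y < n2) (prim c0 c1 c2 (y.+1%:R / J%:R) - prim c0 c1 c2 (y%:R / J%:R))
   = prim c0 c1 c2 (n2%:R / J%:R) - prim c0 c1 c2 (n1%:R / J%:R).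
  by rewrite telescope_sumr.
have bn1 y : (n1 <= y)%N -> b0 <= y%:R / J%:R.
  by move=> h; apply: le_trans (ltW blo) _; rewrite (geceil _ n1) ?n1l ?n1u.
have S1 : `|\sum_(n1 <= y < n2) (J%:R * F (y%:R / J%:R) - J%:R ^+ 2 *
     (prim c0 c1 c2 (y.+1%:R / J%:R) - prim c0 c1 c2 (y%:R / J%:R)))| <= J%:R * C1.
  apply: le_trans (ler_norm_sum _ _ _) _.
  apply: le_trans (_ : _ <= n2%:R * C1) _; last by rewrite ler_wpM2r // ler_nat.
  apply: sum_const_le => // y /andP[h1 h2].
  have := @prim_step c0 c1 c2 (y%:R / J%:R) J%:R^-1 (bn1 y h1) (ltW Ji).
  have -> : y%:R / J%:R + J%:R^-1 = y.+1%:R / J%:R :> R by rewrite -natr1 mulrDl mul1r.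
  rewrite -/F -/C1; set p := (prim _ _ _ _ - prim _ _ _ _) => h.
  have -> : J%:R * F (y%:R / J%:R) - J%:R ^+ 2 * p
     = - (J%:R ^+ 2 * (p - J%:R^-1 * F (y%:R / J%:R))) by field; rewrite lt0r_neq0.
  rewrite normrN normrM ger0_norm ?sqr_ge0 //.
  apply: le_trans (ler_wpM2l _ h) _; first exact: sqr_ge0.
  by rewrite exprVn mulrCA mulfV ?mulr1 // expf_neq0 // lt0r_neq0.
have end_close z (n : nat) : b0 <= z -> z * J%:R <= n%:R < z * J%:R + 1 ->
    `|prim c0 c1 c2 (n%:R / J%:R) - prim c0 c1 c2 z| <= (C1 + C2) / J%:R.
  move=> bz /andP[h1 h2]; pose e := n%:R / J%:R - z.
  have e0 : 0 <= e by rewrite subr_ge0 ler_pdivlMr.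
  have e1 : e <= J%:R^-1.
    by rewrite lerBlDr ler_pdivrMr // mulrDl mulVf ?lt0r_neq0 // addrC ltW.
  have := @prim_step c0 c1 c2 z e bz e0; rewrite -/C1 -/F.
  have := integrand_bound c0 c1 c2 bz; rewrite -/C2 -/F.
  have -> : z + e = n%:R / J%:R by rewrite /e; ring.
  set d := prim _ _ _ _ - _ => hF hd.
  have hFe : `|e * F z| <= J%:R^-1 * C2 by rewrite normrM ger0_norm // ler_pM.
  have he2 : C1 * e ^+ 2 <= C1 * J%:R^-1.
    rewrite ler_wpM2l // expr2; apply: le_trans (_ : _ <= e * 1) _; last by rewrite mulr1.
    by rewrite ler_wpM2l // (le_trans e1) // invf_le1.
  have -> : d = (d - e * F z) + e * F z by ring.
  apply: le_trans (ler_normD _ _) _; rewrite [(C1 + C2) * _]mulrDl [C2 / _]mulrC; lra.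
have c1' := end_close lo n1 (ltW blo); rewrite n1l n1u in c1'.
have c2' := end_close hi n2 (ltW (lt_trans blo lh)); rewrite n2l n2u in c2'.
rewrite /piece max_r ?(ltW lh) //.
rewrite sumrB -[X in _ - X]mulr_sumr tele in S1.
have -> : \sum_(n1 <= y < n2) J%:R * F (y%:R / J%:R)
    - J%:R ^+ 2 * (prim c0 c1 c2 hi - prim c0 c1 c2 lo) =
  (\sum_(n1 <= i < n2) J%:R * F (i%:R / J%:R) -
        J%:R ^+ 2 * (prim c0 c1 c2 (n2%:R / J%:R) - prim c0 c1 c2 (n1%:R / J%:R)))
  + J%:R ^+ 2 * (prim c0 c1 c2 (n2%:R / J%:R) - prim c0 c1 c2 hi)
  - J%:R ^+ 2 * (prim c0 c1 c2 (n1%:R / J%:R) - prim c0 c1 c2 lo) by ring.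
have sc x : `|x| <= (C1 + C2) / J%:R -> `|J%:R ^+ 2 * x| <= J%:R * (C1 + C2).
  move=> h; rewrite normrM ger0_norm ?sqr_ge0 //.
  apply: le_trans (ler_wpM2l _ h) _; first exact: sqr_ge0.
  by rewrite le_eqVlt; apply/orP; left; apply/eqP; field; rewrite lt0r_neq0.
apply: le_trans (ler_normB _ _) _.
apply: le_trans (lerD (ler_normD _ _) (sc _ (c1' isT))) _.
apply: le_trans (lerD (lerD S1 (sc _ (c2' isT))) (lexx _)) _.
by lra.
Unshelve. all: by end_near. Qed.

End Riemann.

(** * Number of points per arc *)

Section MainTerm.
Context {R : realType}.
Variables (t mu : R).
Hypotheses (t_gt0 : 0 < t) (mu_gt0 : 0 < mu).
Implicit Types (J m y n A B : nat) (ka r : R).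

Let b0 := mu / 2.
Let b0_gt0 : 0 < b0. Proof. by rewrite divr_gt0. Qed.

(** The shape of [pos (1 / q - mu / b)] as a function of the height [b]. *)
Definition ramp ka r0 r1 (b : R) : R := if ka <= b then r0 + r1 / b else 0.

(** The integral over [0, 1] of [tent n * ramp ka r0 r1]. *)
Definition tent_piece n ka r0 r1 : R :=
  piece (2 * r0) (2 * r1 - n%:R * t * r0) (- (n%:R * t * r1))
    (Num.max (n%:R * t / 2) ka) (Num.min (n.+1%:R * t / 2) 1)
  + piece (- (2 * r0)) (n.+2%:R * t * r0 - 2 * r1) (n.+2%:R * t * r1)
    (Num.max (n.+1%:R * t / 2) ka) (Num.min (n.+2%:R * t / 2) 1).

(** Above the cut [ka] both factors are affine in [1 / b], so between the kinks of
    [tent], at [n * t / 2], [(n + 1) * t / 2] and [(n + 2) * t / 2], the product is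
    an [integrand]. *)
Lemma tent_split n ka r0 r1 b : 0 < b < 1 ->
  tent t n b * ramp ka r0 r1 b =
  (Num.max (n%:R * t / 2) ka <= b < Num.min (n.+1%:R * t / 2) 1)%R%:R *
     integrand (2 * r0) (2 * r1 - n%:R * t * r0) (- (n%:R * t * r1)) b
  + (Num.max (n.+1%:R * t / 2) ka <= b < Num.min (n.+2%:R * t / 2) 1)%R%:R *
     integrand (- (2 * r0)) (n.+2%:R * t * r0 - 2 * r1) (n.+2%:R * t * r1) b.
Proof.
move=> /andP[b_gt0 b1]; rewrite !ge_max !lt_min b1 !andbT /ramp.
have cond (x : R) : (x * t / 2 <= b) = (x * (t / b) <= 2).
  by rewrite mulrA !ler_pdivrMr // [b * 2]mulrC.
rewrite ![b < _]ltNge !cond /tent /integrand -!mulrA.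
have -> : forall x y z : R, x + y / b + z / b ^+ 2 = x + y / b + z / b / b.
  by move=> x y z; field; rewrite lt0r_neq0.
have s0 : 0 < t / b by rewrite divr_gt0.
have e1 : n.+1%:R * (t / b) = n%:R * (t / b) + t / b by rewrite -natr1; ring.
have e2 : n.+2%:R * (t / b) = n%:R * (t / b) + 2 * (t / b).
  by rewrite -[n.+2%:R]natr1 -natr1; ring.
have e3 : n.+2%:R = n%:R + 2 :> R by rewrite -[n.+2%:R]natr1 -natr1; ring.
rewrite e1 e2; case: (ka <= b); rewrite ?andbF ?andbT /=; last first.
  by rewrite !mul0r mulr0 addr0.
set s := t / b in s0 e1 e2 *.
have [c0|c0] := leP (n%:R * s) 2; have [c1|c1] := leP (n%:R * s + s) 2;
have [c2|c2] := leP (n%:R * s + 2 * s) 2 => /=; try lra.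
- rewrite !mul0r addr0 (_ : Num.max _ _ = 0) ?mul0r //.
  by rewrite min_r ?max_l //; lra.
- rewrite min_r ?max_r ?mul0r ?mul1r ?add0r; [|lra|lra].
  by rewrite e3 /s; field; rewrite lt0r_neq0.
- rewrite min_l ?max_r ?mul0r ?mul1r ?addr0; [|lra|lra].
  by rewrite /s; field; rewrite lt0r_neq0.
- rewrite !mul0r addr0 (_ : Num.max _ _ = 0) ?mul0r //.
  by rewrite min_l ?max_l //; lra.
Qed.

Lemma tent_sum n ka r0 r1 : b0 < ka ->
  negl (fun J => \sum_(row0 b0 J <= y < J)
      J%:R * (tent t n (y%:R / J%:R) * ramp ka r0 r1 (y%:R / J%:R))
    - J%:R ^+ 2 * tent_piece n ka r0 r1).
Proof.
move=> bka.
have lo (x : R) : b0 < Num.max x ka by rewrite lt_max bka orbT.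
have hi (x : R) : Num.min x 1 <= 1 by rewrite ge_min lexx orbT.
have H := negl_add
  (riemann_sum b0_gt0 (2 * r0) (2 * r1 - n%:R * t * r0) (- (n%:R * t * r1))
     (lo (n%:R * t / 2)) (hi (n.+1%:R * t / 2)))
  (riemann_sum b0_gt0 (- (2 * r0)) (n.+2%:R * t * r0 - 2 * r1) (n.+2%:R * t * r1)
     (lo (n.+1%:R * t / 2)) (hi (n.+2%:R * t / 2))).
apply: negl_eq H; near=> J.
have J0R : 0 < J%:R :> R by near: J; exact: nbhs_infty_gtr.
rewrite addrACA -big_split /= -opprD -mulrDr -/(tent_piece n ka r0 r1).
congr (_ - _); rewrite !big_nat; apply: eq_bigr => y /andP[y1 y2].
rewrite -mulrDr -tent_split //.
have y0 : 0 < y%:R :> R by rewrite ltr0n; exact: leq_trans y1.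
by rewrite divr_gt0 //= ltr_pdivrMr // mul1r ltr_nat.
Unshelve. all: by end_near. Qed.

Lemma ramp_bound ka r0 r1 b : b0 < b -> `|ramp ka r0 r1 b| <= `|r0| + `|r1| / b0.
Proof.
move=> hb; have b_gt0 : 0 < b by apply: lt_trans hb.
rewrite /ramp; case: ifP => _; last by rewrite normr0 addr_ge0 // divr_ge0 // ltW.
apply: le_trans (ler_normD _ _) _; rewrite lerD2l normrM ler_wpM2l // normfV.
by rewrite gtr0_norm // lef_pV2 ?posrE // ltW.
Qed.

Lemma active_sum A B ka r0 r1 : b0 < ka ->
  negl (fun J => \sum_(0 <= m < (2 * J).+1) \sum_(row0 b0 J <= y < J)
      (active t A B J m y)%:R * ramp ka r0 r1 (y%:R / J%:R)
    - J%:R ^+ 2 * tent_piece (A + B) ka r0 r1).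
Proof.
move=> bka; set C := `|r0| + `|r1| / b0.
have C0 : 0 <= C by rewrite addr_ge0 // divr_ge0 // ltW.
have E : negl (fun J => \sum_(row0 b0 J <= y < J)
    (\sum_(0 <= m < (2 * J).+1) (active t A B J m y)%:R
      - J%:R * tent t (A + B) (y%:R / J%:R)) * ramp ka r0 r1 (y%:R / J%:R)).
  apply: (@negl_linear _ _ (2 * C)); near=> J.
  have J0R : 0 < J%:R :> R by near: J; exact: nbhs_infty_gtr.
  have J0 : (0 < J)%N by rewrite -(ltr_nat R).
  apply: le_trans (ler_norm_sum _ _ _) _; rewrite mulrC.
  apply: sum_const_le; first by rewrite mulr_ge0.
  move=> y /andP[y1 y2]; rewrite normrM; apply: ler_pM => //.
    by apply: count_active => //; exact: leq_trans y1.
  by apply: ramp_bound; rewrite ltr_pdivlMr //; exact: row0_gt.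
apply: negl_eq (negl_add E (tent_sum (A + B) r0 r1 bka)); near=> J.
rewrite addrA -big_split /= exchange_big /=; congr (_ - _).
apply: eq_bigr => y _; rewrite mulrBl -mulr_suml; ring.
Unshelve. all: by end_near. Qed.

(** Density of the points that have [A] active rows below and [B] above and for
    which [frac (X / y)] lies in the part of the arc where the successor is
    further than the threshold; the two ramps are those of [arc_len]. *)
Definition arc_value A B (a : (nat * nat) * (nat * nat)) : R :=
  if (A + B == 0)%N then tent_piece 0 mu 1 0
  else ramp_r A B a * tent_piece (A + B) (a.2.2%:R * mu) a.2.2%:R^-1 (- mu)
     + ramp_l A B a * tent_piece (A + B) (a.1.2%:R * mu) a.1.2%:R^-1 (- mu).

(** The distance threshold in row [y], in units of [frac (X / y)]. *)
Definition cutoff J y : R := mu * J%:R / y%:R.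

Definition in_window A B a J m y : bool :=
  (arc_lo A B a (cutoff J y) <= frac (absc t J m / y%:R)) &&
  (frac (absc t J m / y%:R) < arc_hi A B a (cutoff J y)).

Lemma cutoff_lip J y l : (row0 b0 J <= y)%N ->
  `|cutoff J (y + l) - cutoff J y| <= mu / b0 ^+ 2 * l%:R / J%:R.
Proof.
move=> hy; have y1 := row0_gt hy.
have [J0|J0] := posnP J.
  by rewrite /cutoff J0 mulr0 !mul0r subrr normr0 invr0 mulr0.
have J0R : 0 < J%:R :> R by rewrite ltr0n.
have bJ : 0 < b0 * J%:R by rewrite mulr_gt0.
have y0 : 0 < y%:R :> R by apply: lt_trans y1.
have l0 : 0 <= l%:R :> R by [].
have yl : 0 < y%:R + l%:R :> R by rewrite ltr_wpDr.
rewrite /cutoff natrD distrC.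
have -> : mu * J%:R / y%:R - mu * J%:R / (y%:R + l%:R) =
  mu * J%:R * l%:R / (y%:R * (y%:R + l%:R)) by field; rewrite !lt0r_neq0.
rewrite ger0_norm; last by rewrite divr_ge0 ?mulr_ge0 // ltW.
have -> : mu / b0 ^+ 2 * l%:R / J%:R = mu * J%:R * l%:R / ((b0 * J%:R) * (b0 * J%:R)).
  by field; rewrite !lt0r_neq0.
rewrite ler_wpM2l ?mulr_ge0 ?(ltW mu_gt0) // lef_pV2 ?posrE ?mulr_gt0 //.
by apply: ler_pM; rewrite ?(ltW bJ) ?(ltW y1) // ler_wpDr // ltW.
Qed.

Lemma pos_ramp (q : nat) (b : R) : (0 < q)%N -> 0 < b ->
  pos (q%:R^-1 - mu / b) = ramp (q%:R * mu) q%:R^-1 (- mu) b.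
Proof.
move=> q0 b_gt0; have q0R : 0 < q%:R :> R by rewrite ltr0n.
have c : (q%:R * mu <= b) = (0 <= q%:R^-1 - mu / b).
  by rewrite subr_ge0 ler_pdivrMr // ler_pdivlMl.
rewrite /ramp /pos c mulNr; case: leP => h; rewrite ?max_l ?max_r //.
Qed.

Lemma arc_in01 n (a : (nat * nat) * (nat * nat)) : a \in farey n ->
  (0 : R) <= ratio a.1 /\ (ratio a.2 : R) <= 1.
Proof.
move=> ha; split; first by rewrite /ratio divr_ge0.
elim: n a ha => [|n IH] a; first by rewrite inE => /eqP-> /=; rewrite /ratio divr1.
move=> /flattenP[s /mapP[b hb ->]]; rewrite /split_arc.
case: eqP => _; rewrite !inE; last by move/eqP->; exact: IH.
case/orP => /eqP-> /=; last exact: IH.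
have := fareyP hb => /and4P[/andP[q1 _] /andP[q2 _] _ /eqP det].
apply: le_trans (IH b hb); rewrite /ratio /=.
rewrite ler_pdivrMr ?ltr0n ?addn_gt0 ?q1 // mulrAC ler_pdivlMr ?ltr0n //.
rewrite -!natrM ler_nat; nia.
Qed.

(** The window length is the expected value of its indicator; the deviation is a
    difference of two sawtooth sums, negligible by equidistribution. *)
Lemma arc_sum A B a : a \in farey (A + B) ->
  negl (fun J => \sum_(0 <= m < (2 * J).+1) \sum_(row0 b0 J <= y < J)
      (active t A B J m y)%:R * (in_window A B a J m y)%:R
    - J%:R ^+ 2 * arc_value A B a).
Proof.
move=> ha; have arc := fareyP ha; have lt12 := ltW (@ratio_lt R _ _ arc).
have [r1 r2] := arc_in01 ha.
pose al : R := (slope A B a)%:~R; pose ga : R := (icept A B a)%:~R.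
have windE J m y : (in_window A B a J m y)%:R =
   (arc_hi A B a (cutoff J y) - arc_lo A B a (cutoff J y))
   + (frac (absc t J m / y%:R - arc_hi A B a (cutoff J y))
      - frac (absc t J m / y%:R - arc_lo A B a (cutoff J y))).
  have [h1 h2 h3] := win_itv al ga (cutoff J y) lt12.
  rewrite -frac_itv_indic; [|exact: le_trans h1|exact: h2|exact: le_trans r2].
  by rewrite addrC subrK.
have cut0 J y : 0 <= cutoff J y by rewrite /cutoff divr_ge0 ?mulr_ge0 // ltW.
have cutE J y : (0 < J)%N -> (0 < y)%N -> cutoff J y = mu / (y%:R / J%:R).
  by move=> J0 y0; rewrite /cutoff; field; rewrite !pnatr_eq0 -!lt0n J0 y0.
have bmu : b0 < mu by rewrite /b0 gtr_pMr // invf_lt1 // ltr1n.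
have [n0|n0] := posnP (A + B).
  have [A0 B0] : A = 0%N /\ B = 0%N by lia.
  subst A B; rewrite /arc_value /=; move: ha; rewrite inE => /eqP ea; subst a.
  apply: negl_eq (active_sum 0 0 1 0 bmu).
  near=> J; congr (_ - _); have J0 : (0 < J)%N by near: J; exists 1%N.
  apply: eq_bigr => m _; rewrite !big_nat; apply: eq_bigr => y /andP[y1 _].
  have y0 : (0 < y)%N by apply: leq_trans y1.
  have yJ : 0 < y%:R / J%:R :> R by rewrite divr_gt0 ?ltr0n.
  congr (_ * _); rewrite windE /ramp mul0r addr0 cutE //.
  have lo0 : arc_lo 0 0 ((0, 1), (1, 1))%N (mu / (y%:R / J%:R)) = 0 :> R.
    by rewrite /arc_lo /win_lo /slope /= subrr ltxx /ratio /= mul0r.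
  have := arc_len0 (mu / (y%:R / J%:R)); rewrite lo0 subr0 => ->.
  rewrite ler_pdivrMr // mul1r.
  rewrite subr0; case: leP => _ /=; last by rewrite subr0 subrr addr0.
  rewrite (@frac_unique _ (_ - 1) (Num.floor (absc t J m / y%:R) - 1)
     (frac (absc t J m / y%:R))) ?frac_itv ?subrr ?addr0 //.
  by rewrite rmorphB /= {1}[absc t J m / y%:R]fracE; ring.
have a1 : 1 <= `|al|.
  have := slope_neq0 arc n0; rewrite /al -intr_norm => s0.
  by rewrite -[1](_ : 1%:~R = _) // ler_int; lia.
have lipW J y l : (row0 b0 J <= y)%N ->
   `|arc_hi A B a (cutoff J (y + l)) - arc_hi A B a (cutoff J y)|
      <= mu / b0 ^+ 2 * l%:R / J%:R /\
   `|arc_lo A B a (cutoff J (y + l)) - arc_lo A B a (cutoff J y)|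
      <= mu / b0 ^+ 2 * l%:R / J%:R.
  move=> hy; have [l1 l2] := win_lip ga (cutoff J (y + l)) (cutoff J y) lt12 a1.
  by split; [apply: le_trans l2 _|apply: le_trans l1 _]; exact: cutoff_lip.
have C0 : 0 <= mu / b0 ^+ 2 by rewrite divr_ge0 ?sqr_ge0 // ltW.
have Ehi := equidistribution t_gt0 b0_gt0 A B C0 (fun J y l h => (lipW J y l h).1).
have Elo := equidistribution t_gt0 b0_gt0 A B C0 (fun J y l h => (lipW J y l h).2).
have bka (q : nat) : (0 < q)%N -> b0 < q%:R * mu.
  move=> q0; apply: lt_le_trans bmu _.
  by rewrite ler_peMl ?ler1n // ltW.
have /and4P[/andP[q1 _] /andP[q2 _] _ _] := arc.
have M1 := negl_scale (ramp_r A B a) (active_sum A B a.2.2%:R^-1 (- mu) (bka _ q2)).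
have M2 := negl_scale (ramp_l A B a) (active_sum A B a.1.2%:R^-1 (- mu) (bka _ q1)).
apply: negl_eq (negl_add (negl_add M1 M2) (negl_add Ehi (negl_opp Elo))).
near=> J; have J0 : (0 < J)%N by near: J; exists 1%N.
rewrite /arc_value gtn_eqF //.
transitivity (\sum_(0 <= m < (2 * J).+1) \sum_(row0 b0 J <= y < J)
   (ramp_r A B a * ((active t A B J m y)%:R
       * ramp (a.2.2%:R * mu) a.2.2%:R^-1 (- mu) (y%:R / J%:R))
   + ramp_l A B a * ((active t A B J m y)%:R
       * ramp (a.1.2%:R * mu) a.1.2%:R^-1 (- mu) (y%:R / J%:R))
   + (active t A B J m y)%:R * (frac (absc t J m / y%:R - arc_hi A B a (cutoff J y)) - 2^-1)
   - (active t A B J m y)%:R * (frac (absc t J m / y%:R - arc_lo A B a (cutoff J y)) - 2^-1))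
   - J%:R ^+ 2 * (ramp_r A B a * tent_piece (A + B) (a.2.2%:R * mu) a.2.2%:R^-1 (- mu)
     + ramp_l A B a * tent_piece (A + B) (a.1.2%:R * mu) a.1.2%:R^-1 (- mu))).
  have split4 (F1 F2 F3 F4 : nat -> nat -> R) :
    \sum_(0 <= m < (2 * J).+1) \sum_(row0 b0 J <= y < J)
      (ramp_r A B a * F1 m y + ramp_l A B a * F2 m y + F3 m y - F4 m y) =
    ramp_r A B a * (\sum_(0 <= m < (2 * J).+1) \sum_(row0 b0 J <= y < J) F1 m y)
    + ramp_l A B a * (\sum_(0 <= m < (2 * J).+1) \sum_(row0 b0 J <= y < J) F2 m y)
    + \sum_(0 <= m < (2 * J).+1) \sum_(row0 b0 J <= y < J) F3 m y
    - \sum_(0 <= m < (2 * J).+1) \sum_(row0 b0 J <= y < J) F4 m y.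
    rewrite !mulr_sumr -!big_split -sumrB /=; apply: eq_bigr => m _.
    by rewrite !mulr_sumr -!big_split -sumrB.
  by rewrite split4; ring.
congr (_ - _); apply: eq_bigr => m _; rewrite !big_nat; apply: eq_bigr => y /andP[y1 _].
have y0 : (0 < y)%N by apply: leq_trans y1.
have yJ : 0 < y%:R / J%:R :> R by rewrite divr_gt0 ?ltr0n.
rewrite windE arc_len // cutE // !pos_ramp //; ring.
Unshelve. all: by end_near. Qed.

End MainTerm.

(** * Gaps and isolated points *)

Lemma sub_in_count (T : eqType) (a b : pred T) (s : seq T) :
  (forall x, x \in s -> a x -> b x) -> (count a s <= count b s)%N.
Proof.
elim: s => //= x s IH h; apply: leq_add.
  by case: (a x) (h x (mem_head _ _)) => // ->.
by apply: IH => y ys; apply: h; rewrite inE ys orbT.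
Qed.

Section Gaps.
Context {R : realType} {T : eqType}.
Variables (pts : seq T) (f : T -> R) (c : R).
Hypothesis uniq_pts : uniq pts.

Definition isolated (p : T) : bool :=
  all (fun p' => ~~ (f p < f p' < f p + c)) pts.
Definition alone (p : T) : bool :=
  all (fun p' => (f p' == f p) ==> (p' == p)) pts.

Let s := sort <=%R [seq f p | p <- pts].
(* The list is indexed from 0: gap number [j] runs from item [j.-1] to item [j]. *)
Let gaps := count (fun j => c <= nth 0 s j - nth 0 s j.-1) (iota 1 (size pts).-1).

(** A gap of length at least [c] starts at an isolated point, and an isolated
    point with no other point at the same place starts a gap unless it is last. *)
Lemma gaps_isolated :
  (gaps <= count isolated pts)%N /\
  (count (fun p => isolated p && alone p) pts <= gaps.+1)%N.
Proof.
case E : pts uniq_pts => [|p0 pts'] Upts; first by rewrite /gaps E.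
rewrite -E; pose ps := sort (relpre f <=%R) pts.
have ps_pts : perm_eq ps pts by rewrite perm_sort.
have sps : size ps = size pts by rewrite size_sort.
have Ups : uniq ps by rewrite sort_uniq E.
have mps p : (p \in ps) = (p \in pts) by rewrite mem_sort.
have sE : s = map f ps by rewrite /s sort_map.
pose N := (size pts).-1; have NE : size ps = N.+1 by rewrite sps /N E.
have nthE i : (i < N.+1)%N -> nth 0 s i = f (nth p0 ps i).
  by move=> h; rewrite sE (nth_map p0) // NE.
have mono i j : (i <= j)%N -> (j < N.+1)%N -> f (nth p0 ps i) <= f (nth p0 ps j).
  move=> ij jN; rewrite -!nthE //; last exact: leq_ltn_trans jN.
  have ss : sorted <=%R s by apply: sort_sorted; exact: le_total.
  apply: (sorted_leq_nth le_trans le_refl 0 ss) => //.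
    by rewrite inE size_sort size_map -sps NE (leq_ltn_trans ij).
  by rewrite inE size_sort size_map -sps NE.
have allE (P : pred T) : all P pts = all P ps.
  by apply/idP/idP => /allP h; apply/allP => p; [rewrite mps|rewrite -mps]; exact: h.
have cntE (P : pred T) : count P pts = (count (fun i => P (nth p0 ps i)) (iota 0 N) +
    P (nth p0 ps N))%N.
  rewrite -(permP ps_pts) -{1}(mkseq_nth p0 ps) NE /mkseq count_map -addn1 iotaD.
  by rewrite count_cat /= add0n addn0.
have gE : gaps = count (fun i => c <= f (nth p0 ps i.+1) - f (nth p0 ps i)) (iota 0 N).
  rewrite /gaps -/N -[1%N]/(1 + 0)%N iotaDl count_map; apply: eq_in_count => i.
  rewrite mem_iota /= add0n add1n => iN; rewrite !nthE //; exact: ltnW.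
split.
  rewrite cntE gE; apply: leq_trans (leq_addr _ _).
  apply: sub_in_count => i; rewrite mem_iota add0n => /= iN gap.
  rewrite /isolated allE; apply/(all_nthP p0) => j; rewrite NE => jN.
  rewrite negb_and -!leNgt; have [ji|ij] := leqP j i.
    by rewrite (mono j i) // ltnW.
  by rewrite -lerBrDl (le_trans gap) ?orbT // lerB // mono.
rewrite cntE gE -addn1; apply: leq_add; last by case: (_ && _).
apply: sub_in_count => i; rewrite mem_iota add0n => /= iN /andP[].
rewrite /isolated /alone !allE => /allP iso /allP al.
have Sin : nth p0 ps i.+1 \in ps by rewrite mem_nth // NE.
have lt : f (nth p0 ps i) < f (nth p0 ps i.+1).
  rewrite lt_neqAle mono // andbT; apply/negP => /eqP e.
  have := al _ Sin; rewrite -e eqxx /= nth_uniq ?NE //; last exact: ltnW.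
  by rewrite eqn_leq ltnn.
by have := iso _ Sin; rewrite lt /= -leNgt -lerBrDl.
Qed.

End Gaps.

(** * Angles as arctangents *)

Section Angles.
Context {R : realType}.

(** The cosine of the angle at the viewpoint is adjacent side over hypotenuse. *)
Lemma acos_atan (x y : R) : 0 < x -> 0 <= y ->
  acos (x / Num.sqrt (x ^+ 2 + y ^+ 2)) = atan (y / x).
Proof.
move=> x0 y0; have z0 : 0 <= y / x by rewrite divr_ge0 // ltW.
have -> : x / Num.sqrt (x ^+ 2 + y ^+ 2) = cos (atan (y / x)).
  rewrite cos_atan.
  have -> : x ^+ 2 + y ^+ 2 = x ^+ 2 * (1 + (y / x) ^+ 2).
    by field; rewrite lt0r_neq0.
  rewrite sqrtrM ?sqr_ge0 // sqrtr_sqr gtr0_norm // invfM mulrA mulfV ?mul1r //.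
  by rewrite lt0r_neq0.
rewrite cosK // in_itv /=; apply/andP; split.
  by rewrite -[leLHS](@atan0 R) le_atan.
by apply: le_trans (ltW (atan_ltpi2 _)) _; rewrite ler_pdivrMr // ler_peMr ?pi_ge0 // ler1n.
Qed.

Lemma atan_sub_bounds (u v m : R) : 0 <= u -> u < v -> v <= m ->
  (v - u) / (1 + m ^+ 2) <= atan v - atan u <= v - u.
Proof.
move=> u0 uv vm.
have H1 (x : R) : x \in `]u, v[ -> is_derive x 1 atan ((1 + x ^+ 2)^-1).
  by move=> _; exact: is_derive1_atan.
have H2 : {within `[u, v], continuous (@atan R)}.
  by apply: continuous_subspaceT => x; exact: continuous_atan.
have [x] := MVT uv H1 H2.
rewrite in_itv /= => /andP[ux xv] ->.
have d0 : 0 <= v - u by rewrite subr_ge0 ltW.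
have x0 : 0 <= x ^+ 2 by rewrite sqr_ge0.
have x1 : 1 <= 1 + x ^+ 2 by rewrite lerDl.
have xm : x ^+ 2 <= m ^+ 2.
  by rewrite ler_pXn2r ?nnegrE //; lra.
rewrite [(v - u) / _]mulrC; apply/andP; split.
  by rewrite ler_wpM2r // lef_pV2 ?posrE; lra.
by rewrite ler_piMl // invf_le1; lra.
Qed.

Lemma lt_atan (u v : R) : 0 <= u -> u < v -> atan u < atan v.
Proof.
move=> u0 uv; have /andP[h _] := atan_sub_bounds u0 uv (lexx v).
rewrite -subr_gt0; apply: lt_le_trans h.
by rewrite divr_gt0 ?subr_gt0 // ltr_wpDr ?sqr_ge0.
Qed.

End Angles.

(** * Which grid points are isolated *)

Section Tolerance.
Context {R : realType}.
Variable e : R.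
Hypotheses (e_ge0 : 0 <= e) (e_small : e <= 24^-1).

Lemma shrink_bound : 1 - 5 * e <= (1 - 3 * e) * (1 - e) ^+ 2.
Proof.
have es := e_small; have e0 := e_ge0; have ee := mulr_ge0 e0 e0.
have h4 : 1 - 2 * e <= (1 - e) ^+ 2 by rewrite !expr2; lra.
have h3 : 0 <= 1 - 3 * e by lra.
have := ler_wpM2l h3 h4; lra.
Qed.

Lemma grow_bound : (1 + e) ^+ 3 * (1 + 3 * e) <= 1 + 12 * e.
Proof.
have e0 := e_ge0; have e2 := mulr_ge0 e0 e0.
have s1 : e * e <= 24^-1 * e by rewrite ler_wpM2r.
have s2 : (e * e) * e <= 24^-1 * (e * e) by rewrite mulrC ler_wpM2r.
have s3 : (e * e) * (e * e) <= 24^-1 * (e * e * e).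
  have -> : e * e * (e * e) = e * (e * e * e) by ring.
  by rewrite ler_wpM2r // mulr_ge0.
have -> : (1 + e) ^+ 3 * (1 + 3 * e) =
  1 + 6 * e + 12 * (e * e) + 10 * (e * e * e) + 3 * (e * e * (e * e)) by ring.
lra.
Qed.

End Tolerance.

Section Geometry.
Context {R : realType}.
Variables (t lam : R) (h J : nat) (e c : R).
Hypotheses (t_gt0 : 0 < t) (lam_gt0 : 0 < lam) (ht : 2 <= h.+1%:R * t).

(* For a point of row [y], a difference of [lam] average gaps in angle amounts to
   [k * w - p = mu * J / y]. Below height [b0 * J], consecutive points of a row
   already differ by at most about half of that. *)
Let mu := lam * t / 2.
Let b0 := mu / 2.
Let T := t * J%:R ^+ 2.
Let G := lam / (2 * t * J%:R ^+ 3).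
(* Replacing [X] by [T] costs [e] for each of the at most [h] active rows, and
   comparing thresholds costs a factor [1 + 12 * e] on a quantity at most 2. *)
Let margin := (h + 24)%:R * e.
Let X := @absc R t J.

Hypotheses (e_gt0 : 0 < e) (e_small : e <= 24^-1).
Hypotheses (J_gt0 : (0 < J)%N) (J_large : 1 <= e * t * J%:R).
Hypotheses (hJ : h%:R <= b0 * J%:R).
Hypotheses (c_lo : (1 - 3 * e) * G <= c) (c_hi : c <= (1 + 3 * e) * G).

Definition grid (J : nat) : seq (nat * nat) :=
  [seq (m, y) | m <- iota 0 (2 * J).+1, y <- iota 0 J.+1].

Definition incl (p : nat * nat) : R := atan (p.2%:R / X p.1).

Lemma mem_grid p : (p \in grid J) = (p.1 <= 2 * J)%N && (p.2 <= J)%N.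
Proof.
case: p => m y; apply/allpairsP/idP => [[[m' y'] []]|].
  by rewrite !mem_iota /fst /snd => h1 h2 [-> ->]; move: h1 h2; clear; lia.
rewrite /fst /snd => h1; exists (m, y).
by rewrite /fst /snd !mem_iota; split=> //; move: h1; clear; lia.
Qed.

Let JR : 0 < J%:R :> R. Proof. by rewrite ltr0n. Qed.
Let T_gt0 : 0 < T. Proof. by rewrite mulr_gt0 ?exprn_gt0. Qed.
Let J_eT : J%:R <= e * T.
Proof.
have -> : e * T = e * t * J%:R * J%:R by rewrite /T; ring.
by rewrite ler_peMl // ltW.
Qed.

Let X_lo m : (1 - e) * T <= X m.
Proof. by rewrite /X /absc -/T; have : 0 <= m%:R :> R by []; move: J_eT; lra. Qed.

Let X_hi m : (m <= 2 * J)%N -> X m <= (1 + e) * T.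
Proof.
move=> mJ; rewrite /X /absc -/T.
have : m%:R <= 2 * J%:R :> R by rewrite -natrM ler_nat.
by move: J_eT; lra.
Qed.

Let e1 : 1 - e > 0.
Proof. by move: e_small; lra. Qed.

Let X_gt0 m : 0 < X m.
Proof. by apply: lt_le_trans (X_lo m); rewrite mulr_gt0. Qed.

Let G_gt0 : 0 < G.
Proof. by rewrite divr_gt0 // !mulr_gt0 ?exprn_gt0. Qed.

Lemma incl_diff p p' : (p'.1 <= 2 * J)%N -> (p'.2 <= J)%N ->
  p.2%:R / X p.1 < p'.2%:R / X p'.1 ->
  (p'.2%:R / X p'.1 - p.2%:R / X p.1) / (1 + e) <= incl p' - incl p
    <= p'.2%:R / X p'.1 - p.2%:R / X p.1.
Proof.
move=> m1 y1 lt; have u0 : 0 <= p.2%:R / X p.1 by rewrite divr_ge0 // ltW.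
have um : p'.2%:R / X p'.1 <= 2 * e.
  rewrite ler_pdivrMr //; apply: (@le_trans _ _ (e * T)).
    by apply: le_trans J_eT; rewrite ler_nat.
  have : e * ((1 - e) * T) <= e * X p'.1 by rewrite ler_wpM2l // ltW.
  have eT : 0 <= e * T by rewrite mulr_ge0 // ltW.
  have : 0 <= e * T * (1 - 2 * e) by rewrite mulr_ge0 //; move: e_small e_gt0; lra.
  lra.
have /andP[h1 h2] := atan_sub_bounds u0 lt um.
rewrite /incl h2 andbT; apply: le_trans h1; rewrite ler_wpM2l ?subr_ge0 ?(ltW lt) //.
rewrite lef_pV2 ?posrE; try by rewrite ltr_wpDr ?sqr_ge0 //; move: e_small e_gt0; lra.
have : 0 <= e * (1 - 4 * e) by rewrite mulr_ge0 ?(ltW e_gt0) //; move: e_small e_gt0; lra.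
by rewrite exprMn; lra.
Qed.

Lemma incl_mono p p' : incl p < incl p' -> p.2%:R / X p.1 < p'.2%:R / X p'.1.
Proof. by rewrite ltNge [in X in _ -> X]ltNge; apply: contra => /le_atan. Qed.

(** Low in the window, the next point of the same row is already too close. *)
Lemma low_not_isolated m y : (0 < m <= 2 * J)%N -> (0 < y <= J)%N ->
  y%:R <= b0 * J%:R -> ~~ isolated (grid J) incl c (m, y).
Proof.
move=> /andP[m0 mJ] /andP[y0 yJ] yb; apply/allPn; exists (m.-1, y).
  by rewrite mem_grid /= yJ (leq_trans (leq_pred _)).
have y0R : 0 < y%:R :> R by rewrite ltr0n.
have XE : X m = X m.-1 + 1.
  by rewrite /X /absc -{1}(prednK m0) -natr1; ring.
have dE : y%:R / X m.-1 - y%:R / X m = y%:R / (X m * X m.-1).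
  have := X_gt0 m; have := X_gt0 m.-1; rewrite XE => ? ?.
  by field; rewrite !lt0r_neq0.
have d0 : 0 < y%:R / (X m * X m.-1) by rewrite divr_gt0 ?mulr_gt0.
have lt : y%:R / X m < y%:R / X m.-1 by rewrite -subr_gt0 dE.
have mJ' : (m.-1 <= 2 * J)%N by exact: leq_trans (leq_pred _) mJ.
have /andP[h1 h2] := @incl_diff (m, y) (m.-1, y) mJ' yJ lt.
rewrite negbK; move: h1 h2; rewrite /= dE => h1 h2.
apply/andP; split.
  by rewrite -subr_gt0; apply: lt_le_trans h1; rewrite divr_gt0 //; move: e_small e_gt0; lra.
rewrite -ltrBlDl; apply: le_lt_trans h2 _; apply: lt_le_trans c_lo.
apply: (@le_lt_trans _ _ (b0 * J%:R / (((1 - e) * T) * ((1 - e) * T)))).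
  apply: ler_pM => //.
    by rewrite invr_ge0 ltW // mulr_gt0.
  rewrite lef_pV2 ?posrE ?mulr_gt0 //.
  by apply: ler_pM => //; rewrite mulr_ge0 // ltW.
have -> : b0 * J%:R / (((1 - e) * T) * ((1 - e) * T)) = G / (2 * (1 - e) ^+ 2).
  by rewrite /b0 /mu /G /T; field; rewrite !lt0r_neq0.
rewrite ltr_pdivrMr ?mulr_gt0 ?exprn_gt0 //.
have -> : (1 - 3 * e) * G * (2 * (1 - e) ^+ 2) = G * (2 * (1 - 3 * e) * (1 - e) ^+ 2) by ring.
rewrite ltr_pMr // -mulrA; have := shrink_bound (ltW e_gt0) e_small.
by move: e_small; lra.
Qed.

Section Point.
Variables (m y : nat).
Hypotheses (mJ : (m <= 2 * J)%N) (y_lo : (row0 b0 J <= y)%N) (y_hi : (y + h < J)%N).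
Hypothesis no_wall : ~~ near_wall t margin J m y.

Let A := Num.truncn (rows_below t J m y).
Let B := Num.truncn (rows_above t J m y).
Let w := frac (X m / y%:R).
Let M := Num.floor (X m / y%:R).
Let del := cutoff mu J y.

Let y_gt : b0 * J%:R < y%:R. Proof. exact: row0_gt. Qed.
Let y_gt0 : 0 < y%:R :> R.
Proof.
apply: le_lt_trans y_gt; rewrite mulr_ge0 ?(ltW JR) //.
by rewrite /b0 /mu !divr_ge0 ?mulr_ge0 // ltW.
Qed.
Let b0_gt0 : 0 < b0.
Proof. by rewrite /b0 /mu !divr_gt0 ?mulr_gt0. Qed.
Let y_eT : y%:R <= e * T.
Proof. by apply: le_trans J_eT; rewrite ler_nat ltnW // (leq_ltn_trans (leq_addr h y)). Qed.
Let del_gt0 : 0 < del.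
Proof. by rewrite /del /cutoff /mu divr_gt0 ?mulr_gt0 ?invr_gt0. Qed.
Let del_le2 : del <= 2.
Proof.
rewrite /del /cutoff ler_pdivrMr //; have : mu = 2 * b0 by rewrite /b0; field.
by move=> ->; rewrite -mulrA ler_wpM2l // ltW.
Qed.
Let del_T : G * T ^+ 2 / y%:R = del.
Proof. by rewrite /G /T /del /cutoff /mu; field; rewrite !lt0r_neq0. Qed.

Let margin_gt0 : 0 < margin.
Proof. by rewrite mulr_gt0 // ltr0n addn_gt0 orbT. Qed.

Let A_itv : A%:R + margin < rows_below t J m y < A%:R + 1 - margin.
Proof.
move: no_wall; rewrite /near_wall negb_or => /andP[n1 _].
exact: not_near n1 (rows_below_ge0 t_gt0 _ _ _).
Qed.
Let B_itv : B%:R + margin < rows_above t J m y < B%:R + 1 - margin.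
Proof.
move: no_wall; rewrite /near_wall negb_or => /andP[_ n2].
exact: not_near n2 (rows_above_ge0 t_gt0 _ _ _).
Qed.

Let belowE : rows_below t J m y * T = m%:R * y%:R.
Proof. by rewrite /rows_below -/T divfK // lt0r_neq0. Qed.
Let aboveE : rows_above t J m y * T = (2 * J%:R - m%:R) * y%:R.
Proof. by rewrite /rows_above -/T divfK ?lt0r_neq0 // natrB // natrM. Qed.

(** The lengths of the two windows add up to [2 * J * y / T <= 2 / t <= h + 1]. *)
Lemma active_le : (A + B <= h)%N.
Proof.
have : (A + B)%:R < h.+1%:R :> R.
  rewrite natrD; have s : rows_below t J m y + rows_above t J m y <= h.+1%:R.
    rewrite -(ler_pM2r T_gt0) mulrDl belowE aboveE.
    have -> : m%:R * y%:R + (2 * J%:R - m%:R) * y%:R = 2 * (J%:R * y%:R) :> R by ring.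
    have -> : h.+1%:R * T = h.+1%:R * t * (J%:R * J%:R) by rewrite /T; ring.
    rewrite ler_pM ?mulr_ge0 // ler_wpM2l //.
    by rewrite ler_nat ltnW // (leq_ltn_trans (leq_addr h y)).
  by move/andP: A_itv => [a1 _]; move/andP: B_itv => [a2 _]; move: margin_gt0; lra.
by rewrite ltr_nat ltnS.
Qed.

Let AhR : A%:R <= h%:R :> R. Proof. by rewrite ler_nat; exact: leq_trans (leq_addr _ _) active_le. Qed.
Let BhR : B%:R <= h%:R :> R. Proof. by rewrite ler_nat; exact: leq_trans (leq_addl _ _) active_le. Qed.
Let marginE : margin = h%:R * e + 24 * e.
Proof. by rewrite /margin natrD; ring. Qed.

Let XmE : X m = y%:R * (M%:~R + w).
Proof. by rewrite /M /w -fracE mulrC divfK // lt0r_neq0. Qed.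

(** Cross product with a neighbour, in the coordinates [(k, p)] of [k * w - p]. *)
Let cross (k d : int) : k%:~R * X m - d%:~R * y%:R =
  y%:R * (k%:~R * w - (d - k * M)%:~R).
Proof. by rewrite XmE rmorphB rmorphM /=; ring. Qed.

Let XD m' : X m' = X m + (m'%:Z - m%:Z)%:~R.
Proof. by rewrite /X /absc rmorphB /= -!pmulrn; ring. Qed.

(* The difference of two slopes [y / X] is a cross product over [X * X'], and a
   shift of the column by [k * M] replaces [X / y] by its fractional part [w]. *)
Let slope_diff m' y' (k := y'%:Z - y%:Z) (d := m'%:Z - m%:Z) :
  y'%:R / X m' - y%:R / X m = y%:R * (k%:~R * w - (d - k * M)%:~R) / (X m * X m').
Proof.
have yk : y'%:R = y%:R + k%:~R :> R by rewrite /k rmorphB /= -!pmulrn; ring.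
have x1 := X_gt0 m; have x2 := X_gt0 m'.
rewrite -cross yk; have := XD m'; rewrite -/d => E.
have -> : k%:~R * X m - d%:~R * y%:R = (y%:R + k%:~R) * X m - y%:R * X m'.
  by rewrite E; ring.
by field; rewrite !lt0r_neq0.
Qed.

(** A point seen just above [(m, y)] lies in an active row: the other rows would
    need a column outside of the grid. *)
Lemma active_range m' y' (k := y'%:Z - y%:Z) (d := m'%:Z - m%:Z) :
  (m' <= 2 * J)%N -> 0 <= k%:~R * w - (d - k * M)%:~R <= 3 ->
  - A%:Z <= k <= B%:Z.
Proof.
move=> m'J /andP[r0 r3].
have CR := cross k d.
have D0 : 0 <= y%:R * (k%:~R * w - (d - k * M)%:~R) by rewrite mulr_ge0 // ltW.
have D3 : y%:R * (k%:~R * w - (d - k * M)%:~R) <= y%:R * 3 by rewrite ler_wpM2l // ltW.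
rewrite -CR in D0 D3.
have dE : d%:~R = m'%:R - m%:R :> R by rewrite /d rmorphB /= -!pmulrn.
have dhi : d%:~R * y%:R <= rows_above t J m y * T.
  rewrite aboveE ler_wpM2r ?(ltW y_gt0) // dE lerD2r -natrM ler_nat //.
have dlo : - (d%:~R * y%:R) <= rows_below t J m y * T.
  rewrite belowE -mulNr ler_wpM2r ?(ltW y_gt0) // dE opprB gerDl oppr_le0 //.
have eT : 0 <= e * T by rewrite mulr_ge0 // ltW.
move/andP: A_itv => [_ a1]; move/andP: B_itv => [_ b1].
apply/andP; split; rewrite leNgt; apply/negP => hk.
- have k1 : A%:R + 1 <= - k%:~R :> R.
    by rewrite -rmorphN natr1 pmulrn ler_int; move: hk; move: (A) (k); clear; lia.
  have : (A%:R + 1) * ((1 - e) * T) <= - k%:~R * X m.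
    by apply: ler_pM => //; rewrite mulr_ge0 // ltW.
  have : rows_below t J m y * T < (A%:R + 1 - margin) * T by rewrite ltr_pM2r.
  have : A%:R * (e * T) <= h%:R * (e * T) by rewrite ler_wpM2r.
  rewrite marginE; lra.
- have k1 : B%:R + 1 <= k%:~R :> R by rewrite natr1 pmulrn ler_int; move: hk; move: (B) (k); clear; lia.
  have : (B%:R + 1) * ((1 - e) * T) <= k%:~R * X m.
    by apply: ler_pM => //; rewrite mulr_ge0 // ltW.
  have : rows_above t J m y * T < (B%:R + 1 - margin) * T by rewrite ltr_pM2r.
  have : B%:R * (e * T) <= h%:R * (e * T) by rewrite ler_wpM2r.
  move: y_eT; rewrite marginE; lra.
Qed.

Section InArc.
Variable a : (nat * nat) * (nat * nat).
Hypotheses (arc_a : is_arc (A + B) a) (w_in : ratio a.1 < w < ratio a.2).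
Hypothesis off_cut : margin < `|succ_dist A B a w - del|.

(** Two points at the same angle have a vanishing cross product, which
    [no_return] excludes inside an arc. *)
Lemma point_alone : alone (grid J) incl (m, y).
Proof.
apply/allP => -[m' y']; rewrite mem_grid => /= /andP[m'J y'J].
apply/implyP => /eqP eq_incl.
have eqs : y'%:R / X m' = y%:R / X m.
  have u0 k l : 0 <= k%:R / X l by rewrite divr_ge0 // ltW.
  apply/eqP; rewrite eq_le !leNgt; apply/andP; split; apply/negP => /(lt_atan (u0 _ _)).
    by move: eq_incl; rewrite /incl /= => ->; rewrite ltxx.
  by move: eq_incl; rewrite /incl /= => ->; rewrite ltxx.
have r0 : (y'%:Z - y%:Z)%:~R * w - ((m'%:Z - m%:Z) - (y'%:Z - y%:Z) * M)%:~R = 0.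
  have := slope_diff m' y'; rewrite eqs subrr => E.
  have := congr1 (fun z => z * (X m * X m')) E.
  rewrite mul0r divfK; last by rewrite lt0r_neq0 // mulr_gt0.
  by move=> /esym/eqP; rewrite mulf_eq0 gt_eqF //= => /eqP.
have kr := @active_range m' y' m'J; rewrite r0 in kr.
have k0 := no_return arc_a w_in (kr _) r0.
have k0' : y'%:Z - y%:Z = 0 by apply: k0; rewrite lexx /=; lra.
have : (m'%:Z - m%:Z)%:~R = 0 :> R.
  by move: r0; rewrite k0' !mul0r subr0 sub0r => /eqP; rewrite oppr_eq0 => /eqP.
move/eqP; rewrite intr_eq0 => /eqP d0.
by rewrite xpair_eqE; apply/andP; split; move: k0' d0; clear; lia.
Qed.

(** A point seen within the gap would have a positive residue below the
    threshold, against the minimality of [succ_dist]. *)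
Lemma isolated_of_far : del < succ_dist A B a w -> isolated (grid J) incl c (m, y).
Proof.
move=> far; have far' : del + margin < succ_dist A B a w.
  by move: off_cut; rewrite gtr0_norm ?subr_gt0 //; move: e_small e_gt0; lra.
apply/allP => -[m' y']; rewrite mem_grid => /= /andP[m'J y'J].
apply/negP => /andP[lt1 lt2].
have lt := incl_mono lt1.
have /= /andP[h1 _] := incl_diff (p := (m, y)) (p' := (m', y')) m'J y'J lt.
have E := slope_diff m' y'; cbv zeta in E.
set r := _ * w - _ in E; rewrite E in h1.
have x1 := X_gt0 m; have x2 := X_gt0 m'.
have r_gt0 : 0 < r.
  have pXX : 0 < X m * X m' by rewrite mulr_gt0.
  have : 0 < y%:R * r / (X m * X m') by rewrite -E subr_gt0.
  by rewrite ltr_pdivlMr // mul0r pmulr_rgt0.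
have rlt : y%:R * r < (1 + e) * ((1 + 3 * e) * G) * (((1 + e) * T) * ((1 + e) * T)).
  apply: lt_le_trans (_ : _ < (1 + e) * ((1 + 3 * e) * G) * (X m * X m')) _.
    have s1 : y%:R * r / (X m * X m') / (1 + e) < (1 + 3 * e) * G.
      by apply: le_lt_trans h1 _; apply: lt_le_trans c_hi; rewrite ltrBlDl.
    have ep : 0 < 1 + e by rewrite addr_gt0.
    rewrite ltr_pdivrMr // ltr_pdivrMr ?mulr_gt0 // in s1.
    by rewrite [(1 + e) * _]mulrC.
  rewrite ler_wpM2l //; last by apply: ler_pM; rewrite ?(ltW x1) ?(ltW x2) ?X_hi.
  by apply: mulr_ge0; [|apply: mulr_ge0; last exact: ltW]; move: e_gt0; lra.
have rlt' : r < (1 + e) ^+ 3 * (1 + 3 * e) * del.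
  rewrite -(ltr_pM2l y_gt0); apply: lt_le_trans rlt _.
  rewrite -del_T le_eqVlt; apply/orP; left; apply/eqP; field; exact: lt0r_neq0.
have p1 := grow_bound (ltW e_gt0) e_small.
have rdel : r < del + 24 * e.
  apply: lt_le_trans rlt' _; apply: (@le_trans _ _ ((1 + 12 * e) * del)).
    by rewrite ler_wpM2r // ltW.
  have : e * del <= e * 2 by rewrite ler_wpM2l // ltW.
  lra.
have r3 : r <= 3 by move: del_le2 e_small; lra.
have kr := @active_range m' y' m'J.
have := succ_dist_min arc_a w_in (kr _) r_gt0; rewrite -/r => /(_ _).
rewrite (ltW r_gt0) r3 => /(_ isT).
have : 0 <= h%:R * e by rewrite mulr_ge0 // ltW.
by move: far'; rewrite marginE; lra.
Qed.

(** The minimiser of [k * w - p] is realised by a grid point: the margin to the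
    walls keeps its column between 0 and [2 * J]. *)
Lemma not_isolated_of_near : succ_dist A B a w < del ->
  ~~ isolated (grid J) incl c (m, y).
Proof.
move=> near; have near' : succ_dist A B a w < del - margin.
  by move: off_cut; rewrite ltr0_norm ?subr_lt0 //; move: e_small e_gt0; lra.
have he : 0 <= h%:R * e by rewrite mulr_ge0 // ltW.
pose k := slope A B a; pose g : R := succ_dist A B a w.
have g0 : 0 < g := succ_dist_gt0 arc_a w_in.
have g1 : g <= 1 := succ_dist_le1 arc_a w_in.
have /andP[kA kB] : - A%:Z <= k <= B%:Z := slope_range arc_a w_in.
pose d := k * M - icept A B a.
have gE : k%:~R * w - (d - k * M)%:~R = g.
  by rewrite /g /succ_dist -/k /d addrAC subrr add0r rmorphN opprK.
have CR := cross k d; rewrite gE in CR.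
have yg : y%:R * g <= y%:R by rewrite ler_piMr // ltW.
have yg0 : 0 <= y%:R * g by rewrite mulr_ge0 // ltW.
have eT : 0 <= e * T by rewrite mulr_ge0 // ltW.
move/andP: A_itv => [a1 a1']; move/andP: B_itv => [b1 b1'].
have AT : (A%:R + margin) * T < rows_below t J m y * T by rewrite ltr_pM2r.
have BT : (B%:R + margin) * T < rows_above t J m y * T by rewrite ltr_pM2r.
rewrite belowE in AT; rewrite aboveE in BT.
have A0 : 0 <= A%:R :> R by []. have B0 : 0 <= B%:R :> R by [].
have AeT : A%:R * (e * T) <= h%:R * (e * T) by rewrite ler_wpM2r.
have BeT : B%:R * (e * T) <= h%:R * (e * T) by rewrite ler_wpM2r.
have mhi : d%:~R * y%:R <= (2 * J%:R - m%:R) * y%:R :> R.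
  have [k0|k0] := leP k 0.
    have : k%:~R * X m <= 0 by rewrite mulr_le0_ge0 ?lerz0 // ltW.
    have : 0 <= B%:R * T by rewrite mulr_ge0 // ltW.
    have : 0 <= margin * T by rewrite mulr_ge0 // ltW.
    by move: CR BT yg0; lra.
  have : k%:~R * X m <= B%:R * ((1 + e) * T).
    apply: ler_pM; rewrite ?ler0z ?(ltW (X_gt0 _)) ?X_hi //; first exact: ltW.
    by rewrite pmulrn ler_int.
  by move: CR BT yg0 BeT eT he e_gt0; rewrite marginE; lra.
have mlo : - (d%:~R * y%:R) <= m%:R * y%:R :> R.
  have [k0|k0] := leP k 0.
    have : - k%:~R * X m <= A%:R * ((1 + e) * T).
      apply: ler_pM; rewrite ?oppr_ge0 ?lerz0 ?(ltW (X_gt0 _)) ?X_hi //.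
      by rewrite -rmorphN pmulrn ler_int; move: kA; move: (A) (k); clear; lia.
    by move: CR AT y_eT yg AeT eT; rewrite marginE; lra.
  have : 1 * X m <= k%:~R * X m by rewrite ler_wpM2r ?(ltW (X_gt0 _)) // ler1z; move: k0; move: (k); clear; lia.
  have := X_lo m; have : 0 <= m%:R * y%:R :> R by rewrite mulr_ge0.
  have : 0 <= (1 - 2 * e) * T by rewrite mulr_ge0 ?(ltW T_gt0) //; move: e_small; lra.
  by move: CR y_eT yg eT; lra.
have hy : (h <= y)%N by rewrite -(ler_nat R); apply: le_trans hJ (ltW y_gt).
have m1 : 0 <= m%:Z + d.
  rewrite -(ler0z R) rmorphD /= -pmulrn -(pmulr_lge0 _ y_gt0) mulrDl; move: mlo; lra.
have m2 : m%:Z + d <= (2 * J)%N%:Z.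
  rewrite -(ler_int R) rmorphD /= -!pmulrn natrM -(ler_pM2r y_gt0) mulrDl.
  by move: mhi; lra.
have AhN := active_le.
pose m' := absz (m%:Z + d); pose y' := absz (y%:Z + k).
have m'E : m'%:Z - m%:Z = d by rewrite /m'; move: m1; move: (d); clear; lia.
have y'E : y'%:Z - y%:Z = k by rewrite /y'; move: kA hy AhN; move: (A) (B) (k); clear; lia.
have m'J : (m' <= 2 * J)%N by rewrite /m'; move: m1 m2; move: (d); clear; lia.
have y'J : (y' <= J)%N by rewrite /y'; move: kA kB hy y_hi AhN; move: (A) (B) (k); clear; lia.
have x1 := X_gt0 m; have x2 := X_gt0 m'.
have E := slope_diff m' y'; cbv zeta in E; rewrite y'E m'E gE in E.
have d0 : 0 < y%:R * g / (X m * X m') by rewrite divr_gt0 ?mulr_gt0.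
have lt : y%:R / X m < y'%:R / X m' by rewrite -subr_gt0 E.
have /andP[h1 h2] := incl_diff (p := (m, y)) (p' := (m', y')) m'J y'J lt.
rewrite /= E in h1 h2.
apply/allPn; exists (m', y'); first by rewrite mem_grid m'J.
rewrite negbK; apply/andP; split.
  by rewrite -subr_gt0; apply: lt_le_trans h1; rewrite divr_gt0 //; move: e_small e_gt0; lra.
rewrite -ltrBlDl; apply: le_lt_trans h2 _; apply: lt_le_trans c_lo.
rewrite ltr_pdivrMr ?mulr_gt0 //.
apply: lt_le_trans (_ : _ < (1 - 3 * e) * G * (((1 - e) * T) * ((1 - e) * T))) _; last first.
  rewrite ler_wpM2l //.
    by rewrite mulr_ge0 ?(ltW G_gt0) //; move: e_small; lra.
  by apply: ler_pM => //; rewrite mulr_ge0 // ltW.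
have -> : (1 - 3 * e) * G * (((1 - e) * T) * ((1 - e) * T)) =
   y%:R * ((1 - 3 * e) * (1 - e) ^+ 2 * del).
  by rewrite -del_T; field; exact: lt0r_neq0.
rewrite ltr_pM2l //; apply: lt_le_trans near' _.
have h6 := shrink_bound (ltW e_gt0) e_small.
have h7 : (1 - 5 * e) * del <= (1 - 3 * e) * (1 - e) ^+ 2 * del by rewrite ler_wpM2r // ltW.
have h8 : e * del <= e * 2 by rewrite ler_wpM2l // ltW.
by move: h7 h8 he e_gt0; rewrite marginE; lra.
Qed.

End InArc.
End Point.
End Geometry.

(** * The list of angles and its average gap *)

Section AnglesOfGrid.
Context {R : realType}.
Variables (t : R) (J : nat).
Hypotheses (t_gt0 : 0 < t) (J_gt0 : (0 < J)%N) (tJ : 1 < t * J%:R).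

Let X := @absc R t J.

Let X_gt0 m : 0 < X m.
Proof.
rewrite /X /absc expr2 mulrA -[in - J%:R](mul1r J%:R) -mulrBl.
by rewrite ltr_wpDr // mulr_gt0 ?subr_gt0 // ltr0n.
Qed.

Lemma angle_incl (p : nat * nat) :
  angle ((p.1%:Z - J%:Z)%:~R, (p.2%:Z)%:~R) (viewpoint t J) (0, 0) = incl t J p.
Proof.
have T0 : 0 < t * J%:R ^+ 2 by rewrite mulr_gt0 ?exprn_gt0 ?ltr0n.
rewrite /angle /viewpoint /incl /enorm /dot /=.
have -> : (p.1%:Z - J%:Z)%:~R - - (t * J%:R ^+ 2) = X p.1.
  by rewrite /X /absc rmorphB /= -!pmulrn; ring.
have -> : 0 - - (t * J%:R ^+ 2) = t * J%:R ^+ 2 by ring.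
rewrite !subr0 !mulr0 !addr0 -!expr2 -pmulrn sqrtr_sqr gtr0_norm //.
have -> : X p.1 * (t * J%:R ^+ 2) / (Num.sqrt (X p.1 ^+ 2 + p.2%:R ^+ 2) * (t * J%:R ^+ 2))
   = X p.1 / Num.sqrt (X p.1 ^+ 2 + p.2%:R ^+ 2).
  by rewrite -mulf_div mulfV ?mulr1 // lt0r_neq0.
by rewrite acos_atan.
Qed.

Lemma angles_grid : angles t J = sort <=%R [seq incl t J p | p <- grid J].
Proof.
rewrite /angles; congr sort.
have -> : region J = [seq (p.1%:Z - J%:Z, p.2%:Z) | p <- grid J].
  by rewrite /region /grid map_allpairs.
by rewrite -map_comp; apply: eq_map => p /=; rewrite -angle_incl.
Qed.

Lemma size_grid : size (grid J) = region_card J.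
Proof. by rewrite size_allpairs !size_iota. Qed.

Lemma uniq_grid : uniq (grid J).
Proof. by apply: allpairs_uniq; rewrite ?iota_uniq // => -[? ?] [? ?]. Qed.

(** The steepest point is the top left corner. *)
Lemma largest_angle : alpha t J (region_card J) = atan (J%:R / X 0).
Proof.
have maxi p : p \in grid J -> incl t J p <= atan (J%:R / X 0).
  rewrite mem_grid => /andP[_ yJ]; apply: le_atan; rewrite -/X.
  apply: ler_pM; rewrite ?invr_ge0 ?(ltW (X_gt0 _)) ?ler_nat //.
  by rewrite lef_pV2 ?posrE // /X /absc addr0 lerDl.
have sz : size (angles t J) = region_card J.
  by rewrite angles_grid size_sort size_map size_grid.
rewrite /alpha; apply/eqP; rewrite eq_le; apply/andP; split.
  have : nth 0 (angles t J) (region_card J).-1 \in angles t J.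
    by rewrite mem_nth // sz prednK.
  by rewrite {2}angles_grid mem_sort => /mapP[p pg ->]; exact: maxi.
have : atan (J%:R / X 0) \in angles t J.
  rewrite angles_grid mem_sort; apply/mapP; exists (0%N, J) => //.
  by rewrite mem_grid /= leqnn.
move/(nthP 0) => [i]; rewrite sz => iN <-.
have ss : sorted <=%R (angles t J) by apply: sort_sorted; exact: le_total.
by apply: (sorted_leq_nth le_trans le_refl 0 ss); rewrite ?inE ?sz ?prednK.
Qed.

End AnglesOfGrid.

Section MeanGap.
Context {R : realType}.
Variables (t e : R) (J : nat).
Hypotheses (t_gt0 : 0 < t) (e_gt0 : 0 < e) (e_small : e <= 24^-1).
Hypotheses (J_gt0 : (0 < J)%N) (J_large : 1 <= e * t * J%:R) (J_large' : 2 <= e * J%:R).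

Let JR : 0 < J%:R :> R. Proof. by rewrite ltr0n. Qed.

Let tJ_e : e^-1 <= t * J%:R.
Proof. by rewrite -(ler_pM2l e_gt0) mulfV ?lt0r_neq0 // mulrA. Qed.

Lemma tJ_gt1 : 1 < t * J%:R.
Proof.
apply: lt_le_trans tJ_e; rewrite invf_gt1 //.
by apply: le_lt_trans e_small _; rewrite invf_lt1 // ltr1n.
Qed.

(** The largest angle is about [1 / (t * J)], for about [2 * J ^ 2] points. *)
Lemma mean_gap_bounds :
  (1 - 3 * e) / (2 * t * J%:R ^+ 3) <= mean_gap t J <= (1 + 3 * e) / (2 * t * J%:R ^+ 3).
Proof.
have tJ := tJ_gt1.
have es := e_small; have eg := e_gt0; have Jr := JR.
have e1 : 0 < 1 - e by lra.
rewrite /mean_gap largest_angle //.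
set v := J%:R / _; set N := (region_card J)%:R.
have D0 : 0 < 2 * t * J%:R ^+ 3 by rewrite !mulr_gt0 ?exprn_gt0.
have NE : N = 2 * J%:R ^+ 2 + 3 * J%:R + 1 :> R.
  by rewrite /N /region_card natrM -[(2 * J).+1%:R]natr1 -[J.+1%:R]natr1 natrM; ring.
have N0 : 0 < N by rewrite /N ltr0n.
have J20 : 0 < J%:R ^+ 2 :> R by rewrite exprn_gt0.
have Nlo : 2 * J%:R ^+ 2 <= N by rewrite NE; move: JR; lra.
have Nhi : N <= 2 * (1 + e) * J%:R ^+ 2.
  have J1 : 1 <= J%:R :> R by rewrite ler1n.
  have : 2 * J%:R <= e * J%:R * J%:R by rewrite ler_wpM2r // ltW.
  by rewrite NE expr2; lra.
have XE : absc t J 0 = t * J%:R * J%:R - J%:R by rewrite /absc expr2; ring.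
have eJ : J%:R <= e * t * J%:R * J%:R by rewrite ler_peMl // ltW.
have tJJ : 0 < t * J%:R * J%:R by rewrite !mulr_gt0.
have X0 : 0 < absc t J 0.
  have : e * (t * J%:R * J%:R) <= 24^-1 * (t * J%:R * J%:R) by rewrite ler_wpM2r // ltW.
  by rewrite XE; lra.
have v0 : 0 < v by rewrite divr_gt0.
have vlo : (t * J%:R)^-1 <= v.
  rewrite ler_pdivlMr // XE mulrC ler_pdivrMr ?mulr_gt0 //; move: JR; lra.
have vhi : v <= (1 - e)^-1 * (t * J%:R)^-1.
  rewrite -invfM ler_pdivrMr // XE mulrC ler_pdivlMr ?mulr_gt0 //.
  by lra.
have tJi : (t * J%:R)^-1 <= e.
  by rewrite -[leRHS]invrK lef_pV2 ?posrE ?invr_gt0 // mulr_gt0.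
have v2e : v <= 2 * e.
  apply: le_trans vhi _; rewrite mulrC ler_pdivrMr //.
  have : e * e <= 24^-1 * e by rewrite ler_wpM2r // ltW.
  by move: tJi; lra.
have /andP[a1 a2] := atan_sub_bounds (lexx 0) v0 v2e.
rewrite atan0 !subr0 in a1 a2.
have tJ0 : 0 < t * J%:R by rewrite mulr_gt0.
apply/andP; split.
- rewrite ler_pdivlMr //; apply: le_trans a1.
  rewrite ler_pdivlMr; last by rewrite ltr_wpDr ?sqr_ge0.
  apply: le_trans vlo.
  apply: (@le_trans _ _ ((1 - 3 * e) / (2 * t * J%:R ^+ 3) * (2 * (1 + e) * J%:R ^+ 2)
      * (1 + (2 * e) ^+ 2))).
    rewrite ler_wpM2r ?addr_ge0 ?sqr_ge0 // ler_wpM2l // divr_ge0 ?(ltW D0) //; lra.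
  have -> : (1 - 3 * e) / (2 * t * J%:R ^+ 3) * (2 * (1 + e) * J%:R ^+ 2)
      * (1 + (2 * e) ^+ 2) = ((1 - 3 * e) * (1 + e) * (1 + 4 * (e * e))) * (t * J%:R)^-1.
    by field; rewrite !lt0r_neq0.
  rewrite ler_piMl ?invr_ge0 ?(ltW tJ0) //.
  have ee : 0 <= e * e by rewrite mulr_ge0 // ltW.
  have ee1 : e * e <= 24^-1 * e by rewrite ler_wpM2r // ltW.
  have eee : 0 <= e * e * e by rewrite mulr_ge0 // ltW.
  have eeee : 0 <= e * e * (e * e) by rewrite mulr_ge0.
  have -> : (1 - 3 * e) * (1 + e) * (1 + 4 * (e * e)) =
     1 - 2 * e + e * e - 8 * (e * e * e) - 12 * (e * e * (e * e)) by ring.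
  lra.
- rewrite ler_pdivrMr //; apply: le_trans a2 _; apply: le_trans vhi _.
  apply: (@le_trans _ _ ((1 + 3 * e) / (2 * t * J%:R ^+ 3) * (2 * J%:R ^+ 2))); last first.
    by rewrite ler_wpM2l // divr_ge0 ?(ltW D0) //; lra.
  have -> : (1 + 3 * e) / (2 * t * J%:R ^+ 3) * (2 * J%:R ^+ 2) = (1 + 3 * e) * (t * J%:R)^-1.
    by field; rewrite !lt0r_neq0.
  rewrite ler_wpM2r ?invr_ge0 ?(ltW tJ0) // -[leLHS]mul1r ler_pdivrMr //.
  have : e * e <= 24^-1 * e by rewrite ler_wpM2r // ltW.
  lra.
Qed.

End MeanGap.

(** * Exceptional points *)

Section Rare.
Context {R : realType}.
Implicit Types (P Q : R -> nat -> nat -> nat -> bool).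

(** Sets of grid points, depending on a tolerance [e], whose density is at most
    proportional to [e] in the limit. *)
Definition rare P := exists2 C : R, 0 <= C & forall e, 0 < e ->
  \forall J \near \oo,
    \sum_(0 <= m < (2 * J).+1) \sum_(0 <= y < J.+1) (P e J m y)%:R <= C * e * J%:R ^+ 2.

Lemma rare_or P Q : rare P -> rare Q -> rare (fun e J m y => P e J m y || Q e J m y).
Proof.
move=> [C C0 hP] [D D0 hQ]; exists (C + D); first exact: addr_ge0.
move=> e e0; apply: filterS2 (hP e e0) (hQ e e0) => J h1 h2.
apply: le_trans (_ : _ <= C * e * J%:R ^+ 2 + D * e * J%:R ^+ 2) _; last by lra.
apply: le_trans (lerD h1 h2); rewrite -big_split /=; apply: ler_sum => m _.
exact: sum_indic_orb.
Qed.

Lemma rare_false : rare (fun _ _ _ _ => false).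
Proof.
exists 0 => // e _; apply: nearW => J; rewrite !mul0r big1 // => m _.
by rewrite big1.
Qed.

Lemma rare_has (I : eqType) (s : seq I) (F : I -> R -> nat -> nat -> nat -> bool) :
  (forall i, i \in s -> rare (F i)) -> rare (fun e J m y => has (fun i => F i e J m y) s).
Proof.
elim: s => [|i s IH] hF; first exact: rare_false.
apply: rare_or; first exact/hF/mem_head.
by apply: IH => j js; apply: hF; rewrite inE js orbT.
Qed.

Lemma rare_rows P (C : R) : 0 <= C -> (forall e, 0 < e -> \forall J \near \oo,
   forall y, (y <= J)%N ->
     \sum_(0 <= m < (2 * J).+1) (P e J m y)%:R <= C * (e * J%:R + 1)) -> rare P.
Proof.
move=> C0 hP; exists (4 * C); first by rewrite mulr_ge0.
move=> e e0; near=> J.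
have hJ : forall y, (y <= J)%N ->
    \sum_(0 <= m < (2 * J).+1) (P e J m y)%:R <= C * (e * J%:R + 1).
  by near: J; exact: hP.
have J0 : 1 <= J%:R :> R by near: J; exact: nbhs_infty_ger.
have eJ : e^-1 <= J%:R by near: J; exact: nbhs_infty_ger.
have eJ1 : 1 <= e * J%:R by rewrite -ler_pdivrMl // mulr1.
have K0 : 0 <= C * (e * J%:R + 1) by rewrite mulr_ge0 // addr_ge0 // mulr_ge0 // ltW.
rewrite exchange_big /=; apply: le_trans (sum_const_le K0 _) _.
  by move=> y; rewrite ltnS => /= hy; exact: hJ.
rewrite -natr1; apply: (@le_trans _ _ (2 * J%:R * (C * (2 * (e * J%:R))))); last first.
  by rewrite expr2; lra.
apply: ler_pM => //; first lra.
by rewrite ler_wpM2l //; lra.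
Unshelve. all: by end_near. Qed.

Lemma rare_cols P (C : R) : 0 <= C -> (forall e, 0 < e -> \forall J \near \oo,
   forall m, (m <= 2 * J)%N ->
     \sum_(0 <= y < J.+1) (P e J m y)%:R <= C * (e * J%:R + 1)) -> rare P.
Proof.
move=> C0 hP; exists (6 * C); first by rewrite mulr_ge0.
move=> e e0; near=> J.
have hJ : forall m, (m <= 2 * J)%N ->
    \sum_(0 <= y < J.+1) (P e J m y)%:R <= C * (e * J%:R + 1).
  by near: J; exact: hP.
have J0 : 1 <= J%:R :> R by near: J; exact: nbhs_infty_ger.
have eJ : e^-1 <= J%:R by near: J; exact: nbhs_infty_ger.
have eJ1 : 1 <= e * J%:R by rewrite -ler_pdivrMl // mulr1.
have K0 : 0 <= C * (e * J%:R + 1) by rewrite mulr_ge0 // addr_ge0 // mulr_ge0 // ltW.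
apply: le_trans (sum_const_le K0 _) _.
  by move=> m; rewrite ltnS => /= hm; exact: hJ.
rewrite -natr1 natrM; apply: (@le_trans _ _ (3 * J%:R * (C * (2 * (e * J%:R))))); last first.
  by rewrite expr2; lra.
apply: ler_pM => //; first lra.
by rewrite ler_wpM2l //; lra.
Unshelve. all: by end_near. Qed.

End Rare.

Section BadPoints.
Context {R : realType}.
Variables (t mu : R) (h : nat).
Hypotheses (t_gt0 : 0 < t) (mu_gt0 : 0 < mu).

Let b0 := mu / 2.
Let b0_gt0 : 0 < b0. Proof. by rewrite divr_gt0. Qed.
Let kap : R := (h + 24)%:R.
Let kap_gt0 : 0 < kap. Proof. by rewrite ltr0n addn_gt0 orbT. Qed.

Definition in_rows (J y : nat) : bool := (row0 b0 J <= y < J)%N.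
Definition off (J m y : nat) : R := frac (absc t J m / y%:R).

Definition on_end (a : (nat * nat) * (nat * nat)) (J m y : nat) : bool :=
  in_rows J y && (off J m y == ratio a.1).
Definition near_cut n A (a : (nat * nat) * (nat * nat)) (e : R) (J m y : nat) : bool :=
  in_rows J y && (`|succ_dist A (n - A) a (off J m y) - cutoff mu J y| <= kap * e).

(** Border points, points near a wall, and points whose residue is at the end of
    an arc or too close to the threshold: the tolerance [kap * e] is the margin
    that the isolation criteria ask for. *)
Definition bad_point (e : R) (J m y : nat) : bool :=
  [|| y == 0%N, m == 0%N, (J <= y + h)%N, in_rows J y && near_wall t (kap * e) J m y |
   has (fun n => has (fun A => has (fun a => on_end a J m y || near_cut n A a e J m y)
     (farey n)) (iota 0 n.+1)) (iota 0 h.+1)].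

Let rows_gt0 J y : in_rows J y -> [/\ (0 < y)%N, b0 * J%:R < y%:R & (y < J)%N].
Proof.
case/andP=> h1 h2; split=> //; last exact: row0_gt.
exact: leq_trans h1.
Qed.

(** In one row, [X / y] runs through an arithmetic progression of step [1 / y]. *)
Let count_off J y (z0 eta : R) : in_rows J y -> 0 <= eta ->
  \sum_(0 <= m < (2 * J).+1) (frac (absc t J m / y%:R + z0) <= eta)%R%:R
   <= (3 / b0 + 2) * (eta * J%:R + 1).
Proof.
move=> /rows_gt0[y0 yb yJ] eta0; have y0R : 0 < y%:R :> R by rewrite ltr0n.
have J1 : 1 <= J%:R :> R by rewrite ler1n; exact: leq_ltn_trans yJ.
have yJR : y%:R <= J%:R :> R by rewrite ler_nat ltnW.
have := count_frac_arith (2 * J).+1 ((t * J%:R ^+ 2 - J%:R) / y%:R + z0)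
  (sigma := y%:R^-1) _ eta0; rewrite invr_gt0 => /(_ y0R).
rewrite invrK.
have -> : \sum_(0 <= m < (2 * J).+1)
     (frac ((t * J%:R ^+ 2 - J%:R) / y%:R + z0 + y%:R^-1 * m%:R) <= eta)%R%:R
  = \sum_(0 <= m < (2 * J).+1) (frac (absc t J m / y%:R + z0) <= eta)%R%:R :> R.
  apply: eq_bigr => m _; congr ((frac _ <= eta)%R%:R).
  by rewrite /absc mulrDl; ring.
move/le_trans; apply; apply: ler_pM.
- by rewrite addr_ge0 // mulr_ge0 // invr_ge0 ltW.
- by rewrite addr_ge0 // mulr_ge0 // ltW.
- rewrite lerD2r mulrC ler_pdivrMr // mulrC.
  apply: (@le_trans _ _ (3 * J%:R)).
    by rewrite -natr1 natrM; lra.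
  have -> : y%:R * (3 / b0) = 3 * (y%:R / b0) by ring.
  by rewrite ler_wpM2l // ler_pdivlMr // mulrC ltW.
- by rewrite lerD2r ler_wpM2l.
Qed.

Let C1 : R := 3 / b0 + 2.
Let C1_ge0 : 0 <= C1. Proof. by rewrite addr_ge0 // divr_ge0 // ltW. Qed.

Lemma rare_on_end a : rare (fun _ : R => on_end a).
Proof.
apply: (rare_rows (C := C1)) => // e e0; near=> J => y yJ.
have [hy|hy] := boolP (in_rows J y); last first.
  rewrite big1 => [|m _]; last by rewrite /on_end (negbTE hy).
  by rewrite mulr_ge0 // addr_ge0 // mulr_ge0 // ltW.
apply: (@le_trans _ _ (C1 * (0 * J%:R + 1))); last first.
  by rewrite ler_wpM2l // lerD2r ler_wpM2r // ltW.
apply: le_trans (count_off (- ratio a.1) hy (lexx 0)).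
apply: sum_indic_le => m _; rewrite /on_end hy /= /off => /eqP e1.
rewrite (@frac_unique _ _ (Num.floor (absc t J m / y%:R)) 0) ?lexx ?ltr01 //.
by rewrite {1}[absc t J m / y%:R]fracE e1; ring.
Unshelve. all: by end_near. Qed.

(** Away from slope 0, the residue must be close to one point modulo 1; in the
    case of slope 0 the distance is constantly 1 and the condition confines the
    height [y] instead. *)
Lemma rare_near_cut n A a : (A <= n)%N -> a \in farey n -> rare (near_cut n A a).
Proof.
move=> An ha; have := fareyP ha; rewrite -{1}(subnKC An) => arc.
have [n0|n0] := posnP n.
  subst n; have A0 : A = 0%N by move: An; clear; lia.
  subst A; move: ha; rewrite inE => /eqP ea; subst a.
  apply: (rare_cols (C := 2 * kap + 1)); first by rewrite addr_ge0 // mulr_ge0 // ltW.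
  move=> e e0; near=> J => m mJ.
  have J0 : 0 < J%:R :> R by near: J; exact: nbhs_infty_gtr.
  have ke : 0 <= kap * e by rewrite mulr_ge0 // ltW.
  apply: (@le_trans _ _ (2 * kap * e * J%:R + 1)); last first.
    have : 0 <= kap * 2 by rewrite mulr_ge0 // ltW.
    have : 0 <= e * J%:R by rewrite mulr_ge0 // ltW.
    lra.
  apply: count_spread.
    by rewrite -[2 * kap * e]mulrA !mulr_ge0 // ltW.
  have row y : near_cut 0 0 ((0, 1), (1, 1))%N e J m y ->
     `|y%:R - mu * J%:R| <= kap * e * J%:R.
    rewrite /near_cut => /andP[/rows_gt0[y0 yb yJ]].
    have y0R : 0 < y%:R :> R by rewrite ltr0n.
    have yJR : y%:R <= J%:R :> R by rewrite ler_nat ltnW.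
    have -> : succ_dist 0 (0 - 0) ((0, 1), (1, 1))%N (off J m y) = 1.
      by rewrite /succ_dist /slope /icept /= subrr mul0r add0r.
    move=> hc; have -> : y%:R - mu * J%:R = (1 - cutoff mu J y) * y%:R.
      by rewrite /cutoff; field; rewrite lt0r_neq0.
    by rewrite normrM [`|y%:R|]gtr0_norm // ler_pM.
  move=> y y' _ _ /row h1 /row h2; move: h1 h2.
  by rewrite !ler_norml => /andP[? ?] /andP[? ?]; lra.
have An' : (0 < A + (n - A))%N by rewrite subnKC.
have s0 := slope_neq0 arc An'.
pose al : R := (slope A (n - A) a)%:~R; pose ga : R := (icept A (n - A) a)%:~R.
have al0 : al != 0 by rewrite intr_eq0.
have al1 : 1 <= `|al|.
  rewrite /al -intr_norm -[1](_ : 1%:~R = _) // ler_int.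
  by move: s0; clear; lia.
have K0 : 0 <= C1 * (2 * kap + 1) by rewrite mulr_ge0 // addr_ge0 // mulr_ge0 // ltW.
apply: (rare_rows (C := C1 * (2 * kap + 1))) => // e e0; near=> J => y yJ.
have J0 : 0 < J%:R :> R by near: J; exact: nbhs_infty_gtr.
have eJ : 0 <= e * J%:R by rewrite mulr_ge0 // ltW.
have [hy|hy] := boolP (in_rows J y); last first.
  rewrite big1 => [|m _]; last by rewrite /near_cut (negbTE hy).
  by rewrite mulr_ge0 // addr_ge0.
have ke : 0 <= kap * e by rewrite mulr_ge0 // ltW.
pose z := (cutoff mu J y - ga) / al.
apply: (@le_trans _ _ (C1 * (2 * (kap * e) * J%:R + 1))); last first.
  rewrite -[leRHS]mulrA ler_wpM2l //; have : 0 <= kap * 2 by rewrite mulr_ge0 // ltW.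
  lra.
have [k1|k1] := ltP (2 * (kap * e)) 1; last first.
  apply: le_trans (count_off 0 hy (_ : 0 <= 2 * (kap * e))); last by rewrite mulr_ge0.
  by apply: sum_indic_le => m _ _; apply: le_trans (ltW (frac_lt1 _)) k1.
apply: le_trans (count_off (kap * e - z) hy (_ : 0 <= 2 * (kap * e))); last by rewrite mulr_ge0.
apply: sum_indic_le => m _; rewrite /near_cut hy /= => hc.
have : `|off J m y - z| <= kap * e.
  have -> : off J m y - z = (succ_dist A (n - A) a (off J m y) - cutoff mu J y) / al.
    by rewrite /z /succ_dist -/al -/ga; field.
  rewrite normrM normfV ler_pdivrMr ?(lt_le_trans _ al1) //.
  by apply: le_trans hc _; rewrite ler_peMr.
rewrite ler_norml => /andP[c1 c2].
rewrite (@frac_unique _ _ (Num.floor (absc t J m / y%:R)) (off J m y - z + kap * e)).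
- lra.
- by rewrite {1}[absc t J m / y%:R]fracE -/(off J m y); ring.
- by apply/andP; split; lra.
Unshelve. all: by end_near. Qed.

Lemma rare_bad : rare bad_point.
Proof.
apply: rare_or; [|apply: rare_or; [|apply: rare_or; [|apply: rare_or]]].
- apply: (rare_cols (C := 1)) => // e e0; apply: nearW => J m _.
  apply: (@le_trans _ _ (0 + 1)); last by rewrite mul1r lerD2r mulr_ge0 // ltW.
  by apply: count_spread => // y y' _ _ /eqP-> /eqP->; rewrite subrr.
- apply: (rare_rows (C := 1)) => // e e0; apply: nearW => J y _.
  apply: (@le_trans _ _ (0 + 1)); last by rewrite mul1r lerD2r mulr_ge0 // ltW.
  by apply: count_spread => // m m' _ _ /eqP-> /eqP->; rewrite subrr.
- apply: (rare_cols (C := h%:R + 1)); first by rewrite addr_ge0.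
  move=> e e0; apply: nearW => J m _.
  apply: (@le_trans _ _ (h%:R + 1)); last first.
    by rewrite ler_peMr ?addr_ge0 // lerDr mulr_ge0 // ltW.
  apply: count_spread => // y y' _ /andP[yy yJ] h1 h2.
  rewrite -natrB // ler_nat; move: yJ h1; clear; lia.
- pose C := wall_const t * (2 * kap * t / b0 + 1).
  have W0 : 0 <= wall_const t.
    by rewrite /wall_const mulr_ge0 // addr_ge0 // divr_ge0 // ltW.
  have D0 : 0 <= 2 * kap * t / b0 by rewrite divr_ge0 ?mulr_ge0 // ltW.
  have C0 : 0 <= C by rewrite mulr_ge0 // addr_ge0.
  apply: (rare_rows (C := C)) => // e e0; near=> J => y yJ.
  have J0 : 0 < J%:R :> R by near: J; exact: nbhs_infty_gtr.
  have eJ : 0 <= e * J%:R by rewrite mulr_ge0 // ltW.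
  have [hy|hy] := boolP (in_rows J y); last first.
    by rewrite big1 // mulr_ge0 // addr_ge0.
  have ke : 0 < kap * e by rewrite mulr_gt0.
  apply: le_trans (count_near_row t_gt0 b0_gt0 ke _ hy) _; first by rewrite -(ltr_nat R).
  rewrite /C -[leRHS]mulrA ler_wpM2l //.
  have -> : 2 * (kap * e) * t * J%:R / b0 = 2 * kap * t / b0 * (e * J%:R) by ring.
  lra.
- apply: rare_has => n; rewrite mem_iota => /andP[_ nh].
  apply: rare_has => A; rewrite mem_iota => /andP[_ An].
  apply: rare_has => a ha; apply: rare_or; first exact: rare_on_end.
  by apply: rare_near_cut.
Unshelve. all: by end_near. Qed.

End BadPoints.

(** * The limit of the gap distribution *)

Section Limit.
Context {R : realType}.
Variables (t lam : R) (h : nat).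
Hypotheses (t_gt0 : 0 < t) (lam_gt0 : 0 < lam) (ht : 2 <= h.+1%:R * t).

Let mu := lam * t / 2.
Let mu_gt0 : 0 < mu. Proof. by rewrite divr_gt0 // mulr_gt0. Qed.
Let b0 := mu / 2.
Let b0_gt0 : 0 < b0. Proof. by rewrite divr_gt0. Qed.

(** The limit, a sum over the numbers [n] of other active rows, their splittings
    [n = A + (n - A)] and the arcs of order [n]; the factor 1/2 is because there
    are about [2 * J ^ 2] points. *)
Definition gap_value : R :=
  2^-1 * \sum_(0 <= n < h.+1) \sum_(0 <= A < n.+1) \sum_(a <- farey n)
    arc_value t mu A (n - A) a.

(** Indicator of the points that are isolated according to the arc containing
    [frac (X / y)]. *)
Definition predicted J m y : R :=
  \sum_(0 <= n < h.+1) \sum_(0 <= A < n.+1) \sum_(a <- farey n)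
    (active t A (n - A) J m y)%:R * (in_window t mu A (n - A) a J m y)%:R.

Lemma negl_main_sum (I : eqType) (s : seq I) (f : I -> nat -> nat -> nat -> R) (v : I -> R) :
  (forall i, i \in s -> negl (fun J => \sum_(0 <= m < (2 * J).+1)
     \sum_(row0 b0 J <= y < J) f i J m y - J%:R ^+ 2 * v i)) ->
  negl (fun J => \sum_(0 <= m < (2 * J).+1) \sum_(row0 b0 J <= y < J)
     \sum_(i <- s) f i J m y - J%:R ^+ 2 * \sum_(i <- s) v i).
Proof.
move=> hs; apply: negl_eq (negl_sum hs); apply: nearW => J.
rewrite sumrB -mulr_sumr exchange_big /=; congr (_ - _).
by apply: eq_bigr => m _; rewrite exchange_big.
Qed.

Lemma predicted_sum : negl (fun J => \sum_(0 <= m < (2 * J).+1)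
  \sum_(row0 b0 J <= y < J) predicted J m y - J%:R ^+ 2 * (2 * gap_value)).
Proof.
rewrite /gap_value mulrA mulfV // mul1r /predicted.
apply: negl_main_sum => n _; apply: negl_main_sum => A.
rewrite mem_index_iota => /andP[_ An]; apply: negl_main_sum => a ha.
by apply: arc_sum => //; rewrite subnKC.
Qed.

Lemma sum_single (k i : nat) (F : nat -> R) : (i < k)%N ->
  (forall j, j != i -> F j = 0) -> \sum_(0 <= j < k) F j = F i.
Proof.
move=> ik h0; rewrite (bigD1_seq i) ?iota_uniq //=; last by rewrite mem_index_iota.
by rewrite big1 ?addr0.
Qed.

Lemma predictedE J m y (A := Num.truncn (rows_below t J m y))
    (B := Num.truncn (rows_above t J m y)) : (A + B <= h)%N ->
  predicted J m y = \sum_(a <- farey (A + B)) (in_window t mu A B a J m y)%:R.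
Proof.
move=> ABh; rewrite /predicted (@sum_single _ (A + B)) //; last first.
  move=> n nAB; rewrite big1_seq // => A' /andP[_]; rewrite mem_index_iota => /andP[_ A'n].
  rewrite big1 // => a _; rewrite /active; case: eqP => [eA|]; last by rewrite mul0r.
  case: eqP => [eB|]; last by rewrite andbF mul0r.
  by move: nAB; rewrite /A /B eA eB subnKC ?eqxx.
rewrite (@sum_single _ A); last first.
- move=> A' A'A; rewrite big1 // => a _; rewrite /active.
  by rewrite eq_sym -/A (negbTE A'A) mul0r.
- by rewrite ltnS leq_addr.
by apply: eq_bigr => a _; rewrite addKn /active !eqxx mul1r.
Qed.

Definition nterms : R :=
  \sum_(0 <= n < h.+1) \sum_(0 <= A < n.+1) \sum_(a <- farey n) 1.

Lemma nterms_ge0 : 0 <= nterms.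
Proof. by rewrite sumr_ge0 // => n _; rewrite sumr_ge0 // => A _; rewrite sumr_ge0. Qed.

Lemma predicted_bound J m y : 0 <= predicted J m y <= nterms.
Proof.
apply/andP; split.
  by rewrite sumr_ge0 // => n _; rewrite sumr_ge0 // => A _; rewrite sumr_ge0 // => a _; rewrite mulr_ge0.
apply: ler_sum => n _; apply: ler_sum => A _; apply: ler_sum => a _.
by case: (active _ _ _ _ _ _); case: (in_window _ _ _ _ _ _ _ _); rewrite ?mul1r ?mul0r.
Qed.

Section Good.
Variables (J : nat) (e c : R).
Hypotheses (e_gt0 : 0 < e) (e_small : e <= 24^-1).
Hypotheses (J_gt0 : (0 < J)%N) (J_large : 1 <= e * t * J%:R).
Hypotheses (hJ : h%:R <= b0 * J%:R).
Let G := lam / (2 * t * J%:R ^+ 3).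
Hypotheses (c_lo : (1 - 3 * e) * G <= c) (c_hi : c <= (1 + 3 * e) * G).

(** Exactly one arc contains [w]; in this one the window tells whether
    [succ_dist] exceeds the threshold, and the other windows do not contain
    [w]. *)
Lemma good_row m y : (m <= 2 * J)%N -> in_rows mu J y -> ~~ bad_point t mu h e J m y ->
  (isolated (grid J) (incl t J) c (m, y))%:R = predicted J m y /\
  alone (grid J) (incl t J) (m, y).
Proof.
move=> mJ hy; rewrite /bad_point hy andTb.
move=> /norP[_ /norP[_ /norP[yh /norP[nw nh]]]].
have /andP[y_lo _] := hy.
have y_hi : (y + h < J)%N by rewrite ltnNge.
have ABh := active_le t_gt0 ht e_gt0 J_gt0 mJ y_hi nw.
rewrite (predictedE ABh); set A := Num.truncn _ in ABh *; set B := Num.truncn _ in ABh *.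
set iso := isolated _ _ _ _.
pose w := off t J m y.
have arcs a : a \in farey (A + B) -> in_arc a w ->
    in_window t mu A B a J m y = iso /\ alone (grid J) (incl t J) (m, y).
  move=> ha /andP[w1 w2]; have arc := fareyP ha.
  have /norP[ne nc] : ~~ (on_end t mu a J m y || near_cut t mu h (A + B) A a e J m y).
    apply: contra nh => hb; apply/hasP; exists (A + B)%N; first by rewrite mem_iota add0n ltnS.
    apply/hasP; exists A; first by rewrite mem_iota add0n ltnS leq_addr.
    by apply/hasP; exists a.
  have w1' : ratio a.1 < w.
    by rewrite lt_neqAle w1 andbT eq_sym; move: ne; rewrite /on_end hy.
  have far : (h + 24)%:R * e < `|succ_dist A B a w - cutoff mu J y|.
    by move: nc; rewrite /near_cut hy /= -ltNge addKn.
  have w_in : ratio a.1 < w < ratio a.2 by rewrite w1'.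
  split; last exact: (point_alone t_gt0 lam_gt0 ht e_gt0 e_small J_gt0 J_large mJ y_lo y_hi nw arc w_in).
  have ne' : (slope A B a)%:~R * w + (icept A B a)%:~R != cutoff mu J y.
    apply/eqP => E; move: far; rewrite /succ_dist E subrr normr0 ltNge.
    by rewrite mulr_ge0 // ltW.
  have w_in' : ratio a.1 <= w < ratio a.2 by rewrite w1.
  rewrite /in_window /arc_lo /arc_hi (win_mem w_in' ne').
  have [lt|gt|eq] := ltgtP (cutoff mu J y) (succ_dist A B a w).
  - by symmetry; exact: (isolated_of_far t_gt0 lam_gt0 ht e_gt0 e_small J_gt0 J_large c_hi mJ y_lo y_hi nw arc w_in far lt).
  - have n := not_isolated_of_near t_gt0 lam_gt0 ht e_gt0 e_small J_gt0 J_large hJ c_lo mJ y_lo y_hi nw arc w_in far gt.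
    by rewrite /iso (negbTE n).
  - by move: ne'; rewrite -/(succ_dist A B a w) eq eqxx.
have tile := farey_tiling (A + B) w; rewrite frac_itv in tile.
split; last first.
  have : has (fun a => in_arc a w) (farey (A + B)).
    apply/negPn/negP => /hasPn no; move: tile; rewrite big1_seq.
      by move/eqP; rewrite eq_sym oner_eq0.
    by move=> a /andP[_ /no /negbTE ->].
  by case/hasP => a ha /(arcs a ha)[].
transitivity (\sum_(a <- farey (A + B)) (in_arc a w)%:R * iso%:R : R).
  by rewrite -mulr_suml tile mul1r.
rewrite !big_seq; apply: eq_bigr => a ha.
have [ia|ia] := boolP (in_arc a w); first by rewrite mul1r (arcs a ha ia).1.
rewrite mul0r; case E : in_window => //; case/negP: ia; move: E.
have [i1 _ i3] := win_itv (slope A B a)%:~R (icept A B a)%:~R (cutoff mu J y)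
  (ltW (@ratio_lt R _ _ (fareyP ha))).
rewrite /in_window /in_arc => /andP[l1 l2]; apply/andP; split.
  exact: le_trans i1 l1.
exact: lt_le_trans l2 i3.
Qed.

Lemma good_low m y : (m <= 2 * J)%N -> (y <= J)%N -> ~~ in_rows mu J y ->
  ~~ bad_point t mu h e J m y -> ~~ isolated (grid J) (incl t J) c (m, y).
Proof.
move=> mJ yJ nr; rewrite /bad_point => /norP[y0 /norP[m0 /norP[yh _]]].
apply: (low_not_isolated t_gt0 lam_gt0 e_gt0 e_small J_gt0 J_large c_lo); rewrite ?lt0n ?m0 ?y0 //.
move: nr; rewrite /in_rows; have -> : (y < J)%N.
  by rewrite ltnNge; apply: contra yh => /leq_trans; apply; exact: leq_addr.
rewrite andbT -ltnNge /row0 ltnS => hy; apply: (@le_trans _ _ (Num.truncn (b0 * J%:R))%:R).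
  by rewrite ler_nat.
by rewrite truncn_le mulr_ge0 // ltW.
Qed.

End Good.

Lemma count_grid J (P : pred (nat * nat)) : (count P (grid J))%:R =
  \sum_(0 <= m < (2 * J).+1) \sum_(0 <= y < J.+1) (P (m, y))%:R :> R.
Proof.
rewrite -sum1_count natr_sum big_mkcond /= /grid big_allpairs /=.
rewrite /index_iota !subn0; apply: eq_bigr => m _; apply: eq_bigr => y _.
by case: (P _).
Qed.

Lemma sum_rows J (F : nat -> R) :
  \sum_(0 <= y < J.+1) (if in_rows mu J y then F y else 0) = \sum_(row0 b0 J <= y < J) F y.
Proof.
have [h1|h1] := leqP (row0 b0 J) J; last first.
  rewrite [RHS]big_geq ?(ltnW h1) // big1_seq // => y _.
  by rewrite /in_rows; case: ifP => // /andP[h2 h3]; move: (leq_trans h1 (leq_trans h2 (ltnW h3))); rewrite ltnn.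
rewrite big_nat_recr //= {2}/in_rows ltnn andbF addr0.
rewrite (@big_cat_nat _ _ _ (row0 b0 J)) //= [X in X + _]big_nat big1 ?add0r; last first.
  by move=> y /andP[_ hy]; rewrite /in_rows leqNgt hy.
by rewrite !big_nat; apply: eq_bigr => y hy; rewrite /in_rows hy.
Qed.

Definition ngaps J : nat :=
  count (fun j => lam * mean_gap t J <= alpha t J j.+1 - alpha t J j)
    (iota 1 (region_card J).-1).

(** Up to one gap, the number of long gaps lies between two counts of points that
    both agree with [predicted] outside of the bad points. *)
Lemma ngaps_predicted : negl (fun J => (ngaps J)%:R
  - \sum_(0 <= m < (2 * J).+1) \sum_(row0 b0 J <= y < J) predicted J m y).
Proof.
have [C C0 hC] := rare_bad h t_gt0 mu_gt0.
have differ (b b' : bool) (p N : R) : 0 <= p <= N ->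
    `|b%:R - (if b' then p else 0)| <= N + 1.
  rewrite ler_norml => /andP[p1 p2].
  by case: b; case: b' => /=; apply/andP; split; lra.
have K0 := nterms_ge0; set K := nterms + 1; have K1 : 0 < K by rewrite ltr_wpDl.
move=> eps eps0.
pose e := Num.min 24^-1 (eps / (2 * K * (C + 1))).
have D0 : 0 < 2 * K * (C + 1) by rewrite !mulr_gt0 // ltr_wpDl.
have e_gt0 : 0 < e by rewrite /e lt_min invr_gt0 ltr0n divr_gt0.
have e_small : e <= 24^-1 by rewrite /e ge_min lexx.
have e_eps : K * (C * e) <= eps / 2.
  have : e <= eps / (2 * K * (C + 1)) by rewrite /e ge_min lexx orbT.
  rewrite ler_pdivlMr // => h1; have : 0 <= K * e by rewrite mulr_ge0 // ltW.
  lra.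
near=> J.
have bad_J : \sum_(0 <= m < (2 * J).+1) \sum_(0 <= y < J.+1)
    (bad_point t mu h e J m y)%:R <= C * e * J%:R ^+ 2 by near: J; exact: hC.
have J0R : 0 < J%:R :> R by near: J; exact: nbhs_infty_gtr.
have J_gt0 : (0 < J)%N by rewrite -(ltr_nat R).
have J1 : 1 <= J%:R :> R by rewrite ler1n.
have J_large : 1 <= e * t * J%:R.
  by rewrite -ler_pdivrMl ?mulr_gt0 //; near: J; exact: nbhs_infty_ger.
have J_large' : 2 <= e * J%:R by rewrite -ler_pdivrMl //; near: J; exact: nbhs_infty_ger.
have hJ : h%:R <= b0 * J%:R by rewrite -ler_pdivrMl //; near: J; exact: nbhs_infty_ger.
have J_eps : 2 / eps <= J%:R by near: J; exact: nbhs_infty_ger.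
have tJ := tJ_gt1 e_gt0 e_small J_large.
set c := lam * mean_gap t J.
have /andP[g1 g2] := mean_gap_bounds t_gt0 e_gt0 e_small J_gt0 J_large J_large'.
have c_lo : (1 - 3 * e) * (lam / (2 * t * J%:R ^+ 3)) <= c.
  by rewrite mulrCA ler_wpM2l // ltW.
have c_hi : c <= (1 + 3 * e) * (lam / (2 * t * J%:R ^+ 3)).
  by rewrite mulrCA ler_wpM2l // ltW.
have [up low] := gaps_isolated (incl t J) c (uniq_grid J).
rewrite -angles_grid // size_grid -/(ngaps J) in up low.
set Z := \sum_(0 <= m < _) _.
pose zr m y : R := if in_rows mu J y then predicted J m y else 0.
have ZE : Z = \sum_(0 <= m < (2 * J).+1) \sum_(0 <= y < J.+1) zr m y.
  by rewrite /Z; apply: eq_bigr => m _; rewrite /zr sum_rows.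
have close (P : pred (nat * nat)) :
  (forall m y, (m <= 2 * J)%N -> (y <= J)%N -> ~~ bad_point t mu h e J m y ->
     (P (m, y))%:R = zr m y) ->
  `|(count P (grid J))%:R - Z| <= K * (C * e * J%:R ^+ 2).
  move=> hP; rewrite ZE count_grid.
  apply: le_trans (ler_wpM2l (ltW K1) bad_J).
  rewrite -sumrB mulr_sumr; apply: le_trans (ler_norm_sum _ _ _) _.
  rewrite big_nat [leRHS]big_nat; apply: ler_sum => m /andP[_ mJ].
  rewrite -sumrB mulr_sumr; apply: le_trans (ler_norm_sum _ _ _) _.
  rewrite big_nat [leRHS]big_nat; apply: ler_sum => y /andP[_ yJ].
  have [b|b] := boolP (bad_point t mu h e J m y); last first.
    by rewrite hP // subrr normr0 mulr0.
  by rewrite mulr1; exact: differ (predicted_bound J m y).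
have c1 := close (isolated (grid J) (incl t J) c) _.
have c2 := close (fun p => isolated (grid J) (incl t J) c p && alone (grid J) (incl t J) p) _.
have {}c1 : `|(count (isolated (grid J) (incl t J) c) (grid J))%:R - Z| <= K * (C * e * J%:R ^+ 2).
  apply: c1 => m y mJ yJ nb; rewrite /zr; case: ifPn => hy.
    by case: (good_row e_gt0 e_small J_gt0 J_large hJ c_lo c_hi mJ hy nb).
  by rewrite (negbTE (good_low e_gt0 e_small J_gt0 J_large c_lo mJ yJ hy nb)).
have {}c2 : `|(count (fun p => isolated (grid J) (incl t J) c p
    && alone (grid J) (incl t J) p) (grid J))%:R - Z| <= K * (C * e * J%:R ^+ 2).
  apply: c2 => m y mJ yJ nb; rewrite /zr; case: ifPn => hy.
    case: (good_row e_gt0 e_small J_gt0 J_large hJ c_lo c_hi mJ hy nb) => <- ->.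
    by rewrite andbT.
  by rewrite (negbTE (good_low e_gt0 e_small J_gt0 J_large c_lo mJ yJ hy nb)).
rewrite -(ler_nat R) in up; rewrite -(ler_nat R) -natr1 in low.
have small1 : 1 <= eps / 2 * J%:R ^+ 2.
  rewrite ler_pdivrMr // in J_eps; rewrite expr2.
  have : J%:R * eps <= J%:R * eps * J%:R by rewrite ler_peMr // mulr_ge0 // ltW.
  lra.
have K2 : K * (C * e * J%:R ^+ 2) <= eps / 2 * J%:R ^+ 2.
  by rewrite mulrA ler_wpM2r ?sqr_ge0.
move: c1 c2; rewrite !ler_norml => /andP[? ?] /andP[? ?]; apply/andP; split; lra.
Unshelve. all: by end_near. Qed.

Lemma gap_distr_cvg : gap_distr t lam J @[J --> \oo] --> gap_value.
Proof.
have H := negl_add ngaps_predicted predicted_sum.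
have {}H : negl (fun J => (ngaps J)%:R - J%:R ^+ 2 * (2 * gap_value)).
  by apply: negl_eq H; apply: nearW => J; rewrite addrA subrK.
apply/cvgrPdist_le => eps eps0.
have e2 : 0 < eps / 2 by rewrite divr_gt0.
near=> J.
have hJ : `|(ngaps J)%:R - J%:R ^+ 2 * (2 * gap_value)| <= eps / 2 * J%:R ^+ 2.
  by near: J; exact: H.
have J0 : 0 < J%:R :> R by near: J; exact: nbhs_infty_gtr.
have J1 : 1 <= J%:R :> R by near: J; exact: nbhs_infty_ger.
have J2 : 8 * `|gap_value| / eps <= J%:R by near: J; exact: nbhs_infty_ger.
set N : R := (region_card J)%:R.
have NE : N = 2 * J%:R ^+ 2 + 3 * J%:R + 1 :> R.
  by rewrite /N /region_card natrM -[(2 * J).+1%:R]natr1 -[J.+1%:R]natr1 natrM; ring.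
have N0 : 0 < N by rewrite /N ltr0n.
have Jsq : 0 <= J%:R ^+ 2 :> R by rewrite sqr_ge0.
have gE : gap_distr t lam J = (ngaps J)%:R / N by [].
have -> : gap_value - gap_distr t lam J =
   (gap_value * (3 * J%:R + 1) - ((ngaps J)%:R - J%:R ^+ 2 * (2 * gap_value))) / N.
  by rewrite gE -[gap_value in LHS](mulfK (lt0r_neq0 N0)) -mulrBl {1}NE; congr (_ / _); ring.
rewrite normrM normfV [`|N|]gtr0_norm // ler_pdivrMr //.
apply: le_trans (ler_normB _ _) _.
have g1 : `|gap_value * (3 * J%:R + 1)| <= `|gap_value| * (4 * J%:R).
  by rewrite normrM ler_wpM2l // ger0_norm; lra.
rewrite ler_pdivrMr // in J2.
have g2 : 8 * `|gap_value| * J%:R <= J%:R * eps * J%:R by rewrite ler_wpM2r // ltW.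
have g3 : eps * (2 * J%:R ^+ 2) <= eps * N.
  by rewrite ler_wpM2l ?(ltW eps0) // NE; lra.
have g4 : 0 <= eps * (J%:R ^+ 2) by rewrite mulr_ge0 // ltW.
move: g2 g3 hJ g1 g4; rewrite expr2; lra.
Unshelve. all: by end_near. Qed.

End Limit.

(** * The shape of the limit *)

Section Span.
Context {R : realType}.
Variables (C : R -> R -> Prop) (h : nat).

Definition combo (k : seq R) (t l : R) : R :=
  k`_0 + k`_1 * t + k`_2 * (l * t) + k`_3 * (l * t ^+ 2)
  + k`_4 * (t * ln l) + k`_5 * (l * t * ln l)
  + k`_6 * (t * ln t) + k`_7 * (l * t * ln t).

Definition in_span (F : R -> R -> R) :=
  exists k : seq R, forall t l, C t l -> F t l = combo k t l.

Lemma span_eq F G : (forall t l, C t l -> F t l = G t l) -> in_span F -> in_span G.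
Proof. by move=> e [k hk]; exists k => t l c; rewrite -e // hk. Qed.

Lemma span_add F G : in_span F -> in_span G -> in_span (fun t l => F t l + G t l).
Proof.
move=> [k hk] [k' hk']; exists (mkseq (fun i => k`_i + k'`_i) 8) => t l c.
by rewrite hk // hk' // /combo !nth_mkseq //; ring.
Qed.

Lemma span_scale (a : R) F : in_span F -> in_span (fun t l => a * F t l).
Proof.
move=> [k hk]; exists (mkseq (fun i => a * k`_i) 8) => t l c.
by rewrite hk // /combo !nth_mkseq //; ring.
Qed.

Lemma span0 : in_span (fun _ _ => 0).
Proof. by exists [::] => t l _; rewrite /combo !nth_nil; ring. Qed.

Lemma span_sub F G : in_span F -> in_span G -> in_span (fun t l => F t l - G t l).
Proof.
move=> hF hG; apply: span_eq (span_add hF (span_scale (-1) hG)) => t l _.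
by rewrite mulN1r.
Qed.

Lemma span_sum (I : eqType) (s : seq I) (F : I -> R -> R -> R) :
  (forall i, i \in s -> in_span (F i)) -> in_span (fun t l => \sum_(i <- s) F i t l).
Proof.
elim: s => [|i s IH] hF.
  by apply: span_eq span0 => t l _; rewrite big_nil.
apply: span_eq (span_add (hF i (mem_head _ _)) (IH _)).
  by move=> t l _; rewrite big_cons.
by move=> j js; apply: hF; rewrite inE js orbT.
Qed.

(** The points at which the pieces of the integral begin and end. *)
Inductive endpoint := WallAt of nat | CutAt of nat | Top.

Definition place (p : endpoint) (t l : R) : R :=
  match p with
  | WallAt m => m%:R * t / 2
  | CutAt q => q%:R * (l * t / 2)
  | Top => 1
  end.

Definition proper (p : endpoint) : bool :=
  match p with WallAt m => (0 < m)%N | CutAt q => (0 < q)%N | Top => true end.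

(** The order of two functions is the same throughout the region [C]. *)
Definition decided (f g : R -> R -> R) :=
  (forall t l, C t l -> f t l <= g t l) \/ (forall t l, C t l -> g t l <= f t l).

Hypothesis C_gt0 : forall t l, C t l -> 0 < t /\ 0 < l.

(** The logarithm of an endpoint is a constant plus logarithms of [t] and [l], and
    the coefficients of [prim] are those that arise from [tent] and [ramp]. *)
Lemma span_prim (k0 k1 k2 k3 : R) p : proper p ->
  in_span (fun t l => prim k0 (k1 * t + k2 * (l * t)) (k3 * (l * t ^+ 2)) (place p t l)).
Proof.
case: p => [m m0|q q0|_].
- exists [:: 0; k0 * m%:R / 2 + k1 * ln (m%:R / 2);
    k2 * ln (m%:R / 2) - 2 * k3 / m%:R; 0; 0; 0; k1; k2].
  move=> t l /C_gt0[t0 l0]; rewrite /prim /place /combo /=.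
  have m0R : 0 < m%:R :> R by rewrite ltr0n.
  have -> : m%:R * t / 2 = m%:R / 2 * t by ring.
  rewrite lnM ?posrE ?divr_gt0 //; field.
  by rewrite !lt0r_neq0.
- exists [:: 0; k1 * ln (q%:R / 2) - 2 * k3 / q%:R;
    k0 * q%:R / 2 + k2 * ln (q%:R / 2); 0; k1; k2; k1; k2].
  move=> t l /C_gt0[t0 l0]; rewrite /prim /place /combo /=.
  have q0R : 0 < q%:R :> R by rewrite ltr0n.
  have -> : q%:R * (l * t / 2) = q%:R / 2 * (l * t) by ring.
  rewrite !lnM ?posrE ?mulr_gt0 ?divr_gt0 //; field.
  by rewrite !lt0r_neq0.
- exists [:: k0; 0; 0; - k3; 0; 0; 0; 0] => t l _.
  by rewrite /prim /place /combo /= ln1; field.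
Qed.

Lemma span_piece (k0 k1 k2 k3 : R) (lo hi : R -> R -> R) plo phi :
  proper plo -> proper phi ->
  (forall t l, C t l -> lo t l = place plo t l) ->
  (forall t l, C t l -> hi t l = place phi t l) ->
  decided (place plo) (place phi) ->
  in_span (fun t l => piece k0 (k1 * t + k2 * (l * t)) (k3 * (l * t ^+ 2)) (lo t l) (hi t l)).
Proof.
move=> p1 p2 elo ehi [d|d].
  apply: span_eq (span_sub (span_prim k0 k1 k2 k3 p2) (span_prim k0 k1 k2 k3 p1)) => t l c.
  by rewrite /piece elo // ehi // max_r // d.
apply: span_eq span0 => t l c.
by rewrite /piece elo // ehi // max_l ?d // subrr.
Qed.

(* With [2 / (h + 1) <= t <= 2 / h], the wall [m * t / 2] is at most 1 exactly
   for [m <= h], up to equality; what remains is to compare the cuts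
   [q * l * t / 2] with the walls and with 1, that is, [l] with [m / q] and with
   [2 / (q * t)]. *)
Hypothesis h_gt0 : (0 < h)%N.
Hypothesis C_lo : forall t l, C t l -> 2 <= h.+1%:R * t.
Hypothesis C_hi : forall t l, C t l -> h%:R * t <= 2.
Hypothesis C_ratio : forall m q, (0 < m <= h)%N -> (0 < q <= h)%N ->
  decided (fun _ l => l) (fun _ _ => m%:R / q%:R).
Hypothesis C_hyp : forall q, (0 < q <= h)%N ->
  decided (fun _ l => l) (fun t _ => 2 / (q%:R * t)).

Let wall_le1 m t l : (m <= h)%N -> C t l -> m%:R * t / 2 <= 1.
Proof.
move=> mh c; have [t0 _] := C_gt0 c; have := C_hi c.
have : m%:R * t <= h%:R * t by rewrite ler_wpM2r ?(ltW t0) // ler_nat.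
lra.
Qed.

Let wall_ge1 m t l : (h < m)%N -> C t l -> 1 <= m%:R * t / 2.
Proof.
move=> mh c; have [t0 _] := C_gt0 c; have := C_lo c.
have : h.+1%:R * t <= m%:R * t by rewrite ler_wpM2r ?(ltW t0) // ler_nat.
lra.
Qed.

Let dec_cut_wall m q : (m <= h)%N -> (0 < q <= h)%N ->
  decided (place (CutAt q)) (place (WallAt m)).
Proof.
move=> mh qh; have /andP[q0 _] := qh; have q0R : 0 < q%:R :> R by rewrite ltr0n.
have [m0|m0] := posnP m.
  right=> t l /C_gt0[t0 l0]; rewrite /= m0 !mul0r.
  by rewrite mulr_ge0 // divr_ge0 // mulr_ge0 // ltW.
have cut (t l : R) : 0 < t -> (q%:R * (l * t / 2) <= m%:R * t / 2) = (l <= m%:R / q%:R).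
  move=> t0; rewrite [RHS]ler_pdivlMr // -[RHS](ler_pM2r t0).
  have -> : q%:R * (l * t / 2) = l * q%:R * t / 2 by ring.
  by rewrite [LHS]ler_pM2r ?invr_gt0 ?ltr0n.
have mh' : (0 < m <= h)%N by rewrite m0.
have [d|d] := C_ratio mh' qh; [left|right] => t l c; have [t0 _] := C_gt0 c.
  by rewrite /= cut // (d t l).
have := d t l c; rewrite /= le_eqVlt => /orP[/eqP e|lt].
  by rewrite -e le_eqVlt; apply/orP; left; apply/eqP; field; rewrite lt0r_neq0.
by rewrite ltW // ltNge cut // -ltNge.
Qed.

Let dec_cut_top q : (0 < q <= h)%N -> decided (place (CutAt q)) (place Top).
Proof.
move=> qh; have /andP[q0 _] := qh; have q0R : 0 < q%:R :> R by rewrite ltr0n.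
have cut (t l : R) : 0 < t -> (q%:R * (l * t / 2) <= 1) = (l <= 2 / (q%:R * t)).
  move=> t0; rewrite [RHS]ler_pdivlMr ?mulr_gt0 //.
  by apply/idP/idP; lra.
have cut' (t l : R) : 0 < t -> (1 <= q%:R * (l * t / 2)) = (2 / (q%:R * t) <= l).
  move=> t0; rewrite [RHS]ler_pdivrMr ?mulr_gt0 //.
  by apply/idP/idP; lra.
have [d|d] := C_hyp qh; [left|right] => t l c; have [t0 _] := C_gt0 c.
  by rewrite /= cut // (d t l).
by rewrite /= cut' // (d t l).
Qed.

Let span_half m q (k0 k1 k2 k3 : R) : (0 < q <= h)%N ->
  in_span (fun t l => piece k0 (k1 * t + k2 * (l * t)) (k3 * (l * t ^+ 2))
    (Num.max (m%:R * t / 2) (q%:R * (l * t / 2))) (Num.min (m.+1%:R * t / 2) 1)).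
Proof.
move=> qh; have /andP[q0 _] := qh.
have [mh|mh] := leqP m h; last first.
  apply: span_eq span0 => t l c; rewrite /piece max_l ?subrr //.
  apply: (@le_trans _ _ 1); first by rewrite ge_min lexx orbT.
  by rewrite le_max (wall_ge1 mh c).
have [phi pphi [ehi hiT]] : exists2 phi, proper phi &
   (forall t l, C t l -> Num.min (m.+1%:R * t / 2) 1 = place phi t l) /\
   (phi = Top \/ phi = WallAt m.+1 /\ (m.+1 <= h)%N).
  have [mh'|mh'] := leqP m.+1 h.
    exists (WallAt m.+1) => //; split; last by right.
    by move=> t l c; rewrite min_l //; exact: wall_le1 c.
  exists Top => //; split; last by left.
  by move=> t l c; rewrite min_r //; exact: wall_ge1 c.
have dec_cut_hi : decided (place (CutAt q)) (place phi).
  case: hiT => [->|[-> m1h]]; first exact: dec_cut_top.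
  exact: dec_cut_wall.
have wall_hi t l : C t l -> place (WallAt m) t l <= place phi t l.
  move=> c; have [t0 _] := C_gt0 c.
  case: hiT => [->|[-> m1h]]; first exact: wall_le1 c.
  by rewrite /= ler_pM2r ?invr_gt0 // ler_pM2r // ler_nat.
have [d|d] := dec_cut_wall mh qh; last first.
  apply: (@span_piece _ _ _ _ _ _ (CutAt q) phi) => // t l c.
  by rewrite max_r // d.
have [m0|m0] := posnP m.
  apply: (@span_piece _ _ _ _ _ _ (CutAt q) phi) => // t l c.
  have [t0 l0] := C_gt0 c.
  by rewrite max_r // m0 !mul0r mulr_ge0 // divr_ge0 // mulr_ge0 // ltW.
apply: (@span_piece _ _ _ _ _ _ (WallAt m) phi) => //.
  by move=> t l c; rewrite max_l // d.
by left.
Qed.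

Lemma span_tent n q (r0 s : R) : (0 < q <= h)%N ->
  in_span (fun t l => tent_piece t n (q%:R * (l * t / 2)) r0 (s * (l * t / 2))).
Proof.
move=> qh; rewrite /tent_piece.
apply: span_eq (span_add
  (span_half n (2 * r0) (- (n%:R * r0)) s (- (n%:R * s / 2)) qh)
  (span_half n.+1 (- (2 * r0)) (n.+2%:R * r0) (- s) (n.+2%:R * s / 2) qh)) => t l c.
by congr (piece _ _ _ _ _ + piece _ _ _ _ _); field.
Qed.

Lemma span_gap_value : in_span (fun t l => gap_value t l h).
Proof.
apply: span_scale; apply: span_sum => n; rewrite mem_index_iota => /andP[_ nh].
apply: span_sum => A; rewrite mem_index_iota => /andP[_ An].
apply: span_sum => a ha; rewrite /arc_value subnKC //.
have [n0|n0] := posnP n.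
  have h1 : (0 < 1 <= h)%N by [].
  apply: span_eq (span_tent 0 1 0 h1) => t l _.
  by rewrite /= mul1r mul0r.
have /and4P[/andP[q1 q1n] /andP[q2 q2n] _ _] := fareyP ha.
have mx : maxn n 1 = n by apply/maxn_idPl.
rewrite mx in q1n q2n.
have nh' : (n <= h)%N by [].
have q1h : (0 < a.1.2 <= h)%N by rewrite q1 (leq_trans q1n).
have q2h : (0 < a.2.2 <= h)%N by rewrite q2 (leq_trans q2n).
apply: span_eq (span_add
  (span_scale (ramp_r A (n - A) a) (span_tent n a.2.2%:R^-1 (-1) q2h))
  (span_scale (ramp_l A (n - A) a) (span_tent n a.1.2%:R^-1 (-1) q1h))) => t l _.
by rewrite !mulN1r.
Qed.

End Span.

(** * Breakpoints for t *)

Section Breakpoints.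
Context {R : realType}.
Implicit Types (x : R) (H : nat).

Fixpoint below_max x (d : R) (s : seq R) : R :=
  if s is r :: s' then
    let y := below_max x d s' in if (r < x) && (y < r) then r else y
  else d.

Lemma below_maxP x (d : R) (s : seq R) : d < x ->
  [/\ d <= below_max x d s < x, below_max x d s \in d :: s
    & forall r, r \in s -> r < x -> r <= below_max x d s].
Proof.
move=> dx; elim: s => [|r s [/andP[h1 h2] h3 h4]]; first by rewrite /= lexx dx inE eqxx.
rewrite /=; case: ifP => [/andP[rx yr]|c].
  split.
  - by rewrite rx (le_trans h1) // ltW.
  - by rewrite !inE eqxx orbT.
  - move=> r'; rewrite inE => /orP[/eqP->//|/h4 hr /hr h5].
    exact: le_trans h5 (ltW yr).
split; first by rewrite h1.
  by move: h3; rewrite !inE => /orP[->//|->]; rewrite !orbT.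
move=> r'; rewrite inE => /orP[/eqP-> rx|/h4//].
by move: c; rewrite rx /= => /negbT; rewrite -leNgt.
Qed.

(** Candidates for the breakpoints between [2 / (H + 1)] and [2 / H]; the bound on
    the numerators retains every fraction up to 2. *)
Definition small_rats H : seq R :=
  [seq a%:R / b%:R | a <- iota 0 (4 * H * H.+1).+1, b <- iota 1 (2 * H * H.+1)].

Lemma mem_small_rats H (a b : nat) : (a <= 4 * H * H.+1)%N ->
  (0 < b <= 2 * H * H.+1)%N -> a%:R / b%:R \in small_rats H.
Proof.
move=> ha hb; apply/allpairsP; exists (a, b); rewrite /fst /snd !mem_iota.
by split=> //; move: ha hb; lia.
Qed.

Lemma small_ratsP H x : x \in small_rats H -> exists r : rat,
  x = ratr r /\ denq r <= (2 * H * H.+1)%N%:Z.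
Proof.
case/allpairsP => -[a b]; rewrite /fst /snd !mem_iota => -[_ hb ->].
pose g := gcdn a b; have b0 : (0 < b)%N by move: hb; lia.
have g0 : (0 < g)%N by rewrite gcdn_gt0 b0 orbT.
have ag : (a %/ g * g)%N = a by rewrite divnK // dvdn_gcdl.
have bg : (b %/ g * g)%N = b by rewrite divnK // dvdn_gcdr.
have b'0 : (0 < b %/ g)%N by rewrite divn_gt0 // dvdn_leq // dvdn_gcdr.
exists ((a %/ g)%N%:Z%:~R / (b %/ g)%N%:Z%:~R); split.
  rewrite fmorph_div !rmorph_int /= -!pmulrn -{1}ag -{1}bg !natrM -mulf_div.
  by rewrite mulfV ?mulr1 // pnatr_eq0 -lt0n.
rewrite coprimeq_den.
  have gb : (b %/ g <= b)%N by exact: leq_div.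
  rewrite -[0]/(0%N%:Z) eqz_nat gtn_eqF // lez_nat.
  by case/andP: hb => _ hb; rewrite (leq_trans gb) // -ltnS.
rewrite !absz_nat /coprime -(eqn_pmul2r g0) muln_gcdl ag bg mul1n //.
Qed.

(** The number [H] with [2 / (H + 1) < x <= 2 / H]. *)
Definition level x : nat := Num.truncn (2 / x).

Lemma levelP x : 0 < x <= 2 ->
  [/\ (0 < level x)%N, 2 / (level x).+1%:R < x & x <= 2 / (level x)%:R].
Proof.
move=> /andP[x0 x2]; have h0 : 0 <= 2 / x by rewrite divr_ge0 // ltW.
have /andP[h1 h2] := truncn_itv h0; rewrite -/(level x) in h1 h2.
have l1 : (0 < level x)%N by rewrite truncn_gt0 ler_pdivlMr // mul1r.
split=> //.
  by rewrite ltr_pdivrMr // -ltr_pdivrMl // mulrC.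
by rewrite ler_pdivlMr ?ltr0n // -ler_pdivlMl // mulrC.
Qed.

(** The default [2 / (H + 1)] keeps a step within [2 / (H + 1), 2 / H], where [H]
    bounds the number of active rows; it is itself a candidate. *)
Definition next x : R := below_max x (2 / (level x).+1%:R) (small_rats (level x)).

Lemma nextP x : 0 < x <= 2 ->
  [/\ 2 / (level x).+1%:R <= next x < x, next x \in small_rats (level x)
    & forall r, r \in small_rats (level x) -> r < x -> r <= next x].
Proof.
move=> hx; have [l0 l1 l2] := levelP hx.
have [h1 h2 h3] := below_maxP (small_rats (level x)) l1; split=> //.
move: h2; rewrite inE -/(next x) => /orP[/eqP->|//].
by apply: (@mem_small_rats _ 2); move: l0; clear; nia.
Qed.

Fixpoint breakpoint (j : nat) : R := if j is k.+1 then next (breakpoint k) else 2.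

Lemma breakpoint_itv j : 0 < breakpoint j <= 2.
Proof.
elim: j => [|j IH]; first by rewrite /= lexx ltr0n.
have [/andP[h1 h2] _ _] := nextP IH; have /andP[_ h3] := IH.
rewrite /= (lt_le_trans _ h1) ?divr_gt0 //=.
exact: le_trans (ltW h2) h3.
Qed.

Lemma breakpoint_decr j : breakpoint j.+1 < breakpoint j.
Proof. by have [/andP[_ h] _ _] := nextP (breakpoint_itv j). Qed.

Lemma breakpoint_mono i j : (i <= j)%N -> breakpoint j <= breakpoint i.
Proof.
move=> /subnK <-; elim: (j - i)%N => [|k IH]; first by rewrite add0n.
by rewrite addSn (le_trans (ltW (breakpoint_decr _))).
Qed.

Lemma breakpoint_inj : injective breakpoint.
Proof.
have lt i j : (i < j)%N -> breakpoint j < breakpoint i.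
  by move=> /breakpoint_mono h; apply: le_lt_trans h (breakpoint_decr i).
move=> i j e; have [/lt|/lt|//] := ltngtP i j; by rewrite e ltxx.
Qed.

(** The breakpoints above [e] are distinct members of a finite list. *)
Lemma breakpoint_cvg : breakpoint j @[j --> \oo] --> (0 : R).
Proof.
apply/cvgrPdist_lt => e e0.
pose U : seq R := 2 :: flatten [seq small_rats H | H <- iota 0 (Num.truncn (2 / e)).+1].
exists (size U) => // j /= Uj; rewrite sub0r normrN.
have /andP[b0 _] := breakpoint_itv j; rewrite gtr0_norm // ltNge; apply/negP => ej.
have inU i : (i <= j)%N -> breakpoint i \in U.
  case: i => [_|i ij]; first by rewrite inE eqxx.
  rewrite inE; apply/orP; right; apply/flatten_mapP.
  have [h1 h2 _] := nextP (breakpoint_itv i).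
  exists (level (breakpoint i)) => //; rewrite mem_iota /= add0n ltnS.
  apply: le_truncn; rewrite ler_wpM2l // lef_pV2 ?posrE //.
    by apply: le_trans ej _; apply: breakpoint_mono; exact: ltnW.
  by have /andP[] := breakpoint_itv i.
have : (size [seq breakpoint i | i <- iota 0 j.+1] <= size U)%N.
  apply: uniq_leq_size; first by rewrite map_inj_uniq ?iota_uniq //; exact: breakpoint_inj.
  by move=> z /mapP[i]; rewrite mem_iota add0n ltnS => /andP[_ ij] ->; exact: inU.
by rewrite size_map size_iota ltnNge Uj.
Qed.

Lemma breakpoint_rat (h j : nat) : (0 < h)%N ->
  2 / h.+1%:R <= breakpoint j <= 2 / h%:R ->
  exists r : rat, breakpoint j = ratr r /\ denq r <= (2 * h * h.+1)%N%:Z.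
Proof.
move=> h0 /andP[hlo hhi]; have h0R : 0 < h%:R :> R by rewrite ltr0n.
case: j hlo hhi => [|j] hlo hhi.
  exists 2; rewrite ratr_nat; split=> //.
  have -> : denq (2 : rat) = 1 by [].
  by rewrite lez_nat !muln_gt0 h0.
have [/andP[_ h2] h3 _] := nextP (breakpoint_itv j).
have [_ _ l2] := levelP (breakpoint_itv j).
have [r [e d]] := small_ratsP h3; exists r; split=> //; apply: le_trans d _.
set H := level _ in h2 h3 l2 *.
have Hh : (H <= h)%N.
  have : 2 / h.+1%:R < 2 / H%:R :> R.
    by apply: le_lt_trans hlo _; exact: lt_le_trans h2 l2.
  rewrite ltr_pM2l // => lt; rewrite -ltnS -(ltr_nat R).
  have [H0|H0] := posnP H; first by rewrite H0 ltr0n.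
  by move: lt; rewrite ltf_pV2 ?posrE ?ltr0n.
by rewrite lez_nat !leq_mul.
Qed.

End Breakpoints.

(** * Thresholds for lambda *)

Section Cells.
Context {R : realType}.
Variables (H : nat) (x' x : R).
Hypotheses (H_gt0 : (0 < H)%N) (x'_lo : 2 / H.+1%:R <= x') (x'x : x' < x)
  (x_hi : x <= 2 / H%:R).
Hypothesis gap : forall r, r \in small_rats H -> r < x -> r <= x'.

(** Pairs of coefficients describe both kinds of thresholds, the constants [m / q]
    and the hyperbolas [2 / (q * t)], so that they can be sorted together. *)
Definition curve (f : R * R) (t : R) : R := f.1 + f.2 / t.

Definition curves : seq (R * R) :=
  [seq (m%:R / q%:R, 0) | m <- iota 1 H, q <- iota 1 H]
  ++ [seq (0, 2 / q%:R) | q <- iota 1 H].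

Let t0 := (x' + x) / 2.

(** Sorted at the midpoint [t0], the curves are sorted on all of [x', x]. *)
Definition sorted_curves : seq (R * R) :=
  sort (relpre (curve ^~ t0) <=%R) curves.

Definition curve_list : seq (R * R) := (0, 0) :: sorted_curves ++ [:: (0, 2)].

Definition threshold (i : nat) (t : R) : R := curve (nth (0, 2) curve_list i) t.

Let x'_gt0 : 0 < x'.
Proof. by apply: lt_le_trans x'_lo; rewrite divr_gt0. Qed.

Let t0_in : x' < t0 < x.
Proof. by have h := x'x; rewrite /t0; apply/andP; split; lra. Qed.

Let t_gt0 t : x' <= t -> 0 < t. Proof. exact: lt_le_trans. Qed.

Lemma curvesP f : f \in curves ->
  (exists m q : nat, [/\ (0 < m <= H)%N, (0 < q <= H)%N & f = (m%:R / q%:R, 0)])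
  \/ (exists2 q : nat, (0 < q <= H)%N & f = (0, 2 / q%:R)).
Proof.
rewrite mem_cat => /orP[/allpairsP[[m q]]|/mapP[q]].
  rewrite /fst /snd !mem_iota !add1n !ltnS => -[hm hq ->].
  by left; exists m, q.
by rewrite mem_iota add1n ltnS => hq ->; right; exists q.
Qed.

Lemma mem_curves_const m q : (0 < m <= H)%N -> (0 < q <= H)%N ->
  (m%:R / q%:R, 0) \in curves.
Proof.
move=> hm hq; rewrite mem_cat; apply/orP; left; apply/allpairsP; exists (m, q).
by rewrite /fst /snd !mem_iota !add1n !ltnS.
Qed.

Lemma mem_curves_hyp q : (0 < q <= H)%N -> (0, 2 / q%:R) \in curves.
Proof.
move=> hq; rewrite mem_cat; apply/orP; right; apply/mapP; exists q => //.
by rewrite mem_iota add1n ltnS.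
Qed.

(** A constant and a hyperbola of the family cross at a small rational, hence
    not between consecutive breakpoints. *)
Lemma curves_order f g t : f \in curves -> g \in curves ->
  curve f t0 <= curve g t0 -> x' <= t <= x -> curve f t <= curve g t.
Proof.
move=> /curvesP hf /curvesP hg hfg /andP[x't tx].
have tp := t_gt0 x't; have /andP[t01 t02] := t0_in; have t0p := t_gt0 (ltW t01).
have cross m q q' : (0 < m <= H)%N -> (0 < q <= H)%N -> (0 < q' <= H)%N ->
    ((2 * q)%:R / (m * q')%:R : R) \in small_rats H.
  move=> /andP[m0 mH] /andP[q0 qH] /andP[q'0 q'H]; apply: mem_small_rats.
    by apply: (@leq_trans (2 * H)); [rewrite leq_mul2l|rewrite -mulnA leq_mul // leq_pmulr].
  rewrite muln_gt0 m0 q'0 /=; apply: (@leq_trans (H * H)); first by rewrite leq_mul.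
  by rewrite -mulnA mulnCA leq_mul // (leq_trans (leqnSn H)) // leq_pmull.
have cmp m q q' (s : R) : (0 < m <= H)%N -> (0 < q <= H)%N -> (0 < q' <= H)%N -> 0 < s ->
    (m%:R / q%:R <= 2 / q'%:R / s) = (s <= (2 * q)%:R / (m * q')%:R).
  move=> /andP[m0 _] /andP[q0 _] /andP[q'0 _] s0.
  have [mR qR q'R] : [/\ 0 < m%:R :> R, 0 < q%:R :> R & 0 < q'%:R :> R] by rewrite !ltr0n.
  rewrite !natrM [RHS]ler_pdivlMr ?mulr_gt0 //.
  have D0 : 0 < (q%:R * q'%:R * s)^-1 by rewrite invr_gt0 !mulr_gt0.
  rewrite -[RHS](ler_pM2r D0); congr (_ <= _); field; by rewrite !lt0r_neq0.
have cmp' m q q' (s : R) : (0 < m <= H)%N -> (0 < q <= H)%N -> (0 < q' <= H)%N -> 0 < s ->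
    (2 / q'%:R / s <= m%:R / q%:R) = ((2 * q)%:R / (m * q')%:R <= s).
  move=> /andP[m0 _] /andP[q0 _] /andP[q'0 _] s0.
  have [mR qR q'R] : [/\ 0 < m%:R :> R, 0 < q%:R :> R & 0 < q'%:R :> R] by rewrite !ltr0n.
  rewrite !natrM [RHS]ler_pdivrMr ?mulr_gt0 //.
  have D0 : 0 < (q%:R * q'%:R * s)^-1 by rewrite invr_gt0 !mulr_gt0.
  rewrite -[RHS](ler_pM2r D0); congr (_ <= _); field; by rewrite !lt0r_neq0.
move: hfg; case: hf => [[m [q [hm hq ->]]]|[q hq ->]];
case: hg => [[m' [q' [hm' hq' ->]]]|[q' hq' ->]]; rewrite /curve /= ?mul0r ?addr0 ?add0r //.
- rewrite !cmp // => h1; rewrite leNgt; apply/negP => h2.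
  by have := gap (cross _ _ _ hm hq hq') (lt_le_trans h2 tx); lra.
- rewrite !cmp' // => h1; apply: le_trans x't.
  by apply: gap; [exact: cross|exact: le_lt_trans h1 t02].
- by rewrite !ler_pM2r ?invr_gt0.
Qed.

Lemma curves_bounds f t : f \in curves -> x' <= t <= x -> 0 <= curve f t <= 2 / t.
Proof.
move=> /curvesP hf /andP[x't tx]; have tp := t_gt0 x't.
have H0R : 0 < H%:R :> R by rewrite ltr0n.
have th : H%:R <= 2 / t by rewrite ler_pdivlMr // mulrC -ler_pdivlMr // (le_trans tx).
case: hf => [[m [q [/andP[m0 mH] /andP[q0 qH] ->]]]|[q /andP[q0 qH] ->]]; rewrite /curve /=.
  rewrite mul0r addr0 divr_ge0 //=; apply: le_trans th.
  rewrite ler_pdivrMr ?ltr0n //; apply: (@le_trans _ _ H%:R); first by rewrite ler_nat.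
  by rewrite ler_peMr ?ler1n.
rewrite add0r !divr_ge0 ?(ltW tp) //= ler_pM2r ?invr_gt0 //.
by rewrite ler_pdivrMr ?ltr0n // ler_peMr // ler1n.
Qed.

Let M := size sorted_curves.

Let mem_sorted f : (f \in sorted_curves) = (f \in curves).
Proof. by rewrite mem_sort. Qed.

Lemma threshold0 t : threshold 0 t = 0.
Proof. by rewrite /threshold /curve /= mul0r addr0. Qed.

Lemma threshold_last t : threshold M.+1 t = 2 / t.
Proof. by rewrite /threshold /= nth_cat ltnn subnn /= /curve add0r. Qed.

Let threshold_mid i t : (i < M)%N ->
  threshold i.+1 t = curve (nth (0, 2) sorted_curves i) t.
Proof. by move=> h; rewrite /threshold /= nth_cat h. Qed.

Lemma threshold_mono i k t : (i <= k <= M.+1)%N -> x' <= t <= x ->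
  threshold i t <= threshold k t.
Proof.
move=> /andP[ik kM] ht; have mid j : (j < M)%N -> nth (0, 2) sorted_curves j \in curves.
  by move=> jM; rewrite -mem_sorted mem_nth.
have t2 : 0 <= 2 / t by have /andP[h _] := ht; rewrite divr_ge0 // ltW // t_gt0.
case: i ik => [_|i ik].
  rewrite threshold0; case: k kM => [|k kM]; first by rewrite threshold0.
  have [h|h] := ltnP k M.
    by rewrite threshold_mid //; have /andP[] := curves_bounds (mid _ h) ht.
  have -> : k = M by apply/eqP; rewrite eqn_leq h andbT.
  by rewrite threshold_last.
case: k ik kM => // k; rewrite !ltnS => ik kM.
have [h|h] := ltnP k M; last first.
  have -> : k = M by apply/eqP; rewrite eqn_leq h andbT.
  rewrite threshold_last; have [h'|h'] := ltnP i M.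
    by rewrite threshold_mid //; have /andP[] := curves_bounds (mid _ h') ht.
  have -> : i = M by apply/eqP; rewrite eqn_leq h' andbT (leq_trans ik).
  by rewrite threshold_last.
have iM : (i < M)%N := leq_ltn_trans ik h.
rewrite !threshold_mid //; apply: curves_order => //; try exact: mid.
have tr : transitive (relpre (curve ^~ t0) (<=%R : rel R)).
  by move=> a b c; exact: le_trans.
have rf : reflexive (relpre (curve ^~ t0) (<=%R : rel R)) by move=> a; exact: lexx.
have ss : sorted (relpre (curve ^~ t0) <=%R) sorted_curves.
  by apply: sort_sorted => a b; exact: le_total.
by apply: (sorted_leq_nth tr rf (0, 2) ss); rewrite ?inE.
Qed.

Section Cell.
Variable i : nat.
Hypothesis iM : (i <= M)%N.

Definition cell (t l : R) : Prop :=
  [/\ x' <= t <= x, threshold i t <= l <= threshold i.+1 t & 0 < l].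

(** A cell lies between two consecutive curves. *)
Lemma cell_decided f : f \in curves -> decided cell (fun _ l => l) (fun t _ => curve f t).
Proof.
rewrite -mem_sorted => /(nthP (0, 2))[k kM <-].
have [ik|ki] := leqP i k; [left|right] => t l [ht /andP[l1 l2] _].
  apply: le_trans l2 _; rewrite -threshold_mid //; apply: threshold_mono => //.
  by rewrite !ltnS ik ltnW.
apply: le_trans l1; rewrite -threshold_mid //; apply: threshold_mono => //.
by rewrite ki leqW.
Qed.

Lemma cell_span : in_span cell (fun t l => gap_value t l H).
Proof.
have H0R : 0 < H%:R :> R by rewrite ltr0n.
apply: span_gap_value => //.
- by move=> t l [/andP[h _] _ l0]; split=> //; exact: t_gt0 h.
- move=> t l [/andP[h _] _ _]; rewrite mulrC -ler_pdivrMr ?ltr0n //.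
  exact: le_trans h.
- move=> t l [/andP[_ h] _ _]; rewrite mulrC -ler_pdivlMr //.
  exact: le_trans x_hi.
- move=> m q hm hq; have := cell_decided (mem_curves_const hm hq).
  by case=> d; [left|right] => t l c; have := d t l c; rewrite /curve mul0r addr0.
- move=> q hq; have := cell_decided (mem_curves_hyp hq).
  by case=> d; [left|right] => t l c; have := d t l c; rewrite /curve add0r invfM mulrA.
Qed.

End Cell.
End Cells.

Theorem theorem2p3 (R : realType) :
  exists T : nat -> R,
    [/\ T 0%N = 2,
        (forall j : nat, T j.+1 < T j),
        T j @[j --> \oo] --> (0 : R),
        (forall h j : nat, (0 < h)%N ->
           2 / h.+1%:R <= T j <= 2 / h%:R ->
           exists r : rat,
             T j = ratr r /\ denq r <= (2 * h * h.+1)%N%:Z)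
      & forall j : nat, exists (M : nat) (Lam : nat -> R -> R),
          (forall t : R, T j.+1 <= t <= T j ->
             [/\ Lam 0%N t = 0,
                 (forall i : nat, (i <= M)%N -> Lam i t <= Lam i.+1 t)
               & Lam M.+1 t = 2 / t])
          /\
          (forall i : nat, (i <= M)%N ->
             exists k1 k2 k3 k4 k5 k6 k7 k8 : R,
               forall t lambda : R,
                 T j.+1 <= t <= T j ->
                 Lam i t <= lambda <= Lam i.+1 t ->
                 0 < lambda ->
                 cvgn (fun J : nat => gap_distr t lambda J) /\
                 limit_gap_distr t lambda =
                   k1 + k2 * t + k3 * (lambda * t) + k4 * (lambda * t ^+ 2)
                   + k5 * (t * ln lambda) + k6 * (lambda * t * ln lambda)
                   + k7 * (t * ln t) + k8 * (lambda * t * ln t))].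
Proof.
exists (@breakpoint R); split=> //.
- exact: breakpoint_decr.
- exact: breakpoint_cvg.
- exact: breakpoint_rat.
move=> j; pose x := @breakpoint R j; pose x' := @breakpoint R j.+1.
have x_itv : 0 < x <= 2 := breakpoint_itv j.
have [/andP[lo x'x] _ gap] := nextP x_itv.
have [H0 _ hi] := levelP x_itv.
pose H := level x; exists (size (sorted_curves H x' x)), (threshold H x' x).
split=> [t ht|i iM].
  split; [exact: threshold0| |exact: threshold_last].
  move=> i iM; apply: threshold_mono => //.
  by rewrite leqnSn ltnS.
have [k hk] := cell_span H0 lo x'x hi gap iM.
exists k`_0, k`_1, k`_2, k`_3, k`_4, k`_5, k`_6, k`_7 => t lam ht hlam lam0.
have /andP[x'0 _] : 0 < x' <= 2 := breakpoint_itv j.+1.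
have t0 : 0 < t by case/andP: ht => h _; exact: lt_le_trans x'0 h.
have hHt : 2 <= H.+1%:R * t.
  by case/andP: ht => h _; rewrite mulrC -ler_pdivrMr ?ltr0n // (le_trans lo).
have cv := gap_distr_cvg t0 lam0 hHt.
split; first exact: cvgP cv.
rewrite /limit_gap_distr (cvg_lim _ cv) //.
exact: hk.
Qed.
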